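(* Let $a\in\mathbb{C}$ and $f_a(z)=e^z+a$. Suppose that $z_0$ is an endpoint of $f_a$ that is accessible from $I(f_a)$ in at least three different ways; that is, there are three arcs in $I(f_a)\cup\{z_0\}$ that contain $z_0$ and are otherwise pairwise disjoint. Then $z_0$ is eventually periodic under $f_a$.
   Context: For $a\in\mathbb{C}$, $f_a\colon\mathbb{C}\to\mathbb{C}$, $f_a(z)=e^z+a$. $I(f_a)=\{z\in\mathbb{C}: f_a^n(z)\to\infty\}$ is the escaping set. An arc is an injective continuous image of a (nondegenerate) compact interval. A point $z_0\in\mathbb{C}$ is on a hair if there is an arc $\gamma\colon[-1,1]\to I(f_a)$ with $\gamma(0)=z_0$. A point $z_0\in\mathbb{C}$ is an endpoint if $z_0$ is not on a hair and there is an arc $\gamma\colon[0,1]\to\mathbb{C}$ with $\gamma(0)=z_0$ and $\gamma(t)\in I(f_a)$ for all $t>0$. A point is eventually periodic if some iterate $f_a^k(z_0)$, $k\ge0$, is a periodic point. *)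

(* Defs.v *)
From HB Require Import structures.
From mathcomp Require Import all_boot all_order all_algebra.
From mathcomp Require Import complex.
From mathcomp Require Import all_classical all_reals all_analysis.
Set Implicit Arguments.
Unset Strict Implicit.
Unset Printing Implicit Defensive.
Import Order.TTheory GRing.Theory Num.Theory.
Import numFieldNormedType.Exports.
Local Open Scope classical_set_scope.
Local Open Scope ring_scope.
Local Open Scope complex_scope.

(** The complex plane is [R[i]] for [R : realType]. It gets the norm topology
    that the regular module [K^o] carries over any [K : numFieldType]. *)
HB.instance Definition _ (R : rcfType) := PseudoMetricNormedZmod.copy R[i] R[i]^o.

(* Euler's formula: e^(x + iy) = e^x (cos y + i sin y). *)
Definition cexp (R : realType) (z : R[i]) : R[i] :=
  (expR (complex.Re z))%:C * (cos (complex.Im z) +i* sin (complex.Im z)).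

Definition expmap (R : realType) (a z : R[i]) : R[i] := cexp z + a.

(* The norm of [R[i]] is [R[i]]-valued, with values in the nonnegative reals;
   the neighbourhoods of [+oo] in [R[i]] are the sets containing all real
   [x > M] for some real [M], so this says that the moduli tend to infinity. *)
Definition escaping_set (R : realType) (a : R[i]) : set R[i] :=
  [set z | `|iter n (expmap a) z| @[n --> \oo] --> +oo].

Definition arc_on (R : realType) (c d : R) (g : R -> R[i]) : Prop :=
  {within `[c, d], continuous g} /\ set_inj `[c, d] g.

Definition is_arc (R : realType) (A : set R[i]) : Prop :=
  exists (c d : R) (g : R -> R[i]),
    [/\ c < d, arc_on c d g & A = g @` `[c, d]].

Definition on_hair (R : realType) (a z0 : R[i]) : Prop :=
  exists g : R -> R[i],
    [/\ arc_on (-1) 1 g, g @` `[-1, 1] `<=` escaping_set a & g 0 = z0].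

Definition is_endpoint (R : realType) (a z0 : R[i]) : Prop :=
  ~ on_hair a z0 /\
  exists g : R -> R[i],
    [/\ arc_on 0 1 g, g 0 = z0 & g @` `]0, 1] `<=` escaping_set a].

Definition accessible_three_ways (R : realType) (a z0 : R[i]) : Prop :=
  exists A : 'I_3 -> set R[i],
    (forall i, [/\ is_arc (A i), A i `<=` escaping_set a `|` [set z0]
                 & A i z0]) /\
    (forall i j, i != j -> A i `&` A j = [set z0]).

Definition periodic_point (R : realType) (a z : R[i]) : Prop :=
  exists2 p : nat, (0 < p)%N & iter p (expmap a) z = z.

Definition eventually_periodic (R : realType) (a z0 : R[i]) : Prop :=
  exists k : nat, periodic_point a (iter k (expmap a) z0).

(* Main.v *)
(* An endpoint that escaped would lie on the union of two of the arcs, hence on a hair; so z0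
   does not escape, and the three arcs are hairs landing at z0.

   A Baire argument shows that escape is locally uniform along arcs in I(f), so every hair
   eventually has an itinerary with respect to the strips |Im z - 2 k pi| < pi / 2.  Among
   orbits with the same itinerary f expands, which orders them by speed; two hairs with
   eventually equal itineraries are then eventually mapped onto each other near their landing
   points.  If z0 is not eventually periodic, injectivity of f near z0 shows that the
   itineraries of the three hairs and of their forward images pairwise differ infinitely often.

   For (n, k) <> (m, l), the triods formed by the three hairs at f^n(z0) + 2 k pi i and at
   f^m(z0) + 2 l pi i are disjoint, so a winding number argument shows that their itineraries
   do not interlace in the lexicographic order.  This is a symbolic wandering triangle, which a
   descent in the style of Thurston excludes. *)
Require Import Defs.
From mathcomp Require Import all_boot all_order all_algebra.
From mathcomp Require Import complex.
From mathcomp Require Import all_classical all_reals all_analysis.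
From mathcomp Require Import ring lra zify.
Set Implicit Arguments.
Unset Strict Implicit.
Unset Printing Implicit Defensive.
Import Order.TTheory GRing.Theory Num.Theory.
Import numFieldNormedType.Exports.
Local Open Scope classical_set_scope.
Local Open Scope ring_scope.
Local Open Scope complex_scope.

(** Two obstacles shape the proof. Nothing is known about how fast the points of an arc escape, so
    orbits are compared coarsely: under a common itinerary a lead of 4 in real part persists and,
    once exceeded, grows without bound, whence never falling more than 4 behind is a total order
    whose only ties are equalities. In the other direction [pullback] carries a comparison at a late
    time back to early times, at a cost of 4 in real part however many steps are taken. The levels
    [m0 + 50] to [m0 + 80] leave room for a few such losses.

    The other obstacle is planar separation, which is done without Jordan curves and without hairs
    that reach infinity. A point with an itinerary is joined to the far right by a tail, a
    horizontal ray pulled back finitely often; compactness makes a finite depth suffice. The side on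
    which a tail passes a point is read off from a continuous argument along the tail, and
    [W_transport] says that winding cannot change while the point moves off the path. *)

Local Notation re := complex.Re.
Local Notation im := complex.Im.

(** * Continuous functions on an interval *)

Lemma int_norm_lt1 (k l : int) : `|k - l| < 1 -> k = l.
Proof. by lia. Qed.

Section RealPaths.
Variable R : realType.
Implicit Types (g h : R -> R) (t u e : R).

Lemma cts_ball g : continuous g <->
  forall t e, 0 < e -> exists2 d, 0 < d & forall u, `|u - t| < d -> `|g u - g t| < e.
Proof.
split=> [cg t e e0|H t].
  have /cvgrPdist_lt /(_ e e0) [d /= d0 D] := cg t.
  exists d => // u ud; rewrite distrC; apply: D => /=.
  by rewrite distrC.
apply/cvgrPdist_lt => e e0; have [d d0 D] := H t e e0.
exists d => //= u /= ud; rewrite distrC; apply: D; by rewrite distrC.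
Qed.

Lemma cts_add g h : continuous g -> continuous h -> continuous (fun t => g t + h t).
Proof. by move=> cg ch t; apply: continuousD; [exact: cg|exact: ch]. Qed.

Lemma cts_opp g : continuous g -> continuous (fun t => - g t).
Proof. by move=> cg t; apply: continuousN; exact: cg. Qed.

Lemma cts_sub g h : continuous g -> continuous h -> continuous (fun t => g t - h t).
Proof. by move=> cg ch; apply: cts_add => //; exact: cts_opp. Qed.

Lemma cts_mul g h : continuous g -> continuous h -> continuous (fun t => g t * h t).
Proof. by move=> cg ch t; apply: cvgM; [exact: cg|exact: ch]. Qed.

Lemma cts_cst (c : R) : continuous (fun _ : R => c).
Proof. by move=> t; exact: cst_continuous. Qed.

Lemma cts_id : continuous (fun t : R => t).
Proof. by move=> t; exact: cvg_id. Qed.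

Lemma cts_comp g h : continuous g -> continuous h -> continuous (fun t => g (h t)).
Proof. by move=> cg ch t; apply: (@continuous_comp _ _ _ h g); [exact: ch|exact: cg]. Qed.

Lemma cts_div g h : continuous g -> continuous h -> (forall t, h t != 0) ->
  continuous (fun t => g t / h t).
Proof.
move=> cg ch h0 t; apply: cvgM; first exact: cg.
by apply: cvgV; [exact: h0|exact: ch].
Qed.

Lemma cts_norm g : continuous g -> continuous (fun t => `|g t|).
Proof. by move=> cg; apply: cts_comp => //; exact: norm_continuous. Qed.

(** Composing with this retraction onto [0, 1] lets all paths be continuous on the whole line; the
    closed formula makes its own continuity immediate. *)
Definition clamp t : R := (`|t| - `|t - 1| + 1) / 2.

Lemma clamp_cts : continuous clamp.
Proof.
apply: cts_mul; last exact: cts_cst.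
apply: cts_add; last exact: cts_cst.
apply: cts_sub; apply: cts_norm; first exact: cts_id.
by apply: cts_sub; [exact: cts_id|exact: cts_cst].
Qed.

Lemma clamp_id t : 0 <= t <= 1 -> clamp t = t.
Proof. by move=> ?; rewrite /clamp ger0_norm ?ler0_norm; lra. Qed.

Lemma clamp_le0 t : t <= 0 -> clamp t = 0.
Proof. by move=> ?; rewrite /clamp !ler0_norm; lra. Qed.

Lemma clamp_ge1 t : 1 <= t -> clamp t = 1.
Proof. by move=> ?; rewrite /clamp !ger0_norm; lra. Qed.

Lemma clamp01 t : 0 <= clamp t <= 1.
Proof.
case: (lerP t 0) => t0; first by rewrite clamp_le0 //; lra.
case: (lerP t 1) => t1; first by rewrite clamp_id; lra.
by rewrite clamp_ge1; lra.
Qed.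

(** Connectedness of [0, 1]. The hypothesis is symmetric in [u] and [v], so it passes to the
    negation of [S], which justifies the reduction to [s <= t]. *)
Lemma real_induction (S : R -> Prop) :
  (forall t, 0 <= t <= 1 -> exists2 d, 0 < d & forall u v, 0 <= u <= 1 -> 0 <= v <= 1 ->
    `|u - t| < d -> `|v - t| < d -> S u -> S v) ->
  forall s t, 0 <= s <= 1 -> 0 <= t <= 1 -> S s -> S t.
Proof.
move=> H s t s01 t01 Ss; apply: contrapT => nSt.
wlog st : s t s01 t01 S H Ss nSt / s <= t.
  move=> W; case: (lerP s t) => [|/ltW] st; first exact: (W s t s01 t01 S).
  apply: (W t s t01 s01 (fun x => ~ S x)) => // x x01.
  have [d d0 D] := H x x01; exists d => // u v u01 v01 ud vd nu Sv.
  by apply: nu; exact: (D v u).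
pose A : set R := [set x | s <= x <= t /\ S x].
have As : A s by split=> //; lra.
have bA : has_ubound A by exists t => x [] /andP[].
have supA : has_sup A by split; [exists s|].
set m := sup A.
have sm : s <= m by apply: ub_le_sup.
have mt : m <= t by apply: ge_sup; [exists s|move=> x [] /andP[]].
have [d d0 D] := H m ltac:(lra).
have [x [/andP[sx xt] Sx] mx] := sup_adherent d0 supA.
have xm : x <= m by apply: ub_le_sup => //; split; [lra|].
have Sm : S m by apply: (D x m); rewrite ?subrr ?normr0 //; try lra; rewrite ltr_norml; rewrite -/m in mx; lra.
have mlt : m < t by rewrite lt_neqAle mt andbT; apply/eqP => E; apply: nSt; rewrite -E.
pose y := m + Num.min (d / 2) (t - m).
have y1 : m < y by rewrite /y ltrDl lt_min; lra.
have y2 : y <= t by rewrite /y -lerBrDl ge_min lexx orbT.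
have y3 : y - m < d by rewrite /y addrAC subrr add0r gt_min; lra.
have Sy : S y by apply: (D m y) => //; rewrite ?subrr ?normr0 //; try lra; rewrite ltr_norml; lra.
have : y <= m by apply: ub_le_sup => //; split; [lra|].
lra.
Qed.

Lemma cluster01 (x : nat -> R) : (forall n, 0 <= x n <= 1) ->
  exists2 t, 0 <= t <= 1 & forall d N, 0 < d -> exists2 n, (N <= n)%N & `|x n - t| < d.
Proof.
move=> x01; apply: contrapT => nH.
have H t : 0 <= t <= 1 -> exists d N, 0 < d /\ forall n, (N <= n)%N -> d <= `|x n - t|.
  move=> t01; apply: contrapT => nt; apply: nH; exists t => // d N d0.
  apply: contrapT => nd; apply: nt; exists d, N; split=> // n Nn.
  by rewrite leNgt; apply/negP => xd; apply: nd; exists n.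
pose S u := exists N, forall n, (N <= n)%N -> u < x n.
have S1 : ~ S 1 by case=> N /(_ N (leqnn _)); have := x01 N; lra.
(* Without a cluster point, lying below almost all terms is a locally constant property, true at 0
   and false at 1. The second disjunct includes 0, which terms may equal. *)
pose S' u := S u \/ u = 0 /\ exists N, forall n, (N <= n)%N -> u <= x n.
have S0' : S' 0 by right; split=> //; exists 0%N => n _; have := x01 n; lra.
have : S' 1.
  apply: (@real_induction S' _ 0 1) => //; try lra.
  move=> t t01; have [d [N [d0 D]]] := H t t01; exists (d / 2); first lra.
  move=> u v u01 v01; rewrite !ltr_norml => ut vt Su.
  have {Su} [M HM] : exists N, forall n, (N <= n)%N -> u <= x n.
    by case: Su => [[M HM]|[_ //]]; exists M => n /HM; lra.
  left; exists (maxn N M) => n; rewrite geq_max => /andP[Nn Mn].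
  have := D n Nn; have := HM n Mn.
  by case: (lerP 0 (x n - t)) => h; [rewrite ger0_norm //|rewrite ltr0_norm //]; lra.
by case=> // -[]; lra.
Qed.

Lemma ivt01 g (p q v : R) : p <= q -> continuous g -> g p <= v <= g q \/ g q <= v <= g p ->
  exists2 c, p <= c <= q & g c = v.
Proof.
move=> pq cg H.
have [|c] := @IVT R g p q v pq (continuous_subspaceT cg); last by rewrite in_itv /=; exists c.
by rewrite ge_min le_max; case: H => /andP[-> ->]; rewrite ?orbT.
Qed.

Lemma max01 g (p q : R) : p <= q -> continuous g ->
  exists2 c, p <= c <= q & forall t, p <= t <= q -> g t <= g c.
Proof.
move=> pq cg; have [c] := EVT_max pq (continuous_subspaceT cg).
by rewrite in_itv /= => ? H; exists c => // t ?; apply: H; rewrite in_itv.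
Qed.

Lemma min01 g (p q : R) : p <= q -> continuous g ->
  exists2 c, p <= c <= q & forall t, p <= t <= q -> g c <= g t.
Proof.
move=> pq cg; have [c] := EVT_min pq (continuous_subspaceT cg).
by rewrite in_itv /= => ? H; exists c => // t ?; apply: H; rewrite in_itv.
Qed.

Lemma cts_pos g t : continuous g -> 0 < g t ->
  exists2 d, 0 < d & forall u, `|u - t| < d -> 0 < g u.
Proof.
move=> /cts_ball cg g0; have [d d0 D] := cg t _ g0.
by exists d => // u /D; rewrite ltr_norml; lra.
Qed.

Lemma discrete_cst g (p : R) : 0 < p -> continuous g ->
  (forall t, 0 <= t <= 1 -> exists k : int, g t = k%:~R * p) ->
  forall t, 0 <= t <= 1 -> g t = g 0.
Proof.
move=> p0 /cts_ball cg H t t01.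
apply: (@real_induction (fun x => g x = g 0) _ 0 t) => //; last lra.
move=> x x01; have [d d0 D] := cg x (p / 2) ltac:(lra).
exists d => // u v u01 v01 /D gu /D gv <-.
have [ku Eu] := H u u01; have [kv Ev] := H v v01.
move: gu gv; rewrite !ltr_norml Eu Ev => gu gv.
have h : `|(kv - ku)%:~R : R| * p < p.
  rewrite -[X in _ * X]ger0_norm ?(ltW p0) // -normrM intrB mulrBl ltr_norml; lra.
have : `|(kv - ku)%:~R : R| < 1 by rewrite -(ltr_pM2r p0) mul1r.
rewrite -intr_norm -[1]/(1%:~R) ltr_int => {}h.
by have -> := int_norm_lt1 h.
Qed.

End RealPaths.

(** * Winding of a path around a point *)

Section Winding.
Variable R : realType.
Implicit Types (P Q : R -> R[i]) (q z : R[i]) (x y t u c : R).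

(** Coordinatewise, so that real analysis suffices; [cpath_of_arc] and [cts_of_cpath] translate from
    and to the topology of [R[i]]. *)
Definition cpath P := continuous (fun t => re (P t)) /\ continuous (fun t => im (P t)).

Lemma Cext z q : re z = re q -> im z = im q -> z = q.
Proof. by case: z => ? ?; case: q => ? ? /= -> ->. Qed.

Lemma cosDnat x n : cos (x + n%:R * (2 * pi)) = cos x.
Proof. by rewrite mulr_natl [2 * pi]mulr_natl (periodicn (@cosD2pi R)). Qed.

Lemma sinDnat x n : sin (x + n%:R * (2 * pi)) = sin x.
Proof. by rewrite mulr_natl [2 * pi]mulr_natl (periodicn (@sinD2pi R)). Qed.

Lemma cosDint x (k : int) : cos (x + k%:~R * (2 * pi)) = cos x.
Proof.
case: k => n; first exact: cosDnat.
by rewrite NegzE mulrNz mulNr -[LHS](cosDnat _ n.+1) subrK.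
Qed.

Lemma sinDint x (k : int) : sin (x + k%:~R * (2 * pi)) = sin x.
Proof.
case: k => n; first exact: sinDnat.
by rewrite NegzE mulrNz mulNr -[LHS](sinDnat _ n.+1) subrK.
Qed.

Lemma round_pi x : exists k : int, - pi <= x - k%:~R * (2 * pi) < pi.
Proof.
have p0 := @pi_gt0 R; pose y := (x + pi) / (2 * pi).
have Ey : y * (2 * pi) = x + pi by rewrite divfK // mulf_neq0 // ?gt_eqF // pnatr_eq0.
exists (Num.floor y).
have /andP[h1 h2] := real_floor_itv (num_real y).
have {}h1 : (Num.floor y)%:~R * (2 * pi) <= y * (2 * pi) by rewrite ler_pM2r //; lra.
have {}h2 : y * (2 * pi) < (Num.floor y + 1)%:~R * (2 * pi) by rewrite ltr_pM2r //; lra.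
rewrite intrD mulrDl in h2; lra.
Qed.

Lemma cos_eq1 x : cos x = 1 -> exists k : int, x = k%:~R * (2 * pi).
Proof.
move=> cx; have [k K] := round_pi x; exists k; apply/eqP; rewrite -subr_eq0 -normr_eq0.
apply/eqP; apply: (@cos_inj R); rewrite ?in_itv /= ?normr_ge0 ?lexx ?pi_ge0 //.
  rewrite ler_norml; lra.
by rewrite cos_norm cos0 -[LHS](cosDint _ k) subrK.
Qed.

Lemma cos_gt0_near x : `|x| < pi -> 0 < cos x -> `|x| < pi / 2.
Proof.
move=> xp; rewrite -cos_norm => cx; rewrite ltNge; apply/negP => h.
have : cos `|x| <= cos (pi / 2).
  have p0 := @pi_gt0 R.
  rewrite le_eqVlt; case: (ltrgtP (pi / 2) `|x|) h => // [h|->] _; last by rewrite eqxx.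
  by apply/orP; right; rewrite ltr_cos ?in_itv /=; rewrite ?normr_ge0; lra.
by rewrite cos_pihalf; lra.
Qed.

Definition isarg t x y := exists2 r, 0 < r & x = r * cos t /\ y = r * sin t.

Lemma isarg_pos x y : 0 < x -> isarg (atan (y / x)) x y.
Proof.
move=> x0; set z := y / x; set s := Num.sqrt (1 + z ^+ 2).
have s0 : 0 < s by rewrite sqrtr_gt0; have := sqr_ge0 z; lra.
have cE : cos (atan z) = s^-1 by rewrite cos_atan.
have c0 : cos (atan z) != 0 by rewrite cE invr_eq0 gt_eqF.
exists (x * s); first by rewrite mulr_gt0.
split; first by rewrite cE mulfK // gt_eqF.
have -> : sin (atan z) = z / s.
  by rewrite -cE -{2}(atanK z) /tan divfK.
by rewrite mulrACA mulfV ?gt_eqF // mulr1 /z mulrC divfK // gt_eqF.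
Qed.

Lemma isarg_mul t u x y x' y' : isarg t x y -> isarg u x' y' ->
  isarg (t + u) (x * x' - y * y') (x * y' + y * x').
Proof.
move=> [r r0 [-> ->]] [s s0 [-> ->]]; exists (r * s); first by rewrite mulr_gt0.
rewrite cosD sinD; split; ring.
Qed.

Lemma isarg_scale t x y c : 0 < c -> isarg t (c * x) (c * y) -> isarg t x y.
Proof.
move=> c0 [r r0 [h1 h2]]; exists (r / c); first by rewrite divr_gt0.
have c0' : c != 0 by rewrite gt_eqF.
split; [rewrite -(mulKf c0' x) h1|rewrite -(mulKf c0' y) h2]; by rewrite mulrA [c^-1 * r]mulrC.
Qed.

Lemma isarg_uniq t u x y : isarg t x y -> isarg u x y ->
  exists k : int, t - u = k%:~R * (2 * pi).
Proof.
move=> [r r0 [-> ->]] [s s0 [h1 h2]]; apply: cos_eq1; rewrite cosB.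
have := cos2Dsin2 t; have := cos2Dsin2 u.
move: (cos t) (sin t) (cos u) (sin u) h1 h2 => a b a' b' h1 h2 e1 e2.
have rs : r = s.
  have : r ^+ 2 = s ^+ 2.
    have -> : r ^+ 2 = (r * a) ^+ 2 + (r * b) ^+ 2 by rewrite !exprMn -mulrDr e2 mulr1.
    by rewrite h1 h2 !exprMn -mulrDr e1 mulr1.
  by move/eqP; rewrite eqrXn2 // ?ltW // => /eqP.
have r0' : r != 0 by rewrite gt_eqF.
move: h1 h2; rewrite -rs => /(mulfI r0') -> /(mulfI r0') ->.
by rewrite -e1 !expr2.
Qed.

Lemma isarg_shift t x y (k : int) : isarg t x y -> isarg (t + k%:~R * (2 * pi)) x y.
Proof. by move=> [r r0 [-> ->]]; exists r => //; rewrite cosDint sinDint. Qed.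

(** A multiple [c] of pi points left or right, and the last hypothesis puts [x] on that side: an
    argument known up to pi becomes known up to pi / 2. *)
Lemma isarg_near t x y c : isarg t x y -> sin c = 0 -> `|t - c| < pi -> 0 < cos c * x ->
  `|t - c| < pi / 2.
Proof.
move=> [r r0 [-> _]] sc tc; rewrite mulrCA pmulr_rgt0 // => H.
by apply: cos_gt0_near => //; rewrite cosB sc mulr0 addr0 mulrC.
Qed.

(* [W P q c0 c1]: along [P] the argument of [P - q] has a continuous branch starting
   within pi/2 of [c0] and ending within pi/2 of [c1]. *)
Definition W P q c0 c1 := exists2 th : R -> R, continuous th &
  [/\ forall t, 0 <= t <= 1 -> isarg (th t) (re (P t) - re q) (im (P t) - im q),
      `|th 0 - c0| < pi / 2 & `|th 1 - c1| < pi / 2].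

Lemma cpath_comp P (g : R -> R) : cpath P -> continuous g -> cpath (fun t => P (g t)).
Proof. by move=> [P1 P2] cg; split; [exact: (cts_comp P1)|exact: (cts_comp P2)]. Qed.

Lemma cpath_clamp P : cpath P -> cpath (fun t => P (clamp t)).
Proof. by move=> cP; apply: cpath_comp => //; exact: clamp_cts. Qed.

Lemma atan_cts (g : R -> R) : continuous g -> continuous (fun t => atan (g t)).
Proof. by move=> cg; apply: cts_comp => //; exact: continuous_atan. Qed.

(** The quotient (P' - q') / (P - q) has positive real part, so its principal argument is within pi
    / 2 of 0 and can be added to a branch along [P]. At the ends the sum is within pi of [c0] and
    [c1]; the side of [q'] on which the ends lie improves this to pi / 2. *)
Lemma W_ratio P P' q q' c0 c1 : cpath P -> cpath P' ->
  (forall t, 0 <= t <= 1 -> 0 < (re (P t) - re q) * (re (P' t) - re q')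
                             + (im (P t) - im q) * (im (P' t) - im q')) ->
  sin c0 = 0 -> sin c1 = 0 ->
  0 < cos c0 * (re (P' 0) - re q') -> 0 < cos c1 * (re (P' 1) - re q') ->
  W P q c0 c1 -> W P' q' c0 c1.
Proof.
move=> cP cP' dot s0 s1 k0 k1 [th cth [H H0 H1]].
have [a1 a2] := cpath_clamp cP; have [b1 b2] := cpath_clamp cP'.
pose D t := (re (P (clamp t)) - re q) * (re (P' (clamp t)) - re q')
         + (im (P (clamp t)) - im q) * (im (P' (clamp t)) - im q').
pose N t := (re (P (clamp t)) - re q) * (im (P' (clamp t)) - im q')
         - (im (P (clamp t)) - im q) * (re (P' (clamp t)) - re q').
have D0 t : 0 < D t by apply: dot; exact: clamp01.
have cD : continuous D.
  by apply: cts_add; apply: cts_mul; apply: cts_sub => //; exact: cts_cst.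
have cN : continuous N.
  by apply: cts_sub; apply: cts_mul; apply: cts_sub => //; exact: cts_cst.
pose ph t := th t + atan (N t / D t).
have cph : continuous ph.
  apply: cts_add => //; apply: atan_cts; apply: cts_div => // t; exact: lt0r_neq0.
have A t : 0 <= t <= 1 -> isarg (ph t) (re (P' t) - re q') (im (P' t) - im q').
  move=> t01; have At := isarg_mul (H t t01) (isarg_pos (N t) (D0 t)).
  have := D0 t; move: At; rewrite /D /N clamp_id //.
  set x := re (P t) - _; set y := im (P t) - _; set x' := re (P' t) - _; set y' := im (P' t) - _.
  move=> At d0; apply: (@isarg_scale _ _ _ (x ^+ 2 + y ^+ 2)).
    rewrite lt_neqAle addr_ge0 ?sqr_ge0 // andbT eq_sym paddr_eq0 ?sqr_ge0 // !sqrf_eq0.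
    by apply/negP => /andP[/eqP x0 /eqP y0]; move: d0; rewrite x0 y0 !mul0r addr0 ltxx.
  move: At; congr (isarg _ _ _); first by rewrite /ph /N /D clamp_id.
    ring.
  ring.
have S t c : `|th t - c| < pi / 2 -> `|ph t - c| < pi.
  have := @atan_gtNpi2 R (N t / D t); have := @atan_ltpi2 R (N t / D t).
  rewrite /ph !ltr_norml; lra.
exists ph => //; split => //.
  by apply: (isarg_near (A 0 _)) => //; [lra|exact: S].
by apply: (isarg_near (A 1 _)) => //; [lra|exact: S].
Qed.

(** Two branches differ by a constant multiple of 2 pi, which vanishes because both start within pi
    / 2 of [c0]. *)
Lemma W_uniq P q c0 c1 c1' : W P q c0 c1 -> W P q c0 c1' -> `|c1 - c1'| < pi.
Proof.
move=> [th cth [H H0 H1]] [th' cth' [H' H0' H1']].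
have p0 := @pi_gt0 R.
have E : forall t, 0 <= t <= 1 -> th t - th' t = th 0 - th' 0.
  apply: (@discrete_cst R (fun t => th t - th' t) (2 * pi)); first lra.
    exact: cts_sub.
  by move=> t t01; exact: (isarg_uniq (H t t01) (H' t t01)).
have [k K] := isarg_uniq (H 0 ltac:(lra)) (H' 0 ltac:(lra)).
have k0 : `|k - 0| < 1 :> int.
  rewrite subr0 -(ltr_int R) intr_norm -(ltr_pM2r (_ : 0 < 2 * pi)); last lra.
  rewrite -[X in _ * X < _]ger0_norm; last lra.
  by rewrite -normrM -K; move: H0 H0'; rewrite !ltr_norml; lra.
rewrite (int_norm_lt1 k0) mul0r in K.
have := E 1 ltac:(lra); rewrite K => E1.
move: H1 H1'; rewrite !ltr_norml; lra.
Qed.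

Lemma mul_lower (k x c : R) : `|c| <= k -> - (k * `|x|) <= x * c.
Proof.
move=> ck; rewrite lerNl; apply: le_trans (ler_norm _) _; rewrite normrN normrM mulrC.
by apply: ler_wpM2r; rewrite ?normr_ge0.
Qed.

(** In [W_transport] these are P - Q u = (x, y), P - Q t = (x + a, y + b) and P - Q v = (x + (a -
    a'), y + (b - b')). Base points much closer to each other than to the path see it in directions
    that make an acute angle. *)
Lemma perturbed_sq_gt0 (m x y a a' b b' : R) : 0 < m -> `|a| < m / 8 -> `|a'| < m / 8 ->
  `|b| < m / 8 -> `|b'| < m / 8 -> m <= `|x + a| + `|y + b| ->
  0 < x * (x + (a - a')) + y * (y + (b - b')).
Proof.
move=> m0 ha ha' hb hb' hN.
have g1 : 3 / 4 * m <= `|x| + `|y|.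
  by have := ler_normD x a; have := ler_normD y b; lra.
have g2 : - (m / 4 * `|x|) <= x * (a - a').
  by apply: mul_lower; have := ler_normB a a'; lra.
have g3 : - (m / 4 * `|y|) <= y * (b - b').
  by apply: mul_lower; have := ler_normB b b'; lra.
have -> : x * (x + (a - a')) + y * (y + (b - b')) = `|x| ^+ 2 + `|y| ^+ 2 + x * (a - a') + y * (b - b').
  by rewrite !real_normK ?num_real //; ring.
have := normr_ge0 x; have := normr_ge0 y.
move: (`|x|) (`|y|) (x * (a - a')) (y * (b - b')) g1 g2 g3 => X Y A B g1 g2 g3 Y0 X0.
move: m0 g1 g2 g3 {ha ha' hb hb' hN} => m0 g1 g2 g3.
have g4 := sqr_ge0 (X - Y).
have g5 : 3 / 4 * m * (X + Y) <= (X + Y) * (X + Y) by apply: ler_wpM2r; lra.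
have g6 : 0 < m * (X + Y) by apply: mulr_gt0; lra.
nra.
Qed.

(** Winding is locally constant in the base point, by compactness of [P] and [W_ratio]. The
    conditions on real parts keep each end of [P] on a fixed side of the moving base point, so that
    [c0] and [c1] keep their meaning. *)
Lemma W_transport P Q c0 c1 : cpath P -> cpath Q ->
  (forall s t, 0 <= s <= 1 -> 0 <= t <= 1 -> P s <> Q t) ->
  sin c0 = 0 -> sin c1 = 0 ->
  (forall t, 0 <= t <= 1 -> 0 < cos c0 * (re (P 0) - re (Q t))) ->
  (forall t, 0 <= t <= 1 -> 0 < cos c1 * (re (P 1) - re (Q t))) ->
  W P (Q 0) c0 c1 -> W P (Q 1) c0 c1.
Proof.
move=> cP [cQ1 cQ2] PQ s0 s1 k0 k1.
apply: (@real_induction R (fun t => W P (Q t) c0 c1)); try lra.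
move=> t t01.
pose N s := `|re (P s) - re (Q t)| + `|im (P s) - im (Q t)|.
have cN : continuous N.
  case: cP => cP1 cP2.
  by apply: cts_add; apply: cts_norm; apply: cts_sub => //; exact: cts_cst.
have [s s01 smin] := min01 (@ler01 R) cN.
have N0 : 0 < N s.
  rewrite /N lt_neqAle addr_ge0 ?normr_ge0 // andbT eq_sym paddr_eq0 ?normr_ge0 //.
  rewrite !normr_eq0 !subr_eq0; apply/negP => /andP[/eqP e1 /eqP e2].
  by apply: (PQ s t) => //; exact: Cext.
have [d1 d10 D1] := (cts_ball _).1 cQ1 t (N s / 8) ltac:(lra).
have [d2 d20 D2] := (cts_ball _).1 cQ2 t (N s / 8) ltac:(lra).
exists (Num.min d1 d2); first by rewrite lt_min d10 d20.
move=> u v u01 v01; rewrite !lt_min => /andP[u1 u2] /andP[v1 v2].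
apply: W_ratio => //; [|exact: k0|exact: k1].
move=> r r01; have := smin r r01; rewrite {2}/N; move: (D1 _ u1) (D1 _ v1) (D2 _ u2) (D2 _ v2).
move: N0; move: (N s) => m {smin cN s01 D1 D2}.
have -> : re (P r) - re (Q t) = (re (P r) - re (Q u)) + (re (Q u) - re (Q t)) by ring.
have -> : im (P r) - im (Q t) = (im (P r) - im (Q u)) + (im (Q u) - im (Q t)) by ring.
have -> : re (P r) - re (Q v) = (re (P r) - re (Q u)) + ((re (Q u) - re (Q t)) - (re (Q v) - re (Q t))) by ring.
have -> : im (P r) - im (Q v) = (im (P r) - im (Q u)) + ((im (Q u) - im (Q t)) - (im (Q v) - im (Q t))) by ring.
move: (re (P r) - re (Q u)) (im (P r) - im (Q u)) (re (Q u) - re (Q t)) (re (Q v) - re (Q t))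
  (im (Q u) - im (Q t)) (im (Q v) - im (Q t)) => x y a a' b b' m0 ha ha' hb hb' hN.
exact: (perturbed_sq_gt0 m0 ha ha' hb hb' hN).
Qed.

(** A sum with clamped times instead of a case distinction, so that continuity needs no gluing; it
    is the concatenation when P1 1 = P2 0. *)
Definition pcat P1 P2 : R -> R[i] := fun t =>
  (re (P1 (clamp (2 * t))) + re (P2 (clamp (2 * t - 1))) - re (P2 0))
  +i* (im (P1 (clamp (2 * t))) + im (P2 (clamp (2 * t - 1))) - im (P2 0)).

Lemma aff_cts c u : continuous (fun t : R => c * t + u).
Proof. by apply: cts_add; [apply: cts_mul; [exact: cts_cst|exact: cts_id]|exact: cts_cst]. Qed.

Lemma clamp2_cts : continuous (fun t : R => clamp (2 * t)).
Proof.
apply: cts_comp; first exact: clamp_cts.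
by apply: cts_mul; [exact: cts_cst|exact: cts_id].
Qed.

Lemma clamp2B_cts : continuous (fun t : R => clamp (2 * t - 1)).
Proof. by apply: cts_comp; [exact: clamp_cts|exact: aff_cts]. Qed.

Lemma pcat_cpath P1 P2 : cpath P1 -> cpath P2 -> cpath (pcat P1 P2).
Proof.
move=> [a1 a2] [b1 b2]; split; apply: cts_sub; try exact: cts_cst; apply: cts_add.
- exact: (cts_comp a1 clamp2_cts).
- exact: (cts_comp b1 clamp2B_cts).
- exact: (cts_comp a2 clamp2_cts).
- exact: (cts_comp b2 clamp2B_cts).
Qed.

Lemma pcat_l P1 P2 t : 0 <= t <= 1 / 2 -> pcat P1 P2 t = P1 (2 * t).
Proof.
move=> th; have e1 : clamp (2 * t) = 2 * t by apply: clamp_id; lra.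
have e2 : clamp (2 * t - 1) = 0 by apply: clamp_le0; lra.
rewrite /pcat e1 e2.
by apply: Cext => /=; ring.
Qed.

Lemma pcat_r P1 P2 t : P1 1 = P2 0 -> 1 / 2 <= t <= 1 -> pcat P1 P2 t = P2 (2 * t - 1).
Proof.
move=> E th; have e1 : clamp (2 * t) = 1 by apply: clamp_ge1; lra.
have e2 : clamp (2 * t - 1) = 2 * t - 1 by apply: clamp_id; lra.
rewrite /pcat e1 e2.
by rewrite E; apply: Cext => /=; ring.
Qed.

Lemma pcat_img P1 P2 t : P1 1 = P2 0 -> 0 <= t <= 1 ->
  exists2 s, 0 <= s <= 1 & pcat P1 P2 t = P1 s \/ pcat P1 P2 t = P2 s.
Proof.
move=> E t01; case: (lerP t (1 / 2)) => th.
  by exists (2 * t); [lra|left; apply: pcat_l; lra].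
by exists (2 * t - 1); [lra|right; apply: pcat_r => //; lra].
Qed.

Lemma pcat0 P1 P2 : pcat P1 P2 0 = P1 0.
Proof. by rewrite pcat_l ?mulr0 //; lra. Qed.

Lemma pcat1 P1 P2 : P1 1 = P2 0 -> pcat P1 P2 1 = P2 1.
Proof. by move=> E; rewrite pcat_r //; [congr P2|]; lra. Qed.

Lemma W_cat P1 P2 q c0 c1 c2 : P1 1 = P2 0 -> W P1 q c0 c1 -> W P2 q c1 c2 ->
  W (pcat P1 P2) q c0 c2.
Proof.
move=> E [th cth [H H0 H1]] [th' cth' [H' H0' H1']].
have p0 := @pi_gt0 R.
have Eth : th 1 = th' 0.
  have := H 1 ltac:(lra); rewrite E => h1.
  have [k K] := isarg_uniq h1 (H' 0 ltac:(lra)).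
  have k0 : `|k - 0| < 1 :> int.
    rewrite subr0 -(ltr_int R) intr_norm -(ltr_pM2r (_ : 0 < 2 * pi)); last lra.
    rewrite -[X in _ * X < _]ger0_norm; last lra.
    by rewrite -normrM -K; move: H1 H0'; rewrite !ltr_norml; lra.
  by move: K; rewrite (int_norm_lt1 k0) mul0r; lra.
exists (fun t => th (clamp (2 * t)) + th' (clamp (2 * t - 1)) - th' 0).
  apply: cts_sub; last exact: cts_cst.
  by apply: cts_add; [exact: (cts_comp cth clamp2_cts)|exact: (cts_comp cth' clamp2B_cts)].
split.
- move=> t t01; case: (lerP t (1 / 2)) => th2.
    rewrite pcat_l; last lra.
    have e1 : clamp (2 * t) = 2 * t by apply: clamp_id; lra.
    have e2 : clamp (2 * t - 1) = 0 by apply: clamp_le0; lra.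
    by rewrite e1 e2 addrK; apply: H; lra.
  rewrite pcat_r //; last lra.
  have e1 : clamp (2 * t) = 1 by apply: clamp_ge1; lra.
  have e2 : clamp (2 * t - 1) = 2 * t - 1 by apply: clamp_id; lra.
  by rewrite e1 e2 Eth addrAC subrr add0r; apply: H'; lra.
- by rewrite mulr0 sub0r !clamp_le0 ?addrK //; lra.
- have e1 : clamp (2 * 1) = 1 :> R by apply: clamp_ge1; lra.
  have e2 : clamp (2 * 1 - 1) = 1 :> R by apply: clamp_ge1; lra.
  by rewrite e1 e2 Eth; have -> : th' 0 + th' 1 - th' 0 = th' 1 by ring.
Qed.

Definition prev P : R -> R[i] := fun t => P (1 - t).

Lemma rev_cts : continuous (fun t : R => 1 - t).
Proof. by apply: cts_sub; [exact: cts_cst|exact: cts_id]. Qed.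

Lemma prev_cpath P : cpath P -> cpath (prev P).
Proof. by move=> cP; exact: (cpath_comp cP rev_cts). Qed.

Lemma W_rev P q c0 c1 : W P q c0 c1 -> W (prev P) q c1 c0.
Proof.
move=> [th cth [H H0 H1]]; exists (fun t => th (1 - t)); first exact: (cts_comp cth rev_cts).
by split; rewrite ?subr0 ?subrr //; move=> t t01; apply: H; lra.
Qed.

Lemma W_shift P q c0 c1 : W P q c0 c1 -> W P q (c0 - 2 * pi) (c1 - 2 * pi).
Proof.
move=> [th cth [H H0 H1]]; exists (fun t => th t - 2 * pi).
  by apply: cts_sub => //; exact: cts_cst.
split.
- move=> t t01; have := isarg_shift (-1) (H t t01).
  by rewrite mulrN1z mulN1r.
- by move: H0; rewrite !ltr_norml; lra.
- by move: H1; rewrite !ltr_norml; lra.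
Qed.

Lemma isarg_pi x y : x < 0 -> isarg (- pi + atan (y / x)) x y.
Proof.
move=> x0; have x1 : 0 < - x by lra.
have [r r0 [h1 h2]] := isarg_pos (- y) x1.
have -> : y / x = - y / - x by rewrite invrN mulrNN.
exists r => //; rewrite cosD sinD cosN sinN cospi sinpi; lra.
Qed.

(** The direction to the left has argument - pi here and in [W_below], but pi in [W_above];
    [W_shift] reconciles them. *)
Lemma W_left P q : cpath P -> (forall t, 0 <= t <= 1 -> re (P t) < re q) ->
  W P q (- pi) (- pi).
Proof.
move=> cP H; have [a1 a2] := cpath_clamp cP.
exists (fun t => - pi + atan ((im (P (clamp t)) - im q) / (re (P (clamp t)) - re q))).
  apply: cts_add; first exact: cts_cst.
  apply: atan_cts; apply: cts_div; try (apply: cts_sub => //; exact: cts_cst).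
  by move=> t; have := H _ (clamp01 t); rewrite subr_eq0 => h; rewrite lt_eqF.
have S x : `|- pi + atan x - - pi| < pi / 2.
  by have := @atan_gtNpi2 R x; have := @atan_ltpi2 R x; rewrite ltr_norml; lra.
split => // t t01; rewrite clamp_id //; apply: isarg_pi.
by have := H t t01; lra.
Qed.

Lemma atan_sgn x : (0 < x -> 0 < atan x) /\ (x < 0 -> atan x < 0).
Proof. by split => /lt_atan; rewrite atan0. Qed.

Lemma W_below P q : cpath P -> (forall t, 0 <= t <= 1 -> im (P t) < im q) ->
  re (P 0) < re q -> re q < re (P 1) -> W P q (- pi) 0.
Proof.
move=> cP H h0 h1; have [a1 a2] := cpath_clamp cP.
pose z t := (re (P (clamp t)) - re q) / (im q - im (P (clamp t))).
exists (fun t => - (pi / 2) + atan (z t)).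
  apply: cts_add; first exact: cts_cst.
  apply: atan_cts; apply: cts_div; try (apply: cts_sub => //; exact: cts_cst).
  by move=> t; have := H _ (clamp01 t); rewrite subr_eq0 => h; rewrite gt_eqF.
have B x := conj (@atan_gtNpi2 R x) (@atan_ltpi2 R x).
have c0 : clamp 0 = 0 :> R by rewrite clamp_le0.
have c1 : clamp 1 = 1 :> R by rewrite clamp_ge1.
split.
- move=> t t01; have Ht := H t t01.
  have [|r r0 [e1 e2]] := @isarg_pos (im q - im (P t)) (re (P t) - re q); first lra.
  exists r => //; rewrite /z clamp_id // [- (pi / 2) + _]addrC cosBpihalf sinBpihalf; lra.
- have : atan (z 0) < 0.
    apply: (atan_sgn _).2; rewrite /z c0 pmulr_llt0 ?invr_gt0; first lra.
    by have := H 0 ltac:(lra); lra.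
  by have [] := B (z 0); rewrite ltr_norml; lra.
- have : 0 < atan (z 1).
    apply: (atan_sgn _).1; rewrite /z c1 divr_gt0; try lra.
    by have := H 1 ltac:(lra); lra.
  by have [] := B (z 1); rewrite ltr_norml; lra.
Qed.

Lemma W_above P q : cpath P -> (forall t, 0 <= t <= 1 -> im q < im (P t)) ->
  re (P 0) < re q -> re q < re (P 1) -> W P q pi 0.
Proof.
move=> cP H h0 h1; have [a1 a2] := cpath_clamp cP.
pose z t := (re q - re (P (clamp t))) / (im (P (clamp t)) - im q).
exists (fun t => pi / 2 + atan (z t)).
  apply: cts_add; first exact: cts_cst.
  apply: atan_cts; apply: cts_div; try (apply: cts_sub => //; exact: cts_cst).
  by move=> t; have := H _ (clamp01 t); rewrite subr_eq0 => h; rewrite gt_eqF.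
have B x := conj (@atan_gtNpi2 R x) (@atan_ltpi2 R x).
have c0 : clamp 0 = 0 :> R by rewrite clamp_le0.
have c1 : clamp 1 = 1 :> R by rewrite clamp_ge1.
split.
- move=> t t01; have Ht := H t t01.
  have [|r r0 [e1 e2]] := @isarg_pos (im (P t) - im q) (re q - re (P t)); first lra.
  exists r => //; rewrite /z clamp_id // [pi / 2 + _]addrC cosDpihalf sinDpihalf; lra.
- have : 0 < atan (z 0).
    apply: (atan_sgn _).1; rewrite /z c0 divr_gt0; try lra.
    by have := H 0 ltac:(lra); lra.
  by have [] := B (z 0); rewrite ltr_norml; lra.
- have : atan (z 1) < 0.
    apply: (atan_sgn _).2; rewrite /z c1 pmulr_llt0 ?invr_gt0; first lra.
    by have := H 1 ltac:(lra); lra.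
  by have [] := B (z 1); rewrite ltr_norml; lra.
Qed.

End Winding.

(** * Itineraries and expansion *)

Section Dynamics.
Variables (R : realType) (a : R[i]).
Implicit Types (P Q : R -> R[i]) (u v w z : R[i]) (x y t : R) (k : int) (A : nat -> int).
Local Notation f := (expmap a).
Local Notation F n := (iter n (expmap a)).

(** Points right of [m0] are at least 100 to the right of the singular value [a], which dominates
    the additive errors of the estimates below. *)
Definition m0 : R := `|re a| + `|im a| + 100.

Lemma re_f z : re (f z) = expR (re z) * cos (im z) + re a.
Proof. by case: z => x y; case: a => b c /=; rewrite mul0r subr0. Qed.

Lemma im_f z : im (f z) = expR (re z) * sin (im z) + im a.
Proof. by case: z => x y; case: a => b c /=; rewrite mul0r addr0. Qed.

Lemma modulus_f z : (re (f z) - re a) ^+ 2 + (im (f z) - im a) ^+ 2 = expR (re z) ^+ 2.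
Proof. by rewrite re_f im_f !addrK !exprMn -mulrDr cos2Dsin2 mulr1. Qed.

Lemma far_re z : m0 <= re z -> 100 <= re z - re a.
Proof. by rewrite /m0; have := ler_norm (re a); have := normr_ge0 (im a); lra. Qed.

Lemma expR_ge_re z : m0 <= re (f z) -> 100 <= expR (re z).
Proof.
move=> /far_re h; apply: le_trans h _; rewrite re_f addrK.
by rewrite -[leRHS]mulr1 ler_pM2l ?expR_gt0 // cos_le1.
Qed.

Lemma sq_le x y : `|x| <= y -> x ^+ 2 <= y ^+ 2.
Proof.
move=> h; rewrite -real_normK ?num_real // ler_sqr ?nnegrE //.
by apply: le_trans h; exact: normr_ge0.
Qed.

Lemma le_of_sq x y : 0 <= y -> x ^+ 2 <= y ^+ 2 -> x <= y.
Proof. by move=> y0 h; rewrite leNgt; apply/negP => yx; nra. Qed.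

(** By Cauchy-Schwarz the modulus of f u - a falls short of that of f v - a by at most 4 + 24. A
    lead of more than 4 for [v] would make it more than five times smaller, which is too much for a
    modulus of at least 100. *)
Lemma cmp_step u v : m0 <= re (f v) -> re (f v) - 4 <= re (f u) ->
  `|im (f u) - im (f v)| <= 24 -> re v - 4 <= re u.
Proof.
move=> /far_re hv hu hi; rewrite -ler_expR expRD.
have Mu := modulus_f u; have Mv := modulus_f v.
have e4 : 5 <= expR 4 :> R by apply: le_trans (expR_ge1Dx 4); lra.
have e4' : expR (- 4) * expR 4 = 1 :> R by rewrite -expRD addNr expR0.
have := expR_gt0 (re u); have := expR_gt0 (re v); have := expR_gt0 (- 4 : R).
move: (expR (re u)) (expR (re v)) (expR (-4)) (expR 4) Mu Mv e4 e4' => Eu Ev c C Mu Mv hC hc c0 Ev0 Eu0.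
set U1 := re (f u) - re a in Mu; set U2 := im (f u) - im a in Mu.
set V1 := re (f v) - re a in Mv hv; set V2 := im (f v) - im a in Mv.
have h1 : V1 - 4 <= U1 by rewrite /U1 /V1; lra.
have h2 : `|U2 - V2| <= 24 by have -> : U2 - V2 = im (f u) - im (f v) by rewrite /U2 /V2; ring.
move: U1 U2 V1 V2 hv Mu Mv h1 h2 => U1 U2 V1 V2 hv Mu Mv h1 h2 {hu hi}.
have hc5 : c <= 1 / 5 by nra.
have V1E : V1 <= Ev.
  by apply: le_of_sq; [lra|have := sqr_ge0 V2; lra].
have V2E : `|V2| <= Ev.
  by apply: le_of_sq; [lra|rewrite real_normK ?num_real //; have := sqr_ge0 V1; lra].
have CS : U1 * V1 + U2 * V2 <= Eu * Ev.
  apply: le_of_sq; first by apply: mulr_ge0; lra.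
  rewrite exprMn -Mu -Mv.
  have := sqr_ge0 (U1 * V2 - U2 * V1); nra.
have X2 : V2 ^+ 2 - 24 * Ev <= U2 * V2.
  have -> : U2 * V2 = V2 ^+ 2 + (U2 - V2) * V2 by ring.
  suff : - ((U2 - V2) * V2) <= 24 * Ev by lra.
  apply: le_trans (ler_norm _) _; rewrite normrN normrM.
  by apply: ler_pM; rewrite ?normr_ge0.
have X1 : V1 ^+ 2 - 4 * Ev <= U1 * V1 by nra.
have : (Ev - 28) * Ev <= Eu * Ev by nra.
rewrite ler_pM2r // => h3; nra.
Qed.

(** A lead of 4 makes the modulus of f u - a at least five times that of f v - a; as the imaginary
    parts almost agree, the surplus shows in the real part. *)
Lemma fwd_step u v : m0 <= re (f u) -> m0 <= re (f v) -> `|im (f u) - im (f v)| <= 4 ->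
  re v + 4 <= re u -> re (f v) + 4 <= re (f u).
Proof.
move=> /far_re hu /far_re hv hi huv; rewrite leNgt; apply/negP => hlt.
have Mu := modulus_f u; have Mv := modulus_f v.
have e4 : 5 <= expR 4 :> R by apply: le_trans (expR_ge1Dx 4); lra.
have h5 : 5 * expR (re v) <= expR (re u).
  have : expR (re v + 4) <= expR (re u) by rewrite ler_expR.
  rewrite expRD; have := expR_gt0 (re v); nra.
have := expR_gt0 (re v).
move: (expR (re u)) (expR (re v)) Mu Mv h5 => Eu Ev Mu Mv h5 Ev0.
set U1 := re (f u) - re a in Mu hu; set U2 := im (f u) - im a in Mu.
set V1 := re (f v) - re a in Mv hv; set V2 := im (f v) - im a in Mv.
have h1 : U1 <= V1 + 4 by rewrite /U1 /V1; lra.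
have h2 : `|U2 - V2| <= 4 by have -> : U2 - V2 = im (f u) - im (f v) by rewrite /U2 /V2; ring.
move: U1 U2 V1 V2 hu hv Mu Mv h1 h2 => U1 U2 V1 V2 hu hv Mu Mv h1 h2 {hi huv hlt e4}.
have V1E : V1 <= Ev.
  by apply: le_of_sq; [lra|have := sqr_ge0 V2; lra].
have V2E : `|V2| <= Ev.
  by apply: le_of_sq; [lra|rewrite real_normK ?num_real //; have := sqr_ge0 V1; lra].
have U2E : `|U2| <= `|V2| + 4.
  have -> : U2 = V2 + (U2 - V2) by ring.
  by apply: le_trans (ler_normD _ _) _; lra.
have : U2 ^+ 2 <= (`|V2| + 4) ^+ 2.
  exact: sq_le.
have : U1 ^+ 2 <= (V1 + 4) ^+ 2 by apply: sq_le; rewrite ler_norml; lra.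
rewrite -[V2 ^+ 2]real_normK ?num_real // in Mv.
have : (5 * Ev) ^+ 2 <= Eu ^+ 2 by apply: sq_le; rewrite ler_norml; lra.
have := normr_ge0 V2; move: (`|V2|) Mv V2E => N Mv V2E N0 ? ? ?; nra.
Qed.

Lemma sin_lb x : 0 <= x <= pi / 4 -> cos (pi / 4) * x <= sin x.
Proof.
move=> /andP[x0 xp]; have p0 := @pi_gt0 R.
have [c] := @MVT_segment R sin cos 0 x x0 (fun y _ => is_derive_sin y)
  (continuous_subspaceT (@continuous_sin R)).
rewrite in_itv /= sin0 !subr0 => /andP[c0 cx] ->; apply: ler_wpM2r => //.
rewrite le_eqVlt; case: (ltrgtP c (pi / 4)) => [h|h|->]; rewrite ?eqxx //; last by lra.
by apply/orP; right; rewrite ltr_cos ?in_itv /=; lra.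
Qed.

(** With y = 4 h one has 1 - cos y = 8 (sin h cos h)^2, and for 0 <= h <= pi / 4 both factors are
    bounded below through cos (pi / 4). *)
Lemma cos_quad y : `|y| <= pi -> y ^+ 2 / 8 <= 1 - cos y.
Proof.
move=> yp; rewrite -[y in y ^+ 2]/(y) -real_normK ?num_real // -cos_norm.
move: (`|y|) (normr_ge0 y) yp => {}y y0 yp; have p0 := @pi_gt0 R.
have [h Ey] : exists h, y = 4 * h by exists (y / 4); field.
have hh : 0 <= h <= pi / 4 by lra.
have cc : cos (pi / 4) ^+ 2 = 1 / 2 :> R.
  have : cos ((pi / 4) *+ 2) = 0 :> R.
    have -> : (pi / 4) *+ 2 = pi / 2 :> R by rewrite mulr2n; lra.
    exact: cos_pihalf.
  rewrite cos_mulr2n; lra.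
have c0 : 0 <= cos (pi / 4) :> R by apply: cos_ge0_pihalf; lra.
have s1 := sin_lb hh.
have s2 : cos (pi / 4) <= cos h.
  rewrite le_eqVlt; case: (ltrgtP h (pi / 4)) => [g|g|->]; rewrite ?eqxx //; last by lra.
  by apply/orP; right; rewrite ltr_cos ?in_itv /=; lra.
have -> : 1 - cos y = 8 * (sin h * cos h) ^+ 2.
  have -> : y = (h *+ 2) *+ 2 by rewrite Ey !mulr2n; ring.
  rewrite cos_mulr2n cos2sin2 sin_mulr2n; move: (cos h) (sin h) => C S.
  rewrite !mulr2n; ring.
have g : h / 2 <= sin h * cos h.
  have : (cos (pi / 4) * h) * cos (pi / 4) <= sin h * cos h.
    by apply: ler_pM => //; apply: mulr_ge0 => //; lra.
  by rewrite mulrAC -expr2 cc; lra.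
have h0 : 0 <= h by lra.
have : (h / 2) ^+ 2 <= (sin h * cos h) ^+ 2 by apply: sq_le; rewrite ger0_norm //; lra.
by rewrite Ey; move: (sin h * cos h) => S; rewrite !exprMn; lra.
Qed.

(** By the law of cosines the squared distance of the images splits into a radial and an angular
    part. Convexity of exp bounds the first from below through re u - re v, and [cos_quad] the
    second through im u - im v. *)
Lemma exp_step u v : `|im u - im v| <= pi -> 100 <= expR (re u) -> 100 <= expR (re v) ->
  4 * ((re u - re v) ^+ 2 + (im u - im v) ^+ 2) <=
  (re (f u) - re (f v)) ^+ 2 + (im (f u) - im (f v)) ^+ 2.
Proof.
wlog uv : u v / re v <= re u.
  move=> W; case: (lerP (re v) (re u)) => [|/ltW] h; first exact: W.
  move=> h1 h2 h3; have := W v u h; rewrite distrC => /(_ h1 h3 h2).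
  have e (x y : R) : (x - y) ^+ 2 = (y - x) ^+ 2 by ring.
  by rewrite (e (re u)) (e (im u)) (e (re (f u))) (e (im (f u))).
move=> hp hu hv.
have -> : (re (f u) - re (f v)) ^+ 2 + (im (f u) - im (f v)) ^+ 2 =
  (expR (re u) - expR (re v)) ^+ 2 + 2 * expR (re u) * expR (re v) * (1 - cos (im u - im v)).
  rewrite !re_f !im_f cosB.
  have := cos2Dsin2 (im u); have := cos2Dsin2 (im v).
  move: (cos _) (sin _) (cos _) (sin _) (expR _) (expR _) => b b' c c' E E' e1 e2.
  transitivity (E ^+ 2 * (c ^+ 2 + c' ^+ 2) + E' ^+ 2 * (b ^+ 2 + b' ^+ 2) - 2 * E * E' * (c * b + c' * b')).
    ring.
  by rewrite e1 e2; ring.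
have := cos_quad hp.
have g : expR (re v) * (re u - re v) <= expR (re u) - expR (re v).
  have -> : expR (re u) = expR (re v) * expR (re u - re v) by rewrite -expRD; congr expR; ring.
  have := expR_ge1Dx (re u - re v); have := expR_gt0 (re v); nra.
have faster : expR (re v) <= expR (re u) by rewrite ler_expR.
move: (1 - cos (im u - im v)) => c; move: (im u - im v) => y.
move: (expR (re u)) (expR (re v)) hu hv g faster => Eu Ev hu hv g faster hc.
have : 0 <= re u - re v by lra.
move: (re u - re v) g => x g x0.
have h1 : (100 * x) ^+ 2 <= (Eu - Ev) ^+ 2.
  by apply: sq_le; rewrite ler_norml; nra.
have h2 : 100 * 100 <= Eu * Ev by nra.
have y2 := sqr_ge0 y; have x2 := sqr_ge0 x.
have h3 : 100 * 100 * (y ^+ 2 / 8) <= Eu * Ev * c by apply: ler_pM => //; lra.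
rewrite exprMn in h1; lra.
Qed.

(** These strips are the components of the set where re (f z) > re a. *)
Definition instrip k z := `|im z - k%:~R * (2 * pi)| < pi / 2.

Lemma instrip_diff k u v : instrip k u -> instrip k v -> `|im u - im v| < pi.
Proof. by rewrite /instrip !ltr_norml; lra. Qed.

Lemma instrip_uniq k l z : instrip k z -> instrip l z -> k = l.
Proof.
have p0 := @pi_gt0 R.
rewrite /instrip !ltr_norml => hk hl; apply: int_norm_lt1.
rewrite -(ltr_int R) intr_norm -(ltr_pM2r (_ : 0 < 2 * pi)); last lra.
rewrite -[X in _ * X < _]ger0_norm; last lra.
by rewrite -normrM intrB mulrBl ltr_norml; lra.
Qed.

Lemma cos_strip z : 0 < cos (im z) -> exists k, instrip k z.
Proof.
move=> c0; have [k K] := round_pi (im z); exists k; have p0 := @pi_gt0 R.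
have c0' : 0 < cos (im z - k%:~R * (2 * pi)) by rewrite -(cosDint _ k) subrK.
apply: cos_gt0_near => //; rewrite ltr_norml.
suff : im z - k%:~R * (2 * pi) != - pi by move=> h; rewrite lt_neqAle eq_sym h; lra.
by apply/eqP => h; move: c0'; rewrite h cosN cospi; lra.
Qed.

Lemma strip_cos k z : instrip k z -> 0 < cos (im z).
Proof.
rewrite /instrip ltr_norml => h; rewrite -[im z](subrK (k%:~R * (2 * pi))) cosDint.
by apply: cos_gt0_pihalf.
Qed.

Lemma strip_ex z : m0 <= re (f z) -> exists k, instrip k z.
Proof.
move=> /far_re; rewrite re_f addrK => h; apply: cos_strip.
by rewrite -(pmulr_rgt0 _ (expR_gt0 (re z))); lra.
Qed.

(** The derivative of [f] has positive real part on the strip, which is convex; apply the mean value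
    theorem along the segment from [v] to [u]. This is the acute angle that [W_ratio] asks for. *)
Lemma mono_step k u v : instrip k u -> instrip k v -> u <> v ->
  0 < (re u - re v) * (re (f u) - re (f v)) + (im u - im v) * (im (f u) - im (f v)).
Proof.
move=> ku kv uv.
set dx := re u - re v; set dy := im u - im v.
pose X s := re v + s * dx; pose Y s := im v + s * dy.
pose h s := dx * (expR (X s) * cos (Y s)) + dy * (expR (X s) * sin (Y s)).
pose h' s := expR (X s) * cos (Y s) * (dx ^+ 2 + dy ^+ 2).
have dX (s : R) : is_derive s (1 : R) X dx.
  have : is_derive s (1 : R) X (0 + (s *: 0 + dx *: 1)) by apply: is_deriveD.
  by rewrite scaler0 !add0r -[dx *: 1]/(dx * 1) mulr1.
have dY (s : R) : is_derive s (1 : R) Y dy.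
  have : is_derive s (1 : R) Y (0 + (s *: 0 + dy *: 1)) by apply: is_deriveD.
  by rewrite scaler0 !add0r -[dy *: 1]/(dy * 1) mulr1.
have dh (s : R) : is_derive s (1 : R) h (h' s).
  have dE := is_derive1_comp (is_derive_expR (X s)) (dX s).
  have dC := is_derive1_comp (is_derive_cos (Y s)) (dY s).
  have dS := is_derive1_comp (is_derive_sin (Y s)) (dY s).
  have dEC := is_deriveM dE dC; have dES := is_deriveM dE dS.
  have H := is_deriveD (is_deriveZ dx dEC) (is_deriveZ dy dES).
  apply: is_derive_eq H _; rewrite /h' /GRing.scale /=; ring.
have ch : continuous h.
  by move=> s; apply: differentiable_continuous; apply/derivable1_diffP; have [] := dh s.
have [c cI E] := @MVT R h h' 0 1 ltr01 (fun s _ => dh s) (continuous_subspaceT ch).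
have -> : dx * (re (f u) - re (f v)) + dy * (im (f u) - im (f v)) = h 1 - h 0.
  have e1 : X 1 = re u by rewrite /X mul1r addrC subrK.
  have e2 : Y 1 = im u by rewrite /Y mul1r addrC subrK.
  have e3 : X 0 = re v by rewrite /X mul0r addr0.
  have e4 : Y 0 = im v by rewrite /Y mul0r addr0.
  by rewrite /h e1 e2 e3 e4 !re_f !im_f; ring.
rewrite E subr0 mulr1 /h'.
have : 0 < cos (Y c).
  apply: (@strip_cos k (0 +i* Y c)); move: ku kv cI; rewrite /instrip !ltr_norml in_itv /= /Y /dy.
  move: (im u) (im v) (k%:~R * _) => p q r => h1 h2 h3; nra.
have := expR_gt0 (X c) => e0 c0.
rewrite pmulr_rgt0 ?mulr_gt0 // lt_neqAle addr_ge0 ?sqr_ge0 // andbT eq_sym.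
rewrite paddr_eq0 ?sqr_ge0 // !sqrf_eq0 !subr_eq0; apply/negP => /andP[/eqP e1 /eqP e2].
by apply: uv; exact: Cext.
Qed.

Lemma f_eq u v : f u = f v -> re u = re v /\ exists k, im u - im v = k%:~R * (2 * pi).
Proof.
move=> E; have := modulus_f u; rewrite E modulus_f => /eqP.
rewrite eqrXn2 ?expR_ge0 // => /eqP /expR_inj Er; split; first by rewrite Er.
apply: cos_eq1; rewrite cosB.
have := congr1 (@complex.Re R) E; have := congr1 (@complex.Im R) E; rewrite !re_f !im_f Er.
have e0 : expR (re u) != 0 by rewrite gt_eqF // expR_gt0.
move=> /addIr /(mulfI e0) -> /addIr /(mulfI e0) ->.
by rewrite -!expr2 cos2Dsin2.
Qed.

Lemma f_inj_near u v : `|im u - im v| < 2 * pi -> f u = f v -> u = v.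
Proof.
move=> h /f_eq [Er [k K]]; apply: Cext => //; apply/eqP; rewrite -subr_eq0 K.
have p0 := @pi_gt0 R.
rewrite (@int_norm_lt1 k 0) ?mul0r // subr0 -(ltr_int R) intr_norm.
rewrite -(ltr_pM2r (_ : 0 < 2 * pi)); last lra.
by rewrite -[X in _ * X < _]ger0_norm -?normrM -?K ?mul1r //; lra.
Qed.

Lemma cpath_f P : cpath P -> cpath (fun t => f (P t)).
Proof.
move=> [cx cy]; split.
  rewrite (_ : (fun t => _) = fun t => expR (re (P t)) * cos (im (P t)) + re a); last first.
    by apply: funext => t; exact: re_f.
  apply: cts_add; last exact: cts_cst.
  by apply: cts_mul; apply: cts_comp => //; [exact: continuous_expR|exact: continuous_cos].
rewrite (_ : (fun t => _) = fun t => expR (re (P t)) * sin (im (P t)) + im a); last first.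
  by apply: funext => t; exact: im_f.
apply: cts_add; last exact: cts_cst.
by apply: cts_mul; apply: cts_comp => //; [exact: continuous_expR|exact: continuous_sin].
Qed.

Lemma cpath_F n P : cpath P -> cpath (fun t => F n (P t)).
Proof. by move=> cP; elim: n => [|n IH] //; exact: cpath_f IH. Qed.

Lemma cpath_re n P : cpath P -> continuous (fun t => re (F n (P t))).
Proof. by move=> /(cpath_F n) []. Qed.

Lemma cpath_im n P : cpath P -> continuous (fun t => im (F n (P t))).
Proof. by move=> /(cpath_F n) []. Qed.

Lemma instrip_near k P t : cpath P -> instrip k (P t) ->
  exists2 d, 0 < d & forall s, `|s - t| < d -> instrip k (P s).
Proof.
move=> [_ cy] h; have [||d d0 D] := @cts_pos R (fun s => pi / 2 - `|im (P s) - k%:~R * (2 * pi)|) t.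
- by apply: cts_sub; [exact: cts_cst|apply: cts_norm; apply: cts_sub => //; exact: cts_cst].
- by move: h; rewrite /instrip; lra.
- by exists d => // s /D; rewrite /instrip; lra.
Qed.

Lemma strip_path k P s t : cpath P -> (forall t, 0 <= t <= 1 -> m0 <= re (f (P t))) ->
  0 <= s <= 1 -> 0 <= t <= 1 -> instrip k (P s) -> instrip k (P t).
Proof.
move=> cP H s01 t01; apply: (@real_induction R (fun t => instrip k (P t))) => //.
move=> {s01} {}t {}t01; have [l L] := strip_ex (H t t01).
have [d d0 D] := instrip_near cP L; exists d => // u v _ _ /D lu /D lv ku.
by rewrite (instrip_uniq ku lu).
Qed.

Definition trk A z := forall r, m0 <= re (F r z) /\ instrip (A r) (F r z).
Definition far (m : R) (n : nat) z := forall j, (n <= j)%N -> m <= re (F j z).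

Lemma far_trk z : far m0 0 z -> exists A, trk A z.
Proof.
move=> H; have /choice [A HA] : forall r, exists k, instrip k (F r z).
  by move=> r; apply: strip_ex; exact: (H r.+1).
by exists A => r; split=> //; exact: H.
Qed.

Lemma F_add n j z : F (n + j) z = F n (F j z).
Proof. exact: iterD. Qed.

Lemma far_shift m n j z : far m (n + j) z -> far m n (F j z).
Proof. by move=> H i ni; rewrite -F_add; apply: H; rewrite leq_add2r. Qed.

Lemma far_le m n n' z : (n <= n')%N -> far m n z -> far m n' z.
Proof. by move=> nn H j nj; apply: H; exact: leq_trans nn nj. Qed.

Lemma far_lev m m' n z : m' <= m -> far m n z -> far m' n z.
Proof. by move=> mm H j nj; apply: le_trans mm (H j nj). Qed.

Section Order.
Variables (A : nat -> int).

Lemma trk_im u v r : trk A u -> trk A v -> `|im (F r u) - im (F r v)| < pi.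
Proof. by move=> /(_ r) [_ hu] /(_ r) [_ hv]; exact: instrip_diff hu hv. Qed.

Lemma pi_lt4 : pi < 4 :> R.
Proof. by have := @pihalf_lt2 R; lra. Qed.

Lemma gap_fwd u v n (k : nat) : trk A u -> trk A v -> re (F n v) + 4 <= re (F n u) ->
  re (F (k + n) v) + 4 <= re (F (k + n) u).
Proof.
move=> hu hv h; elim: k => [|k IH] //; rewrite !addSn; apply: fwd_step => //.
- exact: (hu (k + n).+1).1.
- exact: (hv (k + n).+1).1.
- by have := @trk_im u v (k + n).+1 hu hv; have := pi_lt4 => /= ? ?; lra.
Qed.

Definition dist2 u v := (re u - re v) ^+ 2 + (im u - im v) ^+ 2.

Lemma grow u v n : trk A u -> trk A v -> 4 ^+ n * dist2 u v <= dist2 (F n u) (F n v).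
Proof.
move=> hu hv; elim: n => [|n IH]; first by rewrite expr0 mul1r.
rewrite exprS -mulrA; apply: le_trans (_ : 4 * dist2 (F n u) (F n v) <= _).
  by rewrite ler_pM2l.
apply: exp_step; first by apply: ltW; exact: trk_im.
  by apply: expR_ge_re; exact: (hu n.+1).1.
by apply: expR_ge_re; exact: (hv n.+1).1.
Qed.

Lemma dist2_eq0 u v : dist2 u v <= 0 -> u = v.
Proof.
move=> h; have h0 : dist2 u v == 0 by rewrite eq_le h addr_ge0 ?sqr_ge0.
move: h0; rewrite paddr_eq0 ?sqr_ge0 // !sqrf_eq0 !subr_eq0 => /andP[/eqP ? /eqP ?].
exact: Cext.
Qed.

Lemma pow4_big (c B : R) : 0 < c -> exists n, B < 4 ^+ n * c.
Proof.
move=> c0; exists (Num.truncn (`|B| / c)).+1.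
have h : `|B| / c < (Num.truncn (`|B| / c)).+1%:R by exact: truncnS_gt.
apply: le_lt_trans (ler_norm B) _; rewrite -ltr_pdivrMr //.
apply: lt_le_trans h _; move: (_.+1) => n.
rewrite -natrX ler_nat; apply: ltnW; exact: ltn_expl.
Qed.

Lemma bounded_eq u v (B : R) : trk A u -> trk A v -> (forall n, dist2 (F n u) (F n v) <= B) ->
  u = v.
Proof.
move=> hu hv H; apply: dist2_eq0; rewrite leNgt; apply/negP => d0.
have [n] := pow4_big B d0; have := grow n hu hv; have := H n; lra.
Qed.

Definition faster u v := forall n, re (F n v) <= re (F n u) + 4.

Lemma faster_refl u : faster u u.
Proof. by move=> n; lra. Qed.

Lemma not_faster u v : ~ faster u v -> exists n, re (F n u) + 4 < re (F n v).
Proof.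
by move=> /existsNP [n /negP]; rewrite -ltNge => h; exists n.
Qed.

Lemma faster_total u v : trk A u -> trk A v -> faster u v \/ faster v u.
Proof.
move=> hu hv; have [|/not_faster [n hn]] := pselect (faster u v); [by left|right=> k].
rewrite leNgt; apply/negP => hk.
case: (leqP n k) => [nk|/ltnW kn].
  have := @gap_fwd v u n (k - n) hv hu (ltW hn); rewrite subnK //; lra.
have := @gap_fwd u v k (n - k) hu hv (ltW hk); rewrite subnK //; lra.
Qed.

Lemma faster_anti u v : trk A u -> trk A v -> faster u v -> faster v u -> u = v.
Proof.
move=> hu hv h1 h2; apply: (@bounded_eq u v (4 ^+ 2 + pi ^+ 2)) => // n.
by apply: lerD; apply: sq_le; [have := h1 n; have := h2 n; rewrite ler_norml; lra|apply: ltW; exact: trk_im].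
Qed.

(** The distance grows exponentially while the imaginary parts stay within pi of each other, so the
    growth goes into the real parts, and [gap_fwd] fixes its sign. *)
Lemma gap_big u v n (B : R) : trk A u -> trk A v -> re (F n v) + 4 < re (F n u) ->
  exists N, forall k : nat, (N <= k)%N -> re (F k v) + B <= re (F k u).
Proof.
move=> hu hv h.
have uv : 0 < dist2 u v.
  rewrite ltNge; apply/negP => /dist2_eq0 E; move: h; rewrite E; lra.
have [N HN] := pow4_big (B ^+ 2 + pi ^+ 2) uv.
exists (maxn N n) => k; rewrite geq_max => /andP[Nk nk].
have hk : re (F k v) + 4 <= re (F k u).
  by have := @gap_fwd u v n (k - n) hu hv (ltW h); rewrite subnK.
have D : B ^+ 2 + pi ^+ 2 < dist2 (F k u) (F k v).
  apply: lt_le_trans HN _; apply: le_trans (grow k hu hv).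
  by rewrite ler_pM2r // ler_weXn2l //; lra.
have I : (im (F k u) - im (F k v)) ^+ 2 <= pi ^+ 2 by apply: sq_le; apply: ltW; exact: trk_im.
rewrite leNgt; apply/negP => hb.
have : (re (F k u) - re (F k v)) ^+ 2 <= B ^+ 2 by apply: sq_le; rewrite ler_norml; lra.
move: D; rewrite /dist2; lra.
Qed.

(** The two hypotheses cost at most 8 together, whereas a lead beyond 4 would eventually exceed
    20. *)
Lemma faster_trans u v w : trk A u -> trk A v -> trk A w -> faster u v -> faster v w -> faster u w.
Proof.
move=> hu hv hw uv vw; apply: contrapT => /not_faster [n hn].
have [N HN] := gap_big 20 hw hu hn.
by have := HN N (leqnn N); have := uv N; have := vw N; lra.
Qed.

End Order.
End Dynamics.

Lemma sub_bounds (n0 n k : nat) : (k.+1 <= n - n0)%N -> (n0 <= n - k.+1)%N /\ (n - k.+1 < n)%N.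
Proof. by lia. Qed.

(** * The order by speed along paths *)

Section OrderedPaths.
Variables (R : realType) (a : R[i]).
Implicit Types (P Q : R -> R[i]) (u v w x y z : R[i]) (s t p q d m : R) (A : nat -> int).
Local Notation f := (expmap a).
Local Notation F n := (iter n (expmap a)).
Local Notation m0 := (m0 a).
Local Notation trk := (trk a).
Local Notation faster := (faster a).
Local Notation far := (far a).

Definition seg P p q : R -> R[i] := fun t => P (p + t * (q - p)).

Lemma seg_cpath P p q : cpath P -> cpath (seg P p q).
Proof.
move=> cP; apply: cpath_comp => //; apply: cts_add; first exact: cts_cst.
by apply: cts_mul; [exact: cts_id|exact: cts_cst].
Qed.

Lemma seg0 P p q : seg P p q 0 = P p.
Proof. by rewrite /seg mul0r addr0. Qed.

Lemma seg1 P p q : seg P p q 1 = P q.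
Proof. by rewrite /seg mul1r addrC subrK. Qed.

Lemma seg_itv p q t : p <= q -> 0 <= t <= 1 -> p <= p + t * (q - p) <= q.
Proof. by move=> pq t01; nra. Qed.

Lemma seg_surj p q t : p <= t <= q -> exists2 s, 0 <= s <= 1 & t = p + s * (q - p).
Proof.
case: (ltrgtP p q) => [pq tpq|pq tpq|<- tp]; last first.
- by exists 0; rewrite ?mul0r ?addr0; lra.
- lra.
- exists ((t - p) / (q - p)); last by rewrite divfK ?subr_eq0 ?gt_eqF // addrC subrK.
  rewrite divr_ge0 ?ler_pdivrMr ?mul1r; lra.
Qed.

(** Local injectivity is what survives iteration: [f] is injective at small scale but may identify
    distant points of an arc. *)
Definition linj P := forall t, 0 <= t <= 1 -> exists2 d, 0 < d &
  forall s s', 0 <= s <= 1 -> 0 <= s' <= 1 -> `|s - t| < d -> `|s' - t| < d -> P s = P s' -> s = s'.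

Lemma linj_f P : cpath P -> linj P -> linj (fun t => f (P t)).
Proof.
move=> [_ /cts_ball cP] H t t01; have [d d0 D] := H t t01.
have p0 := @pi_gt0 R.
have [e e0 E] := cP t pi p0.
exists (Num.min d e); first by rewrite lt_min d0 e0.
move=> s s' s01 s01'; rewrite !lt_min => /andP[s1 /E s2] /andP[s1' /E s2'] Ef.
apply: D => //; apply: (f_inj_near _ Ef); move: s2 s2'; rewrite !ltr_norml; lra.
Qed.

Lemma linj_F n P : cpath P -> linj P -> linj (fun t => F n (P t)).
Proof.
move=> cP lP; elim: n => [|n IH] //; apply: (@linj_f (fun t => F n (P t))) => //.
exact: cpath_F.
Qed.

Lemma linj_seg P p q : p != q -> 0 <= p <= 1 -> 0 <= q <= 1 -> linj P -> linj (seg P p q).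
Proof.
move=> pq p01 q01 H t t01; have [|d d0 D] := H (p + t * (q - p)); first nra.
have pq0 : 0 < `|q - p| by rewrite normr_gt0 subr_eq0 eq_sym.
exists (d / `|q - p|); first by rewrite divr_gt0.
move=> s s' s01 s01'; rewrite !ltr_pdivlMr // -!normrM => h h' E.
have {}E : p + s * (q - p) = p + s' * (q - p).
  apply: D => //; try nra.
    by have -> : p + s * (q - p) - (p + t * (q - p)) = (s - t) * (q - p) by ring.
  by have -> : p + s' * (q - p) - (p + t * (q - p)) = (s' - t) * (q - p) by ring.
by move/addrI: E => /mulIf; apply; rewrite subr_eq0 eq_sym.
Qed.

(* Minimise at time n and let n tend to infinity: since gaps persist, a cluster
   point of the minimisers is a slowest point. *)
Lemma slowest A P : cpath P -> (forall t, 0 <= t <= 1 -> trk A (P t)) ->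
  exists2 t, 0 <= t <= 1 & forall s, 0 <= s <= 1 -> faster (P s) (P t).
Proof.
move=> cP H.
have /choice [x Hx] : forall n, exists t, 0 <= t <= 1 /\
    forall s, 0 <= s <= 1 -> re (F n (P t)) <= re (F n (P s)).
  by move=> n; have [t t01 T] := min01 (@ler01 R) (@cpath_re _ a n _ cP); exists t.
have [t t01 T] := cluster01 (fun n => (Hx n).1).
exists t => // s s01; apply: contrapT => /not_faster [n hn].
have [||d d0 D] := @cts_pos R (fun r => re (F n (P r)) - (re (F n (P s)) + 4)) t.
- by apply: cts_sub; [exact: cpath_re|exact: cts_cst].
- lra.
have [k nk /D hk] := T d n d0.
have := (Hx k).2 s s01.
have := @gap_fwd _ a A (P (x k)) (P s) n (k - n) (H _ (Hx k).1) (H _ s01).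
rewrite subnK //; move=> /(_ ltac:(lra)); lra.
Qed.

Lemma fastest A P : cpath P -> (forall t, 0 <= t <= 1 -> trk A (P t)) ->
  exists2 t, 0 <= t <= 1 & forall s, 0 <= s <= 1 -> faster (P t) (P s).
Proof.
move=> cP H.
have /choice [x Hx] : forall n, exists t, 0 <= t <= 1 /\
    forall s, 0 <= s <= 1 -> re (F n (P s)) <= re (F n (P t)).
  by move=> n; have [t t01 T] := max01 (@ler01 R) (@cpath_re _ a n _ cP); exists t.
have [t t01 T] := cluster01 (fun n => (Hx n).1).
exists t => // s s01; apply: contrapT => /not_faster [n hn].
have [||d d0 D] := @cts_pos R (fun r => re (F n (P s)) - (re (F n (P r)) + 4)) t.
- by apply: cts_sub; [exact: cts_cst|apply: cts_add; [exact: cpath_re|exact: cts_cst]].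
- lra.
have [k nk /D hk] := T d n d0.
have := (Hx k).2 s s01.
have := @gap_fwd _ a A (P s) (P (x k)) n (k - n) (H _ s01) (H _ (Hx k).1).
rewrite subnK //; move=> /(_ ltac:(lra)); lra.
Qed.

Definition between x y z := (faster y x /\ faster z y) \/ (faster x y /\ faster y z).

(** At each time n the usual intermediate value theorem gives a parameter whose orbit is then within
    4 of [y] in real part. A cluster point of these parameters is mapped to [y], since expansion
    would push a positive distance beyond the bound 4^2 + pi^2. *)
Lemma order_ivt01 A P y : cpath P -> (forall t, 0 <= t <= 1 -> trk A (P t)) -> trk A y ->
  between (P 0) y (P 1) -> exists2 t, 0 <= t <= 1 & P t = y.
Proof.
move=> cP H hy bt.
have /choice [x Hx] : forall n, exists t, 0 <= t <= 1 /\ `|re (F n (P t)) - re (F n y)| <= 4.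
  move=> n.
  have [h0|h0] := boolP (`|re (F n (P 0)) - re (F n y)| <= 4); first by exists 0; split => //; lra.
  have [h1|h1] := boolP (`|re (F n (P 1)) - re (F n y)| <= 4); first by exists 1; split => //; lra.
  have [|c c01 E] := @ivt01 R (fun t => re (F n (P t))) 0 1 (re (F n y)) ler01 (@cpath_re _ a n _ cP).
    move: h0 h1; rewrite !ler_norml !negb_and -!ltNge => /orP h0 /orP h1.
    case: bt => -[/(_ n) b1 /(_ n) b2].
      by left; case: h0; case: h1; lra.
    by right; case: h0; case: h1; lra.
  by exists c; rewrite E subrr normr0; split => //; lra.
have [t t01 T] := cluster01 (fun n => (Hx n).1).
exists t => //; apply: dist2_eq0; rewrite leNgt; apply/negP => d0.
have cD : continuous (fun s => dist2 (P s) y).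
  case: cP => c1 c2; have -> : (fun s => dist2 (P s) y) = fun s =>
    (re (P s) - re y) * (re (P s) - re y) + (im (P s) - im y) * (im (P s) - im y).
    by apply: funext => s; rewrite /dist2 !expr2.
  by apply: cts_add; apply: cts_mul; apply: cts_sub => //; exact: cts_cst.
have [||d d1 D] := @cts_pos R (fun s => dist2 (P s) y - dist2 (P t) y / 2) t.
- by apply: cts_sub => //; exact: cts_cst.
- lra.
have [N HN] := pow4_big (4 ^+ 2 + pi ^+ 2) (ltac:(lra) : 0 < dist2 (P t) y / 2).
have [n Nn /D hn] := T d N d1.
have G := @grow _ a A (P (x n)) y n (H _ (Hx n).1) hy.
have B : dist2 (F n (P (x n))) (F n y) <= 4 ^+ 2 + pi ^+ 2.
  by apply: lerD; apply: sq_le; [exact: (Hx n).2|apply: ltW; apply: (trk_im (A := A)) => //; exact: H (Hx n).1].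
have : 4 ^+ N * (dist2 (P t) y / 2) <= 4 ^+ n * dist2 (P (x n)) y.
  apply: ler_pM; [by apply: exprn_ge0|lra| |lra].
  by apply: ler_weXn2l => //; lra.
lra.
Qed.

Lemma order_ivt A P y p q : p <= q -> cpath P -> (forall t, p <= t <= q -> trk A (P t)) ->
  trk A y -> between (P p) y (P q) -> exists2 t, p <= t <= q & P t = y.
Proof.
move=> pq cP H hy b.
have [||||s s01 E] := @order_ivt01 A (seg P p q) y => //; first exact: seg_cpath.
- by move=> t t01; apply: H; exact: seg_itv.
- by rewrite seg0 seg1.
by exists (p + s * (q - p)) => //; exact: seg_itv.
Qed.

(** If the path turned at [e], [order_ivt] would make it repeat on one side of [e] a value taken
    nearby on the other side, against local injectivity. *)
Lemma no_turn A P e eta : linj P -> cpath P -> (forall t, 0 <= t <= 1 -> trk A (P t)) ->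
  0 < e < 1 -> 0 < eta ->
  (forall p q, 0 <= p < e -> e < q <= 1 -> `|p - e| < eta -> `|q - e| < eta ->
     between (P p) (P q) (P e) \/ between (P e) (P p) (P q)) -> False.
Proof.
move=> lP cP H e01 eta0 B; have [|d d0 D] := lP e; first lra.
pose h := Num.min (Num.min (d / 2) (eta / 2)) (Num.min e (1 - e)).
have h0 : 0 < h by rewrite !lt_min; lra.
have [hd he h1 h2] : [/\ h <= d / 2, h <= eta / 2, h <= e & h <= 1 - e].
  by rewrite /h; split; rewrite !ge_min lexx ?orbT.
have n1 : `|(e - h) - e| = h by rewrite addrAC subrr add0r normrN gtr0_norm.
have n2 : `|(e + h) - e| = h by rewrite addrAC subrr add0r gtr0_norm.
have [||||b|b] := B (e - h) (e + h); rewrite ?n1 ?n2; try lra.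
  have [|||||r r1 E] := @order_ivt A P (P (e + h)) (e - h) e => //; first lra.
  - by move=> t ht; apply: H; lra.
  - by apply: H; lra.
  have : r = e + h by apply: D; rewrite ?n2 //; try lra; rewrite ltr_norml; lra.
  lra.
have [|||||r r1 E] := @order_ivt A P (P (e - h)) e (e + h) => //; first lra.
- by move=> t ht; apply: H; lra.
- by apply: H; lra.
have : r = e - h by apply: D; rewrite ?n1 //; try lra; rewrite ltr_norml; lra.
lra.
Qed.

Lemma no_interior_slowest A P e p q : linj P -> cpath P ->
  (forall t, 0 <= t <= 1 -> trk A (P t)) -> 0 <= p < e -> e < q <= 1 ->
  (forall s, p <= s <= q -> faster (P s) (P e)) -> False.
Proof.
move=> lP cP H pe eq S.
apply: (@no_turn A P e (Num.min (e - p) (q - e))) => //; first lra.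
  by rewrite lt_min; lra.
move=> r r' hr hr'; rewrite !lt_min !ltr_norml => g g'.
have [h|h] := @faster_total _ a A (P r) (P r') (H r ltac:(lra)) (H r' ltac:(lra)).
  by left; right; split => //; apply: S; lra.
by right; left; split => //; apply: S; lra.
Qed.

Lemma no_interior_fastest A P e p q : linj P -> cpath P ->
  (forall t, 0 <= t <= 1 -> trk A (P t)) -> 0 <= p < e -> e < q <= 1 ->
  (forall s, p <= s <= q -> faster (P e) (P s)) -> False.
Proof.
move=> lP cP H pe eq S.
apply: (@no_turn A P e (Num.min (e - p) (q - e))) => //; first lra.
  by rewrite lt_min; lra.
move=> r r' hr hr'; rewrite !lt_min !ltr_norml => g g'.
have [h|h] := @faster_total _ a A (P r) (P r') (H r ltac:(lra)) (H r' ltac:(lra)).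
  by right; right; split => //; apply: S; lra.
by left; left; split => //; apply: S; lra.
Qed.

Lemma slow_end A P : linj P -> cpath P -> (forall t, 0 <= t <= 1 -> trk A (P t)) ->
  (forall t, 0 <= t <= 1 -> faster (P t) (P 0)) \/ (forall t, 0 <= t <= 1 -> faster (P t) (P 1)).
Proof.
move=> lP cP H; have [e e01 S] := slowest cP H.
move: S; case: (ltrgtP 0 e) => [e0|e0|<-] S; [|lra|by left].
move: S; case: (ltrgtP e 1) => [e1|e1|->] S; [|lra|by right].
by exfalso; apply: (@no_interior_slowest A P e 0 1) => //; lra.
Qed.

(** On a loop from [s] to [t] neither the slowest nor the fastest point can be interior. Both are
    then the common end, and antisymmetry makes the path constant there. *)
Lemma tracked_inj A P : linj P -> cpath P -> (forall t, 0 <= t <= 1 -> trk A (P t)) ->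
  forall s t, 0 <= s <= 1 -> 0 <= t <= 1 -> P s = P t -> s = t.
Proof.
move=> lP cP H s t s01 t01.
wlog st : s t s01 t01 / s <= t.
  move=> W E; case: (lerP s t) => [|/ltW] h; first exact: W.
  by apply: esym; apply: W.
move=> E; apply: contrapT => /eqP nst.
have {nst} {}st : s < t by rewrite lt_neqAle nst.
have sub r : s <= r <= t -> 0 <= r <= 1 by lra.
have [x x01 Sx] := @slowest A (seg P s t) (seg_cpath s t cP) (fun r r01 => H _ (sub _ (seg_itv (ltW st) r01))).
have [y y01 Sy] := @fastest A (seg P s t) (seg_cpath s t cP) (fun r r01 => H _ (sub _ (seg_itv (ltW st) r01))).
set X := s + x * (t - s); set Y := s + y * (t - s).
have SX r : s <= r <= t -> faster (P r) (P X).
  by move=> /seg_surj [r' r01 ->]; exact: Sx.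
have SY r : s <= r <= t -> faster (P Y) (P r).
  by move=> /seg_surj [r' r01 ->]; exact: Sy.
have Xst : s <= X <= t by exact: seg_itv (ltW st) x01.
have Yst : s <= Y <= t by exact: seg_itv (ltW st) y01.
have EX : P X = P s.
  case: (ltrgtP s X) => [h|h|<- //]; last by exfalso; lra.
  case: (ltrgtP X t) => [h'|h'|-> //]; last by exfalso; lra.
  by exfalso; apply: (@no_interior_slowest A P X s t) => //; lra.
have EY : P Y = P s.
  case: (ltrgtP s Y) => [h|h|<- //]; last by exfalso; lra.
  case: (ltrgtP Y t) => [h'|h'|-> //]; last by exfalso; lra.
  by exfalso; apply: (@no_interior_fastest A P Y s t) => //; lra.
have C r : s <= r <= t -> P r = P s.
  move=> hr; apply: (@faster_anti _ a A); rewrite -?EX; try (by apply: H; apply: sub).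
  - exact: SX.
  - by rewrite EX -EY; exact: SY.
have [d d0 D] := lP s s01.
pose r := s + Num.min (d / 2) (t - s).
have r1 : s < r by rewrite ltrDl lt_min; lra.
have r2 : r <= t by rewrite -lerBrDl ge_min lexx orbT.
have r3 : r - s <= d / 2 by rewrite /r addrAC subrr add0r ge_min lexx.
have : r = s.
  apply: D => //; [lra|by rewrite ltr_norml; lra|by rewrite subrr normr0|].
  by apply: C; lra.
lra.
Qed.

(** Backward induction on time. Images far to the right confine the path at time [j] to a single
    strip, of height pi < 4; as [P t1] is within 20 of [v] vertically, the whole path is within 24.
    Then [cmp_step] restores the bound on real parts with the same loss of 4. *)
Lemma pullback P v n0 n t1 : cpath P -> 0 <= t1 <= 1 ->
  (forall t, 0 <= t <= 1 -> re (F n v) - 4 <= re (F n (P t)) /\ `|im (F n (P t)) - im (F n v)| <= 24) ->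
  (forall j, (n0 <= j <= n)%N -> m0 + 4 <= re (F j v)) ->
  (forall j, (n0 <= j < n)%N -> `|im (F j (P t1)) - im (F j v)| <= 20) ->
  forall j, (n0 <= j <= n)%N -> forall t, 0 <= t <= 1 ->
    re (F j v) - 4 <= re (F j (P t)) /\ `|im (F j (P t)) - im (F j v)| <= 24.
Proof.
move=> cP t101 Hn Hv H1.
suff K k : (k <= n - n0)%N -> forall t, 0 <= t <= 1 ->
    re (F (n - k) v) - 4 <= re (F (n - k) (P t)) /\ `|im (F (n - k) (P t)) - im (F (n - k) v)| <= 24.
  move=> j /andP[j0 jn]; have := K (n - j)%N; rewrite subKn //; apply.
  exact: leq_sub2l.
elim: k => [|k IH] kn; first by rewrite subn0.
have {}IH := IH (ltnW kn).
have kn' : (k < n)%N by apply: leq_trans kn (leq_subr _ _).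
have E : (n - k = (n - k.+1).+1)%N by rewrite subnSK.
set j := (n - k.+1)%N in E *.
have [j0 jn] : (n0 <= j)%N /\ (j < n)%N by exact: sub_bounds.
move=> t t01.
have far1 s : 0 <= s <= 1 -> m0 <= re (f (F j (P s))).
  move=> s01; have [h _] := IH s s01.
  have := Hv (n - k)%N; rewrite E /= in h *; move=> /(_ ltac:(by rewrite leqW)); lra.
have [l L] := strip_ex (far1 t1 t101).
have L' := @strip_path _ a l (fun s => F j (P s)) t1 t (cpath_F a j cP) far1 t101 t01 L.
have I1 := instrip_diff L' L.
have I2 := H1 j ltac:(by rewrite j0).
have p4 := pi_lt4 R.
split.
  have [h1 h2] := IH t t01.
  apply: (@cmp_step _ a); [|by move: h1; rewrite E|by move: h2; rewrite E].
  have := Hv (n - k)%N; rewrite E /=; move=> /(_ ltac:(by rewrite leqW)); lra.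
move: I1 I2; rewrite /= !ltr_norml !ler_norml; lra.
Qed.

Lemma path_trk P N : cpath P -> (forall t, 0 <= t <= 1 -> far m0 N (P t)) ->
  exists A, forall t, 0 <= t <= 1 -> trk A (F N (P t)).
Proof.
move=> cP H.
have [A HA] := far_trk (@far_shift _ a m0 0 N (P 0) (H 0 ltac:(lra))).
exists A => t t01 r; split.
  by rewrite -F_add; apply: H => //; exact: leq_addl.
have := (HA r).2; rewrite -!F_add.
apply: (@strip_path _ a _ (fun s => F (r + N) (P s)) 0 t) => //; try lra.
  exact: cpath_F.
by move=> s s01; apply: (H s s01 (r + N).+1); rewrite ltnW // ltnS leq_addl.
Qed.

(** The point is that [N] disappears from the conclusion. The slowest point of the path is one of
    its ends, and [pullback] compares the path with that end from time [n0] on. *)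
Lemma uniform_from_ends P N n0 m : m0 + 8 <= m -> cpath P -> linj P -> (forall t, 0 <= t <= 1 -> far m0 N (P t)) ->
  far m n0 (P 0) -> far m n0 (P 1) ->
  forall t, 0 <= t <= 1 -> far (m - 4) n0 (P t).
Proof.
move=> mm cP lP H H0 H1.
have [A HA] := path_trk cP H.
have cQ := cpath_F a N cP; have lQ := linj_F N cP lP.
suff W e : 0 <= e <= 1 -> far m n0 (P e) ->
    (forall t, 0 <= t <= 1 -> faster (F N (P t)) (F N (P e))) ->
    forall t, 0 <= t <= 1 -> far (m - 4) n0 (P t).
  by case: (slow_end lQ cQ HA) => S; [apply: (W 0)|apply: (W 1)] => //; lra.
move=> e01 He S t t01 j j0.
pose n := maxn j N.
have [||||h _] := @pullback P (P e) n0 n e cP e01 _ _ _ j _ t t01.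
- move=> s s01; have := S s s01 (n - N)%N; rewrite -!F_add subnK ?leq_maxr // => h; split; first lra.
  have := @trk_im _ a A (F N (P s)) (F N (P e)) (n - N)%N (HA s s01) (HA e e01).
  by rewrite -!F_add subnK ?leq_maxr //; have := pi_lt4 R; lra.
- by move=> i /andP[i0 _]; have := He i i0; lra.
- by move=> i _; rewrite subrr normr0; lra.
- by rewrite j0 leq_maxl.
by have := He j j0; lra.
Qed.

End OrderedPaths.

(** * Tails and separation *)

Section Barriers.
Variables (R : realType) (a : R[i]).
Implicit Types (P Q T C : R -> R[i]) (e q u v w x y z : R[i]) (s t m : R) (A B : nat -> int).
Local Notation f := (expmap a).
Local Notation F n := (iter n (expmap a)).
Local Notation m0 := (m0 a).

(** The branch of the inverse of [f] from the half-plane re w > re a to strip [k], in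
    coordinates. *)
Definition logb (k : int) w : R[i] :=
  (ln (Num.sqrt ((re w - re a) ^+ 2 + (im w - im a) ^+ 2)))
  +i* (atan ((im w - im a) / (re w - re a)) + k%:~R * (2 * pi)).

Lemma logb_strip k w : instrip k (logb k w).
Proof. by rewrite /instrip /= addrK ltr_norml atan_gtNpi2 atan_ltpi2. Qed.

Lemma sqr_pos (x y : R) : 0 < x -> 0 < x ^+ 2 + y ^+ 2.
Proof. by move=> x0; have := sqr_ge0 y; nra. Qed.

Lemma f_logb k w : m0 <= re w -> f (logb k w) = w.
Proof.
move=> /far_re h; have x0 : 0 < re w - re a by lra.
have [r r0] := isarg_pos (im w - im a) x0.
set th := atan _ => -[e1 e2].
have N : Num.sqrt ((re w - re a) ^+ 2 + (im w - im a) ^+ 2) = r.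
  by rewrite e1 e2 !exprMn -mulrDr cos2Dsin2 mulr1 sqrtr_sqr gtr0_norm.
have e3 : expR (re (logb k w)) = r by rewrite /= N lnK.
apply: Cext; rewrite ?re_f ?im_f e3 /= ?cosDint ?sinDint -/th -?e1 -?e2; ring.
Qed.

Lemma logb_cpath k P : cpath P -> (forall t, m0 <= re (P t)) -> cpath (fun t => logb k (P t)).
Proof.
move=> [cx cy] H.
have x0 t : 0 < re (P t) - re a by have := far_re (H t); lra.
have c1 : continuous (fun t => re (P t) - re a) by apply: cts_sub => //; exact: cts_cst.
have c2 : continuous (fun t => im (P t) - im a) by apply: cts_sub => //; exact: cts_cst.
split => /=; last first.
  apply: cts_add; last exact: cts_cst.
  by apply: atan_cts; apply: cts_div => // t; exact: lt0r_neq0.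
move=> t; apply: (@continuous_comp _ _ _ (fun t => Num.sqrt ((re (P t) - re a) ^+ 2 + (im (P t) - im a) ^+ 2)) (@ln R)); last first.
  by apply: continuous_ln; rewrite sqrtr_gt0 sqr_pos.
apply: (@continuous_comp _ _ _ (fun t => (re (P t) - re a) ^+ 2 + (im (P t) - im a) ^+ 2) (@Num.sqrt R)); last first.
  exact: sqrt_continuous.
by move: t; apply: cts_add; under eq_fun do rewrite expr2; exact: cts_mul.
Qed.

Lemma re_logb_ge k w b : m0 <= re w -> expR b <= `|re w - re a| \/ expR b <= `|im w - im a| ->
  b <= re (logb k w).
Proof.
move=> /far_re h hb; rewrite -ler_expR /= lnK ?posrE ?sqrtr_gt0; last by apply: sqr_pos; lra.
rewrite -[leLHS]gtr0_norm ?expR_gt0 // -sqrtr_sqr; apply: ler_wsqrtr.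
have h1 := sqr_ge0 (re w - re a); have h2 := sqr_ge0 (im w - im a).
have e0 := expR_gt0 b.
case: hb => hb.
  have : expR b ^+ 2 <= (re w - re a) ^+ 2.
    by rewrite -[leRHS]real_normK ?num_real //; apply: sq_le; rewrite (gtr0_norm e0).
  lra.
have : expR b ^+ 2 <= (im w - im a) ^+ 2.
  by rewrite -[leRHS]real_normK ?num_real //; apply: sq_le; rewrite (gtr0_norm e0).
lra.
Qed.

Lemma re_logb_le k w b : m0 <= re w -> `|re w - re a| + `|im w - im a| <= expR b ->
  re (logb k w) <= b.
Proof.
move=> /far_re h hb; rewrite -ler_expR /= lnK ?posrE ?sqrtr_gt0; last by apply: sqr_pos; lra.
rewrite -[leRHS]gtr0_norm ?expR_gt0 // -sqrtr_sqr; apply: ler_wsqrtr.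
rewrite -[(re w - re a) ^+ 2]real_normK ?num_real // -[(im w - im a) ^+ 2]real_normK ?num_real //.
have := normr_ge0 (re w - re a); have := normr_ge0 (im w - im a).
move: (`|re w - re a|) (`|im w - im a|) hb => x y hb y0 x0.
apply: le_trans (_ : (x + y) ^+ 2 <= _); first nra.
by apply: sq_le; rewrite ger0_norm //; lra.
Qed.

Definition inJ m A y := forall r, m <= re (F r y) /\ instrip (A r) (F r y).

(** Approximation of depth [d] to [inJ]: by [eventually_avoids], finitely many conditions then
    suffice to keep a path off an infinite itinerary. *)
Definition follows m A d y :=
  forall r, (r <= d)%N -> m <= re (F r y) /\ ((r < d)%N -> instrip (A r) (F r y)).

Lemma follows_le m A d d' y : (d <= d')%N -> follows m A d' y -> follows m A d y.
Proof.
move=> dd H r rd; have [h1 h2] := H r (leq_trans rd dd); split => // rd'.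
by apply: h2; exact: leq_trans rd' dd.
Qed.

(** Compactness. A cluster point of the parameters lies in some strip at each time because its next
    image is right of [m0], and strips being open and disjoint, it is the prescribed one. *)
Lemma follows_inJ m A C : m0 <= m -> cpath C ->
  (forall d, exists2 t, 0 <= t <= 1 & follows m A d (C t)) ->
  exists2 t, 0 <= t <= 1 & inJ m A (C t).
Proof.
move=> mm cC H.
have /choice [x Hx] : forall d, exists t, 0 <= t <= 1 /\ follows m A d (C t).
  by move=> d; have [t ? ?] := H d; exists t.
have [t t01 T] := cluster01 (fun n => (Hx n).1).
have h1 r : m <= re (F r (C t)).
  rewrite leNgt; apply/negP => h.
  have [||d d0 D] := @cts_pos R (fun s => m - re (F r (C s))) t.
  - by apply: cts_sub; [exact: cts_cst|exact: cpath_re].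
  - lra.
  have [n rn /D hn] := T d r d0.
  by have := ((Hx n).2 r rn).1; lra.
exists t => // r; split => //.
have [k K] : exists k, instrip k (F r (C t)).
  by apply: (@strip_ex _ a); apply: le_trans mm _; exact: (h1 r.+1).
have [d d0 D] := instrip_near (cpath_F a r cC) K.
have [n rn /D hn] := T d r.+1 d0.
have := ((Hx n).2 r (ltnW rn)).2 rn => h.
by rewrite -(instrip_uniq hn h).
Qed.

Lemma eventually_avoids m A C : m0 <= m -> cpath C ->
  (forall t, 0 <= t <= 1 -> ~ inJ m A (C t)) ->
  exists d0, forall d t, (d0 <= d)%N -> 0 <= t <= 1 -> ~ follows m A d (C t).
Proof.
move=> mm cC H; apply: contrapT => nH.
have [d|t t01] := @follows_inJ m A C mm cC; last exact: H.
apply: contrapT => nd; apply: nH; exists d => d' t dd t01 hf; apply: nd; exists t => //.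
exact: follows_le dd hf.
Qed.

(* Pull a horizontal ray back [d] times. *)
Lemma tail_exists d : forall A e b,
  (forall r, (r <= d)%N -> m0 + 4 <= re (F r e) /\ ((r < d)%N -> instrip (A r) (F r e))) ->
  exists T, [/\ cpath T, T 0 = e,
    forall t r, (r <= d)%N -> [/\ re (F r e) - 4 <= re (F r (T t)),
      `|im (F r (T t)) - im (F r e)| <= 4 & (r < d)%N -> instrip (A r) (F r (T t))]
    & forall r, (r <= d)%N -> b <= re (F r (T 1))].
Proof.
elim: d => [|d IH] A e b H.
  pose l := `|b| + `|re e|.
  have l0 : 0 <= l by rewrite addr_ge0 ?normr_ge0.
  exists (fun t => (re e + clamp t * l) +i* im e); split.
  - split => /=; last exact: cts_cst.
    apply: cts_add; first exact: cts_cst.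
    by apply: cts_mul; [exact: clamp_cts|exact: cts_cst].
  - by apply: Cext; rewrite /= ?clamp_le0 ?mul0r ?addr0.
  - move=> t r; rewrite leqn0 => /eqP -> /=; rewrite subrr normr0; split => //.
    by have := clamp01 t; nra.
  - move=> r; rewrite leqn0 => /eqP -> /=; rewrite clamp_ge1 // mul1r /l.
    by have := ler_norm b; have := ler_norm (- re e); rewrite normrN; lra.
(* A branch of the inverse takes points with real part beyond expR b + [|re a|] to points with real
   part beyond [b]. *)
have [|T [cT T0 T1 T2]] := IH (fun r => A r.+1) (f e) (Num.max b (expR b + `|re a|)).
  by move=> r rd; rewrite -iterSr; exact: H.
have Tm t : m0 <= re (T t).
  by have [h _ _] := T1 t 0%N (leq0n _); have [h' _] := H 1%N isT; rewrite /= in h h'; lra.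
have EF t : f (logb (A 0%N) (T t)) = T t by exact: f_logb.
have EFr t r : F r.+1 (logb (A 0%N) (T t)) = F r (T t) by rewrite iterSr EF.
have S0 : instrip (A 0%N) e by apply: (H 0%N _).2.
have D t : `|im (logb (A 0%N) (T t)) - im e| <= 4.
  by have := instrip_diff (logb_strip (A 0%N) (T t)) S0; have := pi_lt4 R; lra.
exists (fun t => logb (A 0%N) (T t)); split.
- exact: logb_cpath.
- apply: (@f_inj_near _ a); last by rewrite EF T0.
  by have := instrip_diff (logb_strip (A 0%N) (T 0)) S0; have := @pi_gt0 R; lra.
- move=> t [|r] rd.
    split; [|exact: D|by move=> _; exact: logb_strip].
    have [h1 h2 _] := T1 t 0%N (leq0n _).
    apply: (@cmp_step _ a) => /=; rewrite ?EF //.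
      by have [h' _] := H 1%N isT; rewrite /= in h'; lra.
    by move: h2 => /=; lra.
  cbv beta; rewrite EFr iterSr; have [h1 h2 h3] := T1 t r rd; split => //.
- move=> [|r] rd.
    apply: (@re_logb_ge (A 0%N) (T 1) b (Tm 1)); left.
    have := T2 0%N (leq0n _); rewrite /= ge_max => /andP[_ h].
    by have := ler_norm (re (T 1) - re a); have := ler_norm (re a); lra.
  by cbv beta; rewrite EFr; have := T2 r rd; rewrite ge_max => /andP[].
Qed.

Definition lexlt A B := exists r, (forall i, (i < r)%N -> A i = B i) /\ A r < B r.

Lemma W_strip_below T q (k l : int) : cpath T -> (forall t, 0 <= t <= 1 -> instrip k (T t)) ->
  instrip l q -> k < l -> re (T 0) < re q -> re q < re (T 1) -> W T q (- pi) 0.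
Proof.
move=> cT H hq kl h0 h1; apply: W_below => // t t01.
have := H t t01; move: hq; rewrite /instrip !ltr_norml => hl hk.
have : (k + 1)%:~R * (2 * pi) <= l%:~R * (2 * pi) :> R.
  by rewrite ler_pM2r ?ler_int; [rewrite lezD1|have := @pi_gt0 R; lra].
by rewrite intrD mulrDl; have := @pi_gt0 R; lra.
Qed.

Lemma W_strip_above T q (k l : int) : cpath T -> (forall t, 0 <= t <= 1 -> instrip k (T t)) ->
  instrip l q -> l < k -> re (T 0) < re q -> re q < re (T 1) -> W T q pi 0.
Proof.
move=> cT H hq kl h0 h1; apply: W_above => // t t01.
have := H t t01; move: hq; rewrite /instrip !ltr_norml => hl hk.
have : (l + 1)%:~R * (2 * pi) <= k%:~R * (2 * pi) :> R.
  by rewrite ler_pM2r ?ler_int; [rewrite lezD1|have := @pi_gt0 R; lra].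
by rewrite intrD mulrDl; have := @pi_gt0 R; lra.
Qed.

(* On which side of [q] the tail passes is decided when the strips first differ, and the
   conformal branches of the inverse do not change it. *)
Lemma W_pass T q A B r c : cpath T ->
  (forall t i, 0 <= t <= 1 -> (i <= r)%N -> instrip (A i) (F i (T t))) ->
  (forall i, (i <= r)%N -> instrip (B i) (F i q)) ->
  (forall i, (i < r)%N -> A i = B i) -> A r <> B r ->
  (forall i, (i <= r)%N -> re (F i (T 0)) < re (F i q) /\ re (F i q) < re (F i (T 1))) ->
  sin c = 0 -> cos c = -1 ->
  W (fun t => F r (T t)) (F r q) c 0 -> W T q c 0.
Proof.
move=> cT hT hq AB nAB hre sc cc Wr.
suff K k : (k <= r)%N -> W (fun t => F (r - k) (T t)) (F (r - k) q) c 0.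
  by have := K r (leqnn r); rewrite subnn.
elim: k => [|k IH] kr; first by rewrite subn0.
have {}IH := IH (ltnW kr).
have [_ jr] := @sub_bounds 0 r k ltac:(by rewrite subn0).
move: IH; rewrite -(subnSK kr); set j := (r - k.+1)%N in jr *; move=> IH.
have [g1 g2] := hre j (ltnW jr).
apply: (W_ratio _ _ _ _ _ _ _ IH) => //.
- exact: (cpath_F a j.+1).
- exact: (cpath_F a j).
- move=> t t01.
  have h1 := hT t j t01 (ltnW jr); have h2 := hq j (ltnW jr); rewrite -AB // in h2.
  rewrite mulrC [X in _ + X]mulrC; apply: (@mono_step _ _ (A j)) => // E.
  have e : F r (T t) = F r q by rewrite -(subnK (ltnW jr)) !F_add E.
  apply: nAB; have := hT t r t01 (leqnn r); rewrite e => h3.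
  exact: instrip_uniq h3 (hq r (leqnn r)).
- exact: sin0.
- by rewrite cc; lra.
- by rewrite cos0; lra.
Qed.

Lemma W_pass_below T q A B : cpath T -> lexlt A B ->
  forall d, (forall t i, 0 <= t <= 1 -> (i < d)%N -> instrip (A i) (F i (T t))) ->
  (forall i, (i < d)%N -> instrip (B i) (F i q)) ->
  (forall i, (i < d)%N -> re (F i (T 0)) < re (F i q) /\ re (F i q) < re (F i (T 1))) ->
  (exists2 r, (r < d)%N & A r <> B r) -> W T q (- pi) 0.
Proof.
move=> cT [r [AB ABr]] d hT hq hre [r' r'd ne].
have rd : (r < d)%N.
  by rewrite ltnNge; apply/negP => dr; apply: ne; apply: AB; exact: leq_trans r'd dr.
have id i : (i <= r)%N -> (i < d)%N by move=> ir; exact: leq_ltn_trans ir rd.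
apply: (@W_pass T q A B r) => //.
- by move=> t i t01 ir; apply: hT => //; exact: id.
- by move=> i ir; apply: hq; exact: id.
- by move=> E; move: ABr; rewrite E ltxx.
- by move=> i ir; apply: hre; exact: id.
- by rewrite sinN sinpi oppr0.
- by rewrite cosN cospi.
apply: (W_strip_below (k := A r) (l := B r)) => //.
- exact: (cpath_F a r).
- by move=> t t01; exact: hT.
- exact: hq.
- by have [] := hre r rd.
- by have [] := hre r rd.
Qed.

Lemma W_pass_above T q A B : cpath T -> lexlt B A ->
  forall d, (forall t i, 0 <= t <= 1 -> (i < d)%N -> instrip (A i) (F i (T t))) ->
  (forall i, (i < d)%N -> instrip (B i) (F i q)) ->
  (forall i, (i < d)%N -> re (F i (T 0)) < re (F i q) /\ re (F i q) < re (F i (T 1))) ->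
  (exists2 r, (r < d)%N & A r <> B r) -> W T q pi 0.
Proof.
move=> cT [r [AB ABr]] d hT hq hre [r' r'd ne].
have rd : (r < d)%N.
  by rewrite ltnNge; apply/negP => dr; apply: ne; apply: esym; apply: AB; exact: leq_trans r'd dr.
have id i : (i <= r)%N -> (i < d)%N by move=> ir; exact: leq_ltn_trans ir rd.
apply: (@W_pass T q A B r) => //.
- by move=> t i t01 ir; apply: hT => //; exact: id.
- by move=> i ir; apply: hq; exact: id.
- by move=> i ir; apply: esym; exact: AB.
- by move=> E; move: ABr; rewrite E ltxx.
- by move=> i ir; apply: hre; exact: id.
- by rewrite sinpi.
- by rewrite cospi.
apply: (W_strip_above (k := A r) (l := B r)) => //.
- exact: (cpath_F a r).
- by move=> t t01; exact: hT.
- exact: hq.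
- by have [] := hre r rd.
- by have [] := hre r rd.
Qed.

Lemma finite_ub (g : nat -> R) d : exists b, forall r, (r <= d)%N -> g r < b.
Proof.
elim: d => [|d [b H]].
  by exists (g 0%N + 1) => r; rewrite leqn0 => /eqP ->; lra.
exists (Num.max b (g d.+1 + 1)) => r; rewrite leq_eqVlt => /orP[/eqP ->|/H h].
  by rewrite lt_max; apply/orP; right; lra.
by rewrite lt_max h.
Qed.

Lemma path_ub C : cpath C -> exists b, forall t, 0 <= t <= 1 -> re (C t) < b.
Proof.
move=> [cx _]; have [t _ T] := max01 (@ler01 R) cx.
by exists (re (C t) + 1) => s /T; lra.
Qed.

End Barriers.

(** * Unlinked itineraries and barriers *)

Section Unlinked.
Variables (R : realType) (a : R[i]).
Implicit Types (P Q T C : R -> R[i]) (e q u v w x y z : R[i]) (s t m : R) (A B : nat -> int).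
Local Notation f := (expmap a).
Local Notation F n := (iter n (expmap a)).
Local Notation m0 := (m0 a).
Local Notation inJ := (inJ a).
Local Notation follows := (follows a).

Lemma tail_of_orbit m A e d b : m0 <= m -> inJ (m + 4) A e ->
  exists T, [/\ cpath T, T 0 = e, forall t, follows m A d (T t) &
    forall r, (r <= d)%N -> b <= re (F r (T 1))].
Proof.
move=> mm He; have [|T [cT T0 T1 T2]] := @tail_exists _ a d A e b.
  by move=> r _; have [h1 h2] := He r; split => //; lra.
exists T; split => // t r rd; have [h1 _ h2] := T1 t r rd; split => //.
by have [h _] := He r; lra.
Qed.

Lemma follows_uniq m A B d y : follows m A d y -> follows m B d y ->
  (exists2 r, (r < d)%N & A r <> B r) -> False.
Proof.
move=> hA hB [r rd ne]; apply: ne.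
exact: instrip_uniq ((hA r (ltnW rd)).2 rd) ((hB r (ltnW rd)).2 rd).
Qed.

Lemma lexlt_neq A B : lexlt A B -> exists d, forall d', (d <= d')%N -> exists2 r, (r < d')%N & A r <> B r.
Proof.
by move=> [r [_ h]]; exists r.+1 => d' rd; exists r => // E; move: h; rewrite E ltxx.
Qed.

Definition hook T1 C T2 := pcat (prev T1) (pcat C T2).

Section Hook.
Variables (T1 C T2 : R -> R[i]).
Hypotheses (cT1 : cpath T1) (cC : cpath C) (cT2 : cpath T2) (E1 : T1 0 = C 0) (E2 : C 1 = T2 0).

Lemma hook_joint : prev T1 1 = pcat C T2 0.
Proof. by rewrite pcat0 /prev subrr. Qed.

Lemma hook_cpath : cpath (hook T1 C T2).
Proof. by apply: pcat_cpath; [exact: prev_cpath|exact: pcat_cpath]. Qed.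

Lemma hook0 : hook T1 C T2 0 = T1 1.
Proof. by rewrite /hook pcat0 /prev subr0. Qed.

Lemma hook1 : hook T1 C T2 1 = T2 1.
Proof. by rewrite /hook pcat1 ?pcat1 //; exact: hook_joint. Qed.

Lemma hook_img t : 0 <= t <= 1 -> exists2 s, 0 <= s <= 1 &
  [\/ hook T1 C T2 t = T1 s, hook T1 C T2 t = C s | hook T1 C T2 t = T2 s].
Proof.
move=> t01; have [s s01 [E|E]] := pcat_img hook_joint t01.
  by exists (1 - s); [lra|constructor 1; rewrite /hook E].
have [s' s01' [E'|E']] := pcat_img E2 s01; exists s' => //.
  by constructor 2; rewrite /hook E E'.
by constructor 3; rewrite /hook E E'.
Qed.

Lemma W_hook q c0 c1 c2 c3 : W T1 q c1 c0 -> W C q c1 c2 -> W T2 q c2 c3 ->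
  W (hook T1 C T2) q c0 c3.
Proof.
move=> h1 h2 h3; apply: (W_cat hook_joint (W_rev h1)).
exact: W_cat E2 h2 h3.
Qed.

End Hook.

(* Disjoint paths whose ends continue to infinity along disjoint tails cannot interlace:
   the winding of one around the far end of the other would have to jump. *)
Lemma unlinked m (C1 C2 : R -> R[i]) (Aa Ab Ac Ad : nat -> int) :
  m0 <= m -> cpath C1 -> cpath C2 ->
  inJ (m + 4) Aa (C1 0) -> inJ (m + 4) Ab (C2 0) ->
  inJ (m + 4) Ac (C1 1) -> inJ (m + 4) Ad (C2 1) ->
  (forall s t, 0 <= s <= 1 -> 0 <= t <= 1 -> C1 s <> C2 t) ->
  (forall t, 0 <= t <= 1 -> ~ inJ m Aa (C2 t)) ->
  (forall t, 0 <= t <= 1 -> ~ inJ m Ac (C2 t)) ->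
  (forall t, 0 <= t <= 1 -> ~ inJ m Ab (C1 t)) ->
  (forall t, 0 <= t <= 1 -> ~ inJ m Ad (C1 t)) ->
  lexlt Aa Ab -> lexlt Ab Ac -> lexlt Ac Ad -> lexlt Aa Ad -> False.
Proof.
move=> mm cC1 cC2 Ja Jb Jc Jd dis xa xc xb xd Lab Lbc Lcd Lad.
have [da Da] := eventually_avoids mm cC2 xa.
have [dc Dc] := eventually_avoids mm cC2 xc.
have [db Db] := eventually_avoids mm cC1 xb.
have [dd Dd] := eventually_avoids mm cC1 xd.
have [eab Eab] := lexlt_neq Lab; have [ebc Ebc] := lexlt_neq Lbc.
have [ecd Ecd] := lexlt_neq Lcd; have [ead Ead] := lexlt_neq Lad.
pose d := (da + db + dc + dd + eab + ebc + ecd + ead)%N.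
have [hda hdb hdc hdd] : [/\ (da <= d)%N, (db <= d)%N, (dc <= d)%N & (dd <= d)%N].
  by rewrite /d; clear; split; lia.
have [hab hbc hcd had] : [/\ (eab <= d)%N, (ebc <= d)%N, (ecd <= d)%N & (ead <= d)%N].
  by rewrite /d; clear; split; lia.
have {}Da := Da d _ hda; have {}Db := Db d _ hdb.
have {}Dc := Dc d _ hdc; have {}Dd := Dd d _ hdd.
have {}Eab := Eab d hab; have {}Ebc := Ebc d hbc.
have {}Ecd := Ecd d hcd; have {}Ead := Ead d had.
clearbody d; clear hda hdb hdc hdd hab hbc hcd had.
have [b1 B1] := path_ub cC1; have [b2 B2] := path_ub cC2.
have [ba Ba] := finite_ub (fun r => re (F r (C1 0))) d.
have [bc Bc] := finite_ub (fun r => re (F r (C1 1))) d.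
pose b := Num.max b1 (Num.max ba bc).
(* The tails of [C2] end to the right of [C1] and, at all times up to [d], of the ends of [C1]. The
   tails of [C1] are chosen afterwards and longer, so that both ends of [P] lie to the right of all
   of [Q], as [W_transport] requires. *)
have [Tb [cTb Tb0 Tbf Tb1]] := tail_of_orbit d b mm Jb.
have [Td [cTd Td0 Tdf Td1]] := tail_of_orbit d b mm Jd.
have Bb r : (r <= d)%N -> [/\ ba <= re (F r (Tb 1)) & bc <= re (F r (Tb 1))].
  by move=> /Tb1; rewrite !ge_max => /and3P[].
have Bd r : (r <= d)%N -> [/\ ba <= re (F r (Td 1)) & bc <= re (F r (Td 1))].
  by move=> /Td1; rewrite !ge_max => /and3P[].
have Bb0 : b1 <= re (Tb 1) by have := Tb1 0%N (leq0n _); rewrite !ge_max => /and3P[].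
have Bd0 : b1 <= re (Td 1) by have := Td1 0%N (leq0n _); rewrite !ge_max => /and3P[].
have [b3 B3] := path_ub cTb; have [b4 B4] := path_ub cTd.
have [b5 B5] := finite_ub (fun r => re (F r (Tb 1))) d.
have [b6 B6] := finite_ub (fun r => re (F r (Td 1))) d.
pose b' := Num.max (Num.max b2 (Num.max b3 b4)) (Num.max b5 b6).
have [Ta [cTa Ta0 Taf Ta1]] := tail_of_orbit d b' mm Ja.
have [Tc [cTc Tc0 Tcf Tc1]] := tail_of_orbit d b' mm Jc.
have Xa r : (r <= d)%N -> [/\ b2 <= re (F r (Ta 1)), b3 <= re (F r (Ta 1)),
    b4 <= re (F r (Ta 1)), b5 <= re (F r (Ta 1)) & b6 <= re (F r (Ta 1))].
  by move=> /Ta1; rewrite !ge_max => /andP[/and3P[-> -> ->] /andP[-> ->]].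
have Xc r : (r <= d)%N -> [/\ b2 <= re (F r (Tc 1)), b3 <= re (F r (Tc 1)),
    b4 <= re (F r (Tc 1)), b5 <= re (F r (Tc 1)) & b6 <= re (F r (Tc 1))].
  by move=> /Tc1; rewrite !ge_max => /andP[/and3P[-> -> ->] /andP[-> ->]].
have strip A y i : follows m A d y -> (i < d)%N -> instrip (A i) (F i y).
  by move=> h id; exact: (h i (ltnW id)).2.
pose P := hook Ta C1 Tc; pose Q := hook Tb C2 Td.
have cP : cpath P by exact: hook_cpath.
have cQ : cpath Q by exact: hook_cpath.
have P0 : P 0 = Ta 1 by exact: hook0.
have P1 : P 1 = Tc 1 by apply: hook1.
have Q0 : Q 0 = Tb 1 by exact: hook0.
have Q1 : Q 1 = Td 1 by apply: hook1.
have PQ s t : 0 <= s <= 1 -> 0 <= t <= 1 -> P s <> Q t.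
  move=> s01 t01; have [s' s01' hP] := hook_img Ta0 (esym Tc0) s01.
  have [t' t01' hQ] := hook_img Tb0 (esym Td0) t01; rewrite /P /Q.
  case: hP => ->; case: hQ => -> E.
  - by apply: (follows_uniq (Taf s')) Eab; rewrite E.
  - by apply: (Da t') => //; rewrite -E.
  - by apply: (follows_uniq (Taf s')) Ead; rewrite E.
  - by apply: (Db s') => //; rewrite E.
  - exact: dis E.
  - by apply: (Dd s') => //; rewrite E.
  - by apply: (follows_uniq (Tbf t')) Ebc; rewrite -E.
  - by apply: (Dc t') => //; rewrite -E.
  - by apply: (follows_uniq (Tcf s')) Ecd; rewrite E.
have Qub t : 0 <= t <= 1 -> re (Q t) < re (Ta 1) /\ re (Q t) < re (Tc 1).
  move=> t01; have [t' t01' hQ] := hook_img Tb0 (esym Td0) t01; rewrite /Q.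
  have [? ? ? _ _] : [/\ b2 <= re (Ta 1), b3 <= re (Ta 1), b4 <= re (Ta 1),
    b5 <= re (Ta 1) & b6 <= re (Ta 1)] := Xa 0%N (leq0n _).
  have [? ? ? _ _] : [/\ b2 <= re (Tc 1), b3 <= re (Tc 1), b4 <= re (Tc 1),
    b5 <= re (Tc 1) & b6 <= re (Tc 1)] := Xc 0%N (leq0n _).
  by case: hQ => ->; split; first [exact: (lt_le_trans (B2 t' t01')) | exact: (lt_le_trans (B3 t' t01'))
    | exact: (lt_le_trans (B4 t' t01'))].
have c1lt s : 0 <= s <= 1 -> re (C1 s) < re (Tb 1) /\ re (C1 s) < re (Td 1).
  by move=> /B1 h; split; apply: lt_le_trans h _.
have Ea i : (i < d)%N -> re (F i (Ta 0)) < re (F i (Tb 1)) /\ re (F i (Tb 1)) < re (F i (Ta 1)).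
  move=> /ltnW id; rewrite Ta0; have [h1 _] := Bb i id; have [_ _ _ h2 _] := Xa i id.
  by split; [exact: lt_le_trans (Ba i id) h1|exact: lt_le_trans (B5 i id) h2].
have Ea' i : (i < d)%N -> re (F i (Ta 0)) < re (F i (Td 1)) /\ re (F i (Td 1)) < re (F i (Ta 1)).
  move=> /ltnW id; rewrite Ta0; have [h1 _] := Bd i id; have [_ _ _ _ h2] := Xa i id.
  by split; [exact: lt_le_trans (Ba i id) h1|exact: lt_le_trans (B6 i id) h2].
have Ec i : (i < d)%N -> re (F i (Tc 0)) < re (F i (Tb 1)) /\ re (F i (Tb 1)) < re (F i (Tc 1)).
  move=> /ltnW id; rewrite Tc0; have [_ h1] := Bb i id; have [_ _ _ h2 _] := Xc i id.
  by split; [exact: lt_le_trans (Bc i id) h1|exact: lt_le_trans (B5 i id) h2].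
have Ec' i : (i < d)%N -> re (F i (Tc 0)) < re (F i (Td 1)) /\ re (F i (Td 1)) < re (F i (Tc 1)).
  move=> /ltnW id; rewrite Tc0; have [_ h1] := Bd i id; have [_ _ _ _ h2] := Xc i id.
  by split; [exact: lt_le_trans (Bc i id) h1|exact: lt_le_trans (B6 i id) h2].
have sa t i : 0 <= t <= 1 -> (i < d)%N -> instrip (Aa i) (F i (Ta t)).
  by move=> _; exact: strip.
have sc t i : 0 <= t <= 1 -> (i < d)%N -> instrip (Ac i) (F i (Tc t)).
  by move=> _; exact: strip.
have sb i : (i < d)%N -> instrip (Ab i) (F i (Tb 1)) by exact: strip.
have sd i : (i < d)%N -> instrip (Ad i) (F i (Td 1)) by exact: strip.
have Ebc' : exists2 r, (r < d)%N & Ac r <> Ab r.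
  by have [r rd ne] := Ebc; exists r => // E; exact: ne.
(* Around the far end of [Tb], the tail [Ta] passes below and [Tc] above, so [P] turns by - 2 pi;
   around the far end of [Td] both pass below and the turn is 0. *)
have Wa := W_pass_below cTa Lab sa sb Ea Eab.
have Wc := W_shift (W_pass_above cTc Lbc sc sb Ec Ebc').
have Wa' := W_pass_below cTa Lad sa sd Ea' Ead.
have Wc' := W_pass_below cTc Lcd sc sd Ec' Ecd.
have pE : pi - 2 * pi = - pi :> R by ring.
rewrite pE sub0r in Wc.
have Wb1 := W_left cC1 (fun t t01 => (c1lt t t01).1).
have Wd1 := W_left cC1 (fun t t01 => (c1lt t t01).2).
have Wb := W_hook Ta0 (esym Tc0) Wa Wb1 Wc.
have Wd := W_hook Ta0 (esym Tc0) Wa' Wd1 Wc'.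
rewrite -/P -Q0 in Wb; rewrite -/P -Q1 in Wd.
have c2 : cos (- (2 * pi)) = 1 :> R.
  by rewrite cosN mulr_natl -[pi *+ 2]add0r cosD2pi cos0.
have s2 : sin (- (2 * pi)) = 0 :> R.
  by rewrite sinN mulr_natl -[pi *+ 2]add0r sinD2pi sin0 oppr0.
have Wb' : W P (Q 1) 0 (- (2 * pi)).
  apply: (W_transport cP cQ PQ (sin0 R) s2 _ _ Wb) => t /Qub [h1 h2].
    by rewrite cos0 P0; lra.
  by rewrite c2 P1; lra.
have := W_uniq Wb' Wd; rewrite subr0 normrN gtr0_norm; have := @pi_gt0 R; lra.
Qed.

Lemma expR_quad (x : R) : 0 <= x -> x ^+ 2 / 4 <= expR x.
Proof.
move=> x0; have -> : x = x / 2 + x / 2 by lra.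
rewrite expRD; have := expR_ge1Dx (x / 2); nra.
Qed.

Definition c0 m : int := Num.floor (expR (m - 2) / (2 * pi)).

Lemma c0_itv m : [/\ (c0 m)%:~R * (2 * pi) <= expR (m - 2),
  expR (m - 2) < ((c0 m)%:~R + 1) * (2 * pi) & 0 <= (c0 m)%:~R :> R].
Proof.
have p0 := @pi_gt0 R; have x0 := expR_gt0 (m - 2).
have := real_floor_itv (num_real (expR (m - 2) / (2 * pi))); rewrite -/(c0 m) intrD => /andP[h1 h2].
split; [by rewrite -ler_pdivlMr //; lra|by rewrite -ltr_pdivrMr //; lra|].
by rewrite ler0z /c0 floor_ge0 divr_ge0 //; lra.
Qed.

(* Strips of height about exp(m - 2) keep a backward orbit at real parts just below [m]. *)
Lemma barrier_start m d : forall A, m0 + 20 <= m ->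
  (forall r, (0 < r)%N -> c0 m <= A r <= c0 m + 1) ->
  exists e, forall r, (r <= d)%N -> [/\ m - 4 <= re (F r e), re (F r e) <= m - 1 & instrip (A r) (F r e)].
Proof.
have p0 := @pi_gt0 R; have p4 := pi_lt4 R.
elim: d => [|d IH] A mm HA.
  exists ((m - 1) +i* ((A 0%N)%:~R * (2 * pi))) => r; rewrite leqn0 => /eqP ->.
  by rewrite /instrip /= subrr normr0; split; lra.
have [|e He] := IH (fun r => A r.+1) mm; first by move=> r _; exact: HA.
have [h1 h2 h3] := He 0%N (leq0n _); rewrite /= in h1 h2 h3.
have me : m0 <= re e by lra.
have fe := f_logb (A 0%N) me.
exists (logb a (A 0%N) e) => -[|r] rd; last by rewrite iterSr fe; exact: He.
change (F 0%N (logb a (A 0%N) e)) with (logb a (A 0%N) e).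
have /andP[k1 k2] := HA 1%N isT.
have k1' : (c0 m)%:~R * (2 * pi) <= (A 1%N)%:~R * (2 * pi) :> R.
  by rewrite ler_pM2r ?ler_int //; lra.
have k2' : (A 1%N)%:~R * (2 * pi) <= ((c0 m)%:~R + 1) * (2 * pi) :> R.
  by rewrite ler_pM2r -?(intrD _ _ 1) ?ler_int //; lra.
have [g1 g2 g3] := c0_itv m.
have := expR_quad (_ : 0 <= m - 2); rewrite /m0 in mm me *.
have n1 := normr_ge0 (re a); have n2 := normr_ge0 (im a).
move=> /(_ ltac:(lra)) q1.
have q2 : 25 * (m - 2) <= expR (m - 2).
  apply: le_trans q1; have : 118 <= m - 2 by lra.
  by move: (m - 2) => y hy; nra.
have e1 : expR (m - 4) * 3 <= expR (m - 2).
  have -> : m - 2 = (m - 4) + 2 by ring.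
  by rewrite [expR (m - 4 + 2)]expRD ler_pM2l ?expR_gt0 //; have := expR_ge1Dx (2 : R); lra.
have e2 : 2 * expR (m - 2) <= expR (m - 1).
  have -> : m - 1 = (m - 2) + 1 by ring.
  by rewrite [expR (m - 2 + 1)]expRD mulrC ler_pM2l ?expR_gt0 //; have := expR_ge1Dx (1 : R); lra.
move: h3; rewrite /instrip ltr_norml => h3.
have m1 := ler_norm (im a); have m2 := ler_norm (- im a); rewrite normrN in m2.
have m3 := ler_norm (re a); have m4 := ler_norm (- re a); rewrite normrN in m4.
split; last exact: logb_strip.
  apply: re_logb_ge => //; right; apply: le_trans (ler_norm _).
  rewrite mulrDl mul1r in g2; lra.
apply: re_logb_le => //; apply: le_trans e2.
rewrite mulrDl mul1r in k2'.
have : `|re e - re a| <= m - 1 + `|re a| by rewrite ler_norml; lra.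
have : `|im e - im a| <= expR (m - 2) + 16 + `|im a| by rewrite ler_norml; lra.
lra.
Qed.

(** The start point keeps real parts at least m - 4 and its tail loses 4 more, hence the level m - 8
    at which [C] has to avoid the itinerary. *)
Lemma barrier_data m A C : m0 + 20 <= m ->
  (forall r, (0 < r)%N -> c0 m <= A r <= c0 m + 1) -> cpath C ->
  (forall t, 0 <= t <= 1 -> ~ inJ (m - 8) A (C t)) ->
  exists T, [/\ cpath T, forall s t, 0 <= s <= 1 -> 0 <= t <= 1 -> T s <> C t,
    forall t, instrip (A 0%N) (T t), re (T 0) < m & forall t, 0 <= t <= 1 -> re (C t) < re (T 1)].
Proof.
move=> mm HA cC nJ.
have [d0 D0] := @eventually_avoids _ a (m - 8) A C ltac:(lra) cC nJ.
have [e He] := @barrier_start m d0.+1 A mm HA.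
have [b B] := path_ub cC.
have [|T [cT T0 T1 T2]] := @tail_exists _ a d0.+1 A e b.
  by move=> r rd; have [h1 h2 h3] := He r rd; split => //; lra.
exists T; split => //.
- move=> s t s01 t01 E; apply: (D0 d0.+1 t (leqnSn _) t01); rewrite -E => r rd.
  have [h1 _ h2] := T1 s r rd; split => //.
  by have [h3 _ _] := He r rd; lra.
- by move=> t; have [_ _] := T1 t 0%N (leq0n _); apply.
- by rewrite T0; have [_ h _] := He 0%N (leq0n _); move: h => /=; lra.
- by move=> t /B; have := T2 0%N (leq0n _) => /=; lra.
Qed.

(** The barrier begins left of [C], ends right of it and lies in strip k + 1, thus less than 3 pi
    above the centre of strip k. It passes above [C 0], and being disjoint from [C] it cannot pass
    below [C 1]. *)
Lemma barrier_above m A (k : int) C : m0 + 20 <= m ->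
  (forall r, (0 < r)%N -> c0 m <= A r <= c0 m + 1) -> A 0%N = k + 1 -> cpath C ->
  (forall t, 0 <= t <= 1 -> m <= re (C t)) -> instrip k (C 0) ->
  (forall t, 0 <= t <= 1 -> ~ inJ (m - 8) A (C t)) ->
  im (C 1) - k%:~R * (2 * pi) < 3 * pi.
Proof.
move=> mm HA A0 cC mC kC nJ; have p0 := @pi_gt0 R.
have [T [cT TC sT T0 T1]] := barrier_data mm HA cC nJ.
have i01 : 0 <= (0 : R) <= 1 by lra.
have i11 : 0 <= (1 : R) <= 1 by lra.
rewrite ltNge; apply/negP => h.
have W0 : W T (C 0) pi 0.
  apply: (W_strip_above (k := k + 1) (l := k)) => //.
  - by move=> t _; rewrite -A0.
  - by clear; lia.
  - by have := mC 0 i01; lra.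
  - exact: T1.
have W1 : W T (C 1) (- pi) 0.
  apply: W_below => //.
  - move=> t _; have := sT t; rewrite A0 /instrip intrD mulrDl mul1r ltr_norml; lra.
  - by have := mC 1 i11; lra.
  - exact: T1.
have W2 : W T (C 1) pi 0.
  apply: (W_transport cT cC TC (sinpi R) (sin0 R) _ _ W0) => t t01.
    by rewrite cospi; have := mC t t01; lra.
  by rewrite cos0; have := T1 t t01; lra.
have := W_uniq (W_rev W2) (W_rev W1); rewrite gtr0_norm; lra.
Qed.

Lemma barrier_below m A (k : int) C : m0 + 20 <= m ->
  (forall r, (0 < r)%N -> c0 m <= A r <= c0 m + 1) -> A 0%N = k - 1 -> cpath C ->
  (forall t, 0 <= t <= 1 -> m <= re (C t)) -> instrip k (C 0) ->
  (forall t, 0 <= t <= 1 -> ~ inJ (m - 8) A (C t)) ->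
  - (3 * pi) < im (C 1) - k%:~R * (2 * pi).
Proof.
move=> mm HA A0 cC mC kC nJ; have p0 := @pi_gt0 R.
have [T [cT TC sT T0 T1]] := barrier_data mm HA cC nJ.
have i01 : 0 <= (0 : R) <= 1 by lra.
have i11 : 0 <= (1 : R) <= 1 by lra.
rewrite ltNge; apply/negP => h.
have W0 : W T (C 0) (- pi) 0.
  apply: (W_strip_below (k := k - 1) (l := k)) => //.
  - by move=> t _; rewrite -A0.
  - by clear; lia.
  - by have := mC 0 i01; lra.
  - exact: T1.
have W1 : W T (C 1) pi 0.
  apply: W_above => //.
  - move=> t _; have := sT t; rewrite A0 /instrip intrB mulrBl mul1r ltr_norml; lra.
  - by have := mC 1 i11; lra.
  - exact: T1.
have sN : sin (- pi) = 0 :> R by rewrite sinN sinpi oppr0.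
have W2 : W T (C 1) (- pi) 0.
  apply: (W_transport cT cC TC sN (sin0 R) _ _ W0) => t t01.
    by rewrite cosN cospi; have := mC t t01; lra.
  by rewrite cos0; have := T1 t t01; lra.
have := W_uniq (W_rev W1) (W_rev W2); rewrite gtr0_norm; lra.
Qed.

End Unlinked.

(** * Uniform escape along arcs *)

Section OneSided.
Variables (R : realType) (a : R[i]).
Implicit Types (P Q T C : R -> R[i]) (q u v w z : R[i]) (e x s t m : R) (A B : nat -> int).
Local Notation f := (expmap a).
Local Notation F n := (iter n (expmap a)).
Local Notation m0 := (m0 a).
Local Notation inJ := (inJ a).
Local Notation far := (far a).

Lemma first_le (g : R -> R) (m s : R) : continuous g -> m < g 0 -> 0 <= s -> g s <= m ->
  exists s', [/\ 0 < s', s' <= s, g s' = m & forall r, 0 <= r <= s' -> m <= g r].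
Proof.
move=> cg g0 s0 gs.
pose E : set R := [set x | 0 <= x <= s /\ g x <= m].
have Es : E s by split => //; lra.
have lE : has_lbound E by exists 0 => x [] /andP[].
have iE : has_inf E by split; [exists s|].
set i := inf E.
have i0 : 0 <= i by apply: lb_le_inf; [exists s|move=> x [] /andP[]].
have is' : i <= s by apply: ge_inf.
have below r : 0 <= r < i -> m < g r.
  move=> /andP[r0 ri]; rewrite ltNge; apply/negP => gr.
  have : i <= r by apply: ge_inf => //; split => //; lra.
  lra.
have gi : g i <= m.
  rewrite leNgt; apply/negP => gm.
  have [||d d0 D] := @cts_pos R (fun x => g x - m) i.
  - by apply: cts_sub => //; exact: cts_cst.
  - lra.
  have [x [/andP[x0 xs] gx] xi] := inf_adherent d0 iE; rewrite -/i in xi.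
  have ix : i <= x by apply: ge_inf => //; split => //; lra.
  have := D x ltac:(by rewrite ltr_norml; lra); lra.
have ip : 0 < i by rewrite lt_neqAle i0 andbT; apply/eqP => E0; move: gi; rewrite -E0; lra.
have [c ci gc] := @ivt01 R g 0 i m i0 cg (or_intror (ltac:(lra) : g i <= m <= g 0)).
have ci' : c = i.
  apply/eqP; rewrite eq_le; apply/andP; split; first lra.
  by apply: ge_inf => //; split; [lra|rewrite gc].
rewrite ci' in gc; exists i; split => // r /andP[r0 ri].
by move: ri; rewrite le_eqVlt => /orP[/eqP ->|ri]; [rewrite gc|apply: ltW; apply: below; rewrite r0].
Qed.

Lemma instrip_close (k l : int) u v (c : R) : `|im u - k%:~R * (2 * pi)| <= c -> instrip l v ->
  `|l - k| <= 1 -> `|im u - im v| <= c + pi / 2 + 2 * pi.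
Proof.
have p0 := @pi_gt0 R; rewrite /instrip => h1 h2 h3.
have : `|(l - k)%:~R * (2 * pi)| <= 2 * pi :> R.
  rewrite normrM [X in _ * X]gtr0_norm; last lra.
  rewrite -[leRHS]mul1r ler_pM2r; last lra.
  by rewrite -intr_norm -[1]/(1%:~R) ler_int.
move: h1 h2; rewrite intrB mulrBl !ler_norml !ltr_norml; lra.
Qed.

Definition uniform_away P := forall e : R, 0 < e -> e <= 1 ->
  exists N, forall t, e <= t <= 1 -> far (m0 + 50) N (P t).

Lemma tail_strip P B : cpath P -> inJ (m0 + 80) B (P 1) -> uniform_away P ->
  forall e, 0 < e -> e <= 1 -> exists N, forall t r, e <= t <= 1 -> (N <= r)%N ->
    m0 + 50 <= re (F r (P t)) /\ instrip (B r) (F r (P t)).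
Proof.
move=> cP JB U e e0 e1; have [N HN] := U e e0 e1; exists N => t r t01 Nr.
split; first exact: HN.
have [s s01 ->] := seg_surj t01.
have := (JB r).2; rewrite -(seg1 P e 1).
apply: (@strip_path _ a _ (fun s => F r (seg P e 1 s)) 1 s) => //; last lra.
  by apply: cpath_F; exact: seg_cpath.
move=> s' s01'; have h := HN _ (seg_itv e1 s01') r.+1 (leqW Nr).
by apply: le_trans h; lra.
Qed.

(* Addresses in {c0, c0 + 1} differing infinitely often from both [A] and [B]. *)
Definition diagonal (k : int) A B m : nat -> int := fun r =>
  if r is 0%N then k else
  let D := if odd r then A else B in if D r == c0 m then c0 m + 1 else c0 m.

Lemma diagonal_itv k A B m r : (0 < r)%N -> c0 m <= diagonal k A B m r <= c0 m + 1.
Proof.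
case: r => // r _; rewrite /diagonal; case: ifP => _; last by rewrite lexx lerDl.
by rewrite lexx andbT lerDl.
Qed.

Lemma diagonal_neq k A B m r : (0 < r)%N -> diagonal k A B m r <> (if odd r then A else B) r.
Proof.
case: r => // r _; rewrite /diagonal; case: ifP => [/eqP -> E|/eqP n E].
  by have : (1 : int) = 0 by apply: (addrI (c0 m)); rewrite E addr0.
by apply: n.
Qed.

Section Adjacent.
Variables (Q : R -> R[i]) (A B : nat -> int).
Hypotheses (cQ : cpath Q) (JA : inJ (m0 + 80) A (Q 0)) (JB : inJ (m0 + 80) B (Q 1))
  (UQ : uniform_away Q).

(** Points with t > 0 end up in the strips of [B], which the diagonal avoids at positive even
    indices; the point t = 0 stays in those of [A], avoided at odd ones. *)
Lemma no_diagonal k n t : 0 <= t <= 1 ->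
  ~ inJ (m0 + 42) (diagonal k (fun r => A (n + r)%N) (fun r => B (n + r)%N) (m0 + 50)) (F n (Q t)).
Proof.
move=> t01; case: (ltrgtP 0 t) => [t0|t0|<-] H; [|lra|].
  have [N HN] := tail_strip cQ JB UQ t0 ltac:(lra).
  pose r := (N.+1).*2.
  have r0 : (0 < r)%N by rewrite double_gt0.
  have := @diagonal_neq k (fun r => A (n + r)%N) (fun r => B (n + r)%N) (m0 + 50) r r0.
  rewrite odd_double; apply; apply: (instrip_uniq (H r).2).
  rewrite -F_add addnC; apply: (HN t (r + n)%N _ _).2; first lra.
  by rewrite /r -addnn; clear; lia.
have := @diagonal_neq k (fun r => A (n + r)%N) (fun r => B (n + r)%N) (m0 + 50) 1 isT.
apply; apply: (instrip_uniq (H 1%N).2).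
by rewrite -F_add addnC; exact: (JA (1 + n)%N).2.
Qed.

Hypothesis AB : forall n, `|A n - B n| <= 1.

(** Up to time [n] the orbit shares the itinerary of [Q 0], and at time [n] it has sunk to the level
    of the barriers; 3 pi is the height that two neighbouring barriers leave. *)
Definition slow_point n s :=
  [/\ forall j, (j < n)%N -> instrip (A j) (F j (Q s)),
      forall j, (j <= n)%N -> m0 + 50 <= re (F j (Q s)),
      re (F n (Q s)) <= m0 + 50 &
      `|im (F n (Q s)) - (A n)%:~R * (2 * pi)| <= 3 * pi].

(* If slow points cluster at the end point, it is as slow as its strips permit, so that
   the rest of the path, which stays in adjacent strips, cannot be slower. *)
Lemma uniform_if_slow :
  (forall (eta : R) N, 0 < eta -> exists n s, [/\ (N <= n)%N, 0 <= s <= 1, s < eta & slow_point n s]) ->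
  forall t, 0 <= t <= 1 -> far (m0 + 50) 0 (Q t).
Proof.
move=> H t t01 j _; have p4 := pi_lt4 R; have p0 := @pi_gt0 R.
case: (ltrgtP 0 t) => [t0|t0|<-]; [|lra|]; last by have := (JA j).1; lra.
have [N HN] := tail_strip cQ JB UQ t0 ltac:(lra).
have [d d0 D] := (cts_ball _).1 (@cpath_re _ a j _ cQ) 0 1 ltr01.
have [n [s [Nn s01 sd [S1 S2 S3 S4]]]] := H d (maxn N j) d0.
move: Nn; rewrite geq_max => /andP[Nn jn].
have [|||h _] := @pullback _ a (seg Q t 1) (Q s) 0 n 1 (seg_cpath t 1 cQ) ltac:(lra) _ _ _ j jn 0 ltac:(lra).
(* The heights differ by at most 3 pi + pi / 2 + 2 pi, and the 24 in [pullback] is large enough for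
   this. *)
- move=> r r01; have tr := seg_itv (ltac:(lra) : t <= 1) r01.
  have [h1 h2] := HN _ n tr Nn; rewrite -/(seg Q t 1 r) in h1 h2; split; first lra.
  by have := instrip_close S4 h2 ltac:(by rewrite distrC); rewrite distrC; lra.
- by move=> i /andP[_ hi]; have := S2 i hi; lra.
- move=> i /andP[_ hi]; have := S1 i hi; rewrite /instrip => /ltW h1.
  have h2 : instrip (B i) (F i (seg Q t 1 1)) by rewrite seg1; exact: (JB i).2.
  by have := instrip_close h1 h2 ltac:(by rewrite distrC); rewrite distrC; lra.
move: h; rewrite seg0 => h.
have := D s ltac:(rewrite ltr_norml; lra); rewrite ltr_norml.
have := (JA j).1; lra.
Qed.

(* Otherwise barriers on both sides force an initial piece of the path to stay in the
   strips of the end point. *)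
Lemma uniform_if_not_slow (eta : R) N : 0 < eta ->
  (forall n s, (N <= n)%N -> 0 <= s <= 1 -> s < eta -> ~ slow_point n s) ->
  exists2 d, 0 < d & forall t, 0 <= t <= d -> far (m0 + 50) 0 (Q t).
Proof.
move=> eta0 H.
have [d1 d10 D1] : exists2 d, 0 < d & forall s j, (j <= N)%N -> 0 <= s < d -> m0 + 50 < re (F j (Q s)).
  elim: (N) => [|n [d d0 D]].
    have [||d d0 D] := @cts_pos R (fun s => re (F 0%N (Q s)) - (m0 + 50)) 0.
    - by apply: cts_sub; [exact: cpath_re|exact: cts_cst].
    - by have := (JA 0%N).1; lra.
    exists d => // s j; rewrite leqn0 => /eqP -> h.
    by have := D s ltac:(rewrite ltr_norml; lra); lra.
  have [||d' d0' D'] := @cts_pos R (fun s => re (F n.+1 (Q s)) - (m0 + 50)) 0.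
  - by apply: cts_sub; [exact: cpath_re|exact: cts_cst].
  - by have := (JA n.+1).1; lra.
  exists (Num.min d d'); first by rewrite lt_min d0.
  move=> s j jn; rewrite lt_min => /and3P[s0 sd sd'].
  move: jn; rewrite leq_eqVlt => /orP[/eqP ->|jn]; last by apply: D => //; rewrite s0.
  by have := D' s ltac:(rewrite ltr_norml; lra); lra.
pose d := Num.min (Num.min d1 eta / 2) 1.
have d0 : 0 < d by rewrite lt_min ltr01 andbT divr_gt0 // lt_min d10.
have [dd1 dde dd01] : [/\ d < d1, d < eta & d <= 1].
  have : d <= Num.min d1 eta / 2 by rewrite /d ge_min lexx.
  have : Num.min d1 eta <= d1 by rewrite ge_min lexx.
  have : Num.min d1 eta <= eta by rewrite ge_min lexx orbT.
  have : d <= 1 by rewrite /d ge_min lexx orbT.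
  by split; lra.
suff K n : forall s j, (j <= N + n)%N -> 0 <= s <= d -> m0 + 50 < re (F j (Q s)).
  by exists d => // t td j _; apply: ltW; apply: (K j) => //; exact: leq_addl.
elim: n => [|n IH] s j; first by rewrite addn0 => jN sd; apply: D1 => //; lra.
rewrite addnS leq_eqVlt => /orP[/eqP ->|]; last exact: IH.
set k := (N + n).+1 => sd; rewrite ltNge; apply/negP => hs.
have Jk := (JA k).1.
(* Take the first parameter that sinks to the barrier level at time [k]. The piece before it has the
   strips of [A] at earlier times and is confined by two barriers at time [k], so s' is a slow
   point. *)
have [||||s' [s0' ss' E Hs']] := @first_le (fun r => re (F k (Q r))) (m0 + 50) s => //; try lra.
  exact: cpath_re.
have s01' : 0 <= s' <= 1 by lra.
have sub r : 0 <= r <= 1 -> 0 <= 0 + r * (s' - 0) <= s' by move=> r01; nra.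
have far_j r j' : 0 <= r <= 1 -> (j' <= k)%N -> m0 + 50 <= re (F j' (seg Q 0 s' r)).
  move=> r01; rewrite leq_eqVlt => /orP[/eqP ->|jk]; first by apply: Hs'; exact: sub.
  by apply: ltW; apply: IH => //; have := sub r r01; lra.
have strip_j r j' : 0 <= r <= 1 -> (j' < k)%N -> instrip (A j') (F j' (seg Q 0 s' r)).
  move=> r01 jk; apply: (@strip_path _ a _ (fun r => F j' (seg Q 0 s' r)) 0 r) => //.
  - by apply: cpath_F; exact: seg_cpath.
  - by move=> r' r01'; have := @far_j r' j'.+1 r01' jk; rewrite /=; lra.
  - by rewrite lexx ler01.
  - by rewrite seg0; exact: (JA j').2.
have cC : cpath (fun r => F k (seg Q 0 s' r)) by apply: cpath_F; exact: seg_cpath.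
have nd l r : 0 <= r <= 1 -> ~ inJ (m0 + 50 - 8)
    (diagonal l (fun r => A (k + r)%N) (fun r => B (k + r)%N) (m0 + 50)) (F k (seg Q 0 s' r)).
  move=> r01; have -> : m0 + 50 - 8 = m0 + 42 by ring.
  by apply: no_diagonal; have := sub r r01; lra.
have i0 : instrip (A k) (F k (seg Q 0 s' 0)) by rewrite seg0; exact: (JA k).2.
have farC r : 0 <= r <= 1 -> m0 + 50 <= re (F k (seg Q 0 s' r)) by move=> r01; exact: far_j.
have mm : m0 + 20 <= m0 + 50 by lra.
have up := barrier_above mm (fun r => @diagonal_itv _ _ _ _ r) erefl cC farC i0 (nd _).
have lo := barrier_below mm (fun r => @diagonal_itv _ _ _ _ r) erefl cC farC i0 (nd _).
apply: (H k s') => //; first by rewrite /k -addnS leq_addr.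
  lra.
split.
- by move=> j' jk; rewrite -(seg1 Q 0 s'); apply: strip_j => //; rewrite ler01 lexx.
- by move=> j' jk; rewrite -(seg1 Q 0 s'); apply: far_j => //; rewrite ler01 lexx.
- by rewrite E.
- by rewrite seg1 in up lo; rewrite ler_norml; lra.
Qed.

Lemma uniform_adjacent : exists N, forall t, 0 <= t <= 1 -> far (m0 + 50) N (Q t).
Proof.
have [H|] := pselect (forall (eta : R) N, 0 < eta -> exists n s,
    [/\ (N <= n)%N, 0 <= s <= 1, s < eta & slow_point n s]).
  by exists 0%N; exact: uniform_if_slow.
move=> /existsNP [eta /existsNP [N /not_implyP [eta0 nH]]].
have [|d d0 D] := @uniform_if_not_slow eta N eta0.
  by move=> n s Nn s01 se sl; apply: nH; exists n, s.
have [N' HN'] := UQ (ltac:(rewrite lt_min d0 ltr01 //) : 0 < Num.min d 1) (ltac:(rewrite ge_min lexx orbT //) : Num.min d 1 <= 1).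
exists N' => t t01; case: (lerP t (Num.min d 1)) => h.
  apply: far_le (leq0n N') _; apply: D; move: h; rewrite le_min; lra.
by apply: HN'; lra.
Qed.

End Adjacent.

End OneSided.

(** * Comparing the itineraries of the two ends *)

Section UniformEscape.
Variables (R : realType) (a : R[i]).
Implicit Types (P Q T C : R -> R[i]) (q u v w z : R[i]) (d e x s t m : R) (A B : nat -> int).
Local Notation f := (expmap a).
Local Notation F n := (iter n (expmap a)).
Local Notation m0 := (m0 a).
Local Notation inJ := (inJ a).
Local Notation far := (far a).
Local Notation uniform_away := (uniform_away a).

Definition lift (k : int) z : R[i] := re z +i* (im z + k%:~R * (2 * pi)).

Lemma f_lift k z : f (lift k z) = f z.
Proof. by apply: Cext; rewrite ?re_f ?im_f /= ?cosDint ?sinDint. Qed.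

Lemma F_lift k r z : F r.+1 (lift k z) = F r.+1 z.
Proof. by rewrite !iterSr f_lift. Qed.

Lemma instrip_lift k l z : instrip l z -> instrip (l + k) (lift k z).
Proof. by rewrite /instrip /= intrD mulrDl; congr (`|_| < _); ring. Qed.

Lemma lift_cpath k P : cpath P -> cpath (fun t => lift k (P t)).
Proof. by move=> [cx cy]; split => //=; apply: cts_add => //; exact: cts_cst. Qed.

(** Itinerary of [lift k (F n z)]: by periodicity of [f] only the first entry sees the
    translation. *)
Definition shift_adr (n : nat) (k : int) A : nat -> int :=
  fun r => if r is r'.+1 then A (n + r'.+1)%N else A n + k.

Lemma inJ_lift m A n k z : (forall r, m <= re (F (r + n) z) /\ instrip (A (r + n)%N) (F (r + n) z)) ->
  inJ m (shift_adr n k A) (lift k (F n z)).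
Proof.
move=> H [|r].
  by have [h1 h2] := H 0%N; split => //; exact: instrip_lift.
by rewrite F_lift -F_add /shift_adr [(n + _)%N]addnC; exact: H.
Qed.

Lemma inJ_shift m n A z : inJ m A z -> forall r, m <= re (F (r + n) z) /\ instrip (A (r + n)%N) (F (r + n) z).
Proof. by move=> H r; exact: H. Qed.

Lemma inJ_far m A z : inJ m A z -> far m 0 z.
Proof. by move=> H j _; exact: (H j).1. Qed.

Lemma inJ_lev m m' A z : m' <= m -> inJ m A z -> inJ m' A z.
Proof. by move=> mm H r; have [h1 h2] := H r; split => //; exact: le_trans mm h1. Qed.

Lemma shift_adr_lt n k l A B : A n + k < B n + l -> lexlt (shift_adr n k A) (shift_adr n l B).
Proof. by move=> h; exists 0%N. Qed.

Lemma linj_prev P : linj P -> linj (prev P).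
Proof.
move=> lP; have h : (1 : R) != 0 by rewrite oner_neq0.
have -> : prev P = seg P 1 0.
  by apply: funext => t; rewrite /prev /seg sub0r mulrN1.
by apply: linj_seg => //; lra.
Qed.

(* Disjointness of [C] from its translate forbids the ends of [C] to be two or more strips apart. *)
Lemma translate_unlinked m C n A B : m0 <= m -> cpath C ->
  (forall r, m + 4 <= re (F r (C 0)) /\ instrip (A (n + r)%N) (F r (C 0))) ->
  (forall r, m + 4 <= re (F r (C 1)) /\ instrip (B (n + r)%N) (F r (C 1))) ->
  (forall s t, 0 <= s <= 1 -> 0 <= t <= 1 -> C s <> lift 1 (C t)) ->
  (forall t, 0 <= t <= 1 -> ~ inJ m (shift_adr n 0 A) (lift 1 (C t))) ->
  (forall t, 0 <= t <= 1 -> ~ inJ m (shift_adr n 0 B) (lift 1 (C t))) ->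
  (forall t, 0 <= t <= 1 -> ~ inJ m (shift_adr n 1 A) (C t)) ->
  (forall t, 0 <= t <= 1 -> ~ inJ m (shift_adr n 1 B) (C t)) ->
  A n + 1 < B n -> False.
Proof.
move=> mm cC JA JB dis x1 x2 x3 x4 AB.
have J0 (D : nat -> int) z : (forall r, m + 4 <= re (F r z) /\ instrip (D (n + r)%N) (F r z)) ->
    inJ (m + 4) (shift_adr n 0 D) z.
  by move=> H [|r]; [have := H 0%N; rewrite /= addn0 addr0|exact: H].
have J1 (D : nat -> int) z : (forall r, m + 4 <= re (F r z) /\ instrip (D (n + r)%N) (F r z)) ->
    inJ (m + 4) (shift_adr n 1 D) (lift 1 z).
  move=> H [|r]; last by rewrite F_lift; exact: H.
  have [h1 h2] := H 0%N; rewrite addn0 in h2; split => //; exact: instrip_lift.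
apply: (@unlinked _ a m C (fun t => lift 1 (C t)) (shift_adr n 0 A) (shift_adr n 1 A)
  (shift_adr n 0 B) (shift_adr n 1 B)) => //.
- exact: lift_cpath.
- exact: J0.
- exact: J1.
- exact: J0.
- exact: J1.
- by apply: shift_adr_lt; rewrite addr0 ltrDl.
- by apply: shift_adr_lt; rewrite addr0.
- by apply: shift_adr_lt; rewrite addr0 ltrDl.
- by apply: shift_adr_lt; move: AB; clear; move: (A n) (B n) => x y; lia.
Qed.

Section AdjacentStrips.
Variables (Q : R -> R[i]) (A B : nat -> int).
Hypotheses (cQ : cpath Q) (lQ : forall e, 0 < e < 1 -> linj (seg Q e 1)) (JA : inJ (m0 + 80) A (Q 0)) (JB : inJ (m0 + 80) B (Q 1))
  (UQ : uniform_away Q).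

Lemma away_inj n s t : 0 < s <= 1 -> 0 < t <= 1 -> F n (Q s) = F n (Q t) -> s = t.
Proof.
move=> s01 t01 E.
pose e := Num.min s t.
have e0 : 0 < e by rewrite lt_min; lra.
have [es et] : e <= s /\ e <= t by rewrite /e !ge_min !lexx orbT.
have e1 : e <= 1 by lra.
have [N HN] := UQ e0 e1.
case: (ltrgtP e 1) => [e1'|e1'|E1]; [|lra|lra].
have cS := seg_cpath e 1 cQ.
have lS : linj (seg Q e 1) by apply: lQ; lra.
pose k := maxn n N.
have HS r : 0 <= r <= 1 -> far m0 k (seg Q e 1 r).
  move=> r01; apply: far_le (leq_maxr n N) _.
  by apply: far_lev (HN _ (seg_itv e1 r01)); lra.
have [D HD] := path_trk cS HS.
have [s' s01' Es] := seg_surj (ltac:(lra) : e <= s <= 1).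
have [t' t01' Et] := seg_surj (ltac:(lra) : e <= t <= 1).
suff : s' = t' by move=> E'; rewrite Es Et E'.
apply: (@tracked_inj _ a D (fun r => F k (seg Q e 1 r)) (linj_F a k cS lS) (cpath_F a k cS) HD) => //.
have kk : k = (k - n + n)%N by rewrite subnK // leq_maxl.
by rewrite /seg -Es -Et kk !F_add E.
Qed.

(** Between [t] and 1 escape is uniform from some late time on. Both ends being far from time n + 1
    on, [uniform_from_ends] lowers that time to n + 1, so the piece lies in one strip at time
    [n]. *)
Lemma away_strip n t : 0 < t <= 1 -> far (m0 + 70) n.+1 (Q t) -> instrip (B n) (F n (Q t)).
Proof.
move=> t01 ft.
have [N HN] := UQ (ltac:(lra) : 0 < t) ltac:(lra).
case: (ltrgtP t 1) => [t1|t1|E1]; [|lra|by rewrite E1; exact: (JB n).2].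
have cS := seg_cpath t 1 cQ.
have lS : linj (seg Q t 1) by apply: lQ; lra.
have H : forall r, 0 <= r <= 1 -> far (m0 + 66) n.+1 (seg Q t 1 r).
  have -> : m0 + 66 = m0 + 70 - 4 by ring.
  apply: (@uniform_from_ends _ a (seg Q t 1) N) => //; first lra.
  - by move=> r r01; apply: far_lev (HN _ (seg_itv (ltW t1) r01)); lra.
  - by rewrite seg0.
  - rewrite seg1; apply: far_le (leq0n _) _.
    by apply: far_lev (inJ_far JB); lra.
rewrite -(seg0 Q t 1).
apply: (@strip_path _ a _ (fun r => F n (seg Q t 1 r)) 1 0); try lra.
- exact: cpath_F.
- by move=> r r01; have := H r r01 n.+1 (leqnn _); rewrite /=; lra.
- by rewrite seg1; exact: (JB n).2.
Qed.

Hypothesis freq : forall N, exists2 n, (N <= n)%N & A n <> B n.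

Lemma not_tail_A n t : 0 < t <= 1 -> (forall r, instrip (A (n + r.+1)%N) (F (n + r.+1) (Q t))) -> False.
Proof.
move=> t01 H; have [N HN] := tail_strip cQ JB UQ (ltac:(lra) : 0 < t) ltac:(lra).
have [k kN ne] := freq (maxn N n.+1); apply: ne.
move: kN; rewrite geq_max => /andP[Nk nk].
have := H (k - n.+1)%N; rewrite addnS -addSn subnKC // => h.
by apply: instrip_uniq h _; apply: (HN t k _ Nk).2; lra.
Qed.

Lemma not_tail_B n : (forall r, instrip (B (n + r.+1)%N) (F (n + r.+1) (Q 0))) -> False.
Proof.
move=> H; have [k nk ne] := freq n.+1; apply: ne.
have := H (k - n.+1)%N; rewrite addnS -addSn subnKC // => h.
exact: instrip_uniq (JA k).2 h.
Qed.

Lemma Q_disjoint n s t : 0 <= s <= 1 -> 0 <= t <= 1 -> F n (Q s) <> lift 1 (F n (Q t)).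
Proof.
move=> s01 t01 E.
have E1 : F n.+1 (Q s) = F n.+1 (Q t) by rewrite /= E f_lift.
have nE r : F r.+1 (F n (Q s)) = F r.+1 (F n (Q t)).
  by rewrite -!F_add addSnnS !F_add E1.
have p0 := @pi_gt0 R.
have self x : F n (Q x) = lift 1 (F n (Q x)) -> False.
  by move=> /(congr1 (@complex.Im R)) /=; rewrite mul1r; lra.
case: (ltrgtP 0 s) => [s0|s0|Es]; [|lra|].
  case: (ltrgtP 0 t) => [t0|t0|Et]; [|lra|].
    have st : s = t by apply: (@away_inj n.+1) => //; lra.
    by apply: (self t); rewrite -{1}st.
  apply: (@not_tail_A n s); first lra.
  move=> r; rewrite addnC F_add nE -Et -F_add.
  exact: (JA (r.+1 + n)%N).2.
case: (ltrgtP 0 t) => [t0|t0|Et]; [|lra|by apply: (self s); rewrite {1}E -Et -Es].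
apply: (@not_tail_A n t); first lra.
move=> r; rewrite addnC F_add -nE -Es -F_add.
exact: (JA (r.+1 + n)%N).2.
Qed.

Lemma exclA k n t : k != 0 -> 0 <= t <= 1 ->
  ~ inJ (m0 + 70) (shift_adr n 0 A) (lift k (F n (Q t))) /\
  ~ inJ (m0 + 70) (shift_adr n k A) (F n (Q t)).
Proof.
move=> k0 t01; case: (ltrgtP 0 t) => [t0|t0|<-]; [|lra|]; split => H.
- apply: (@not_tail_A n t); first lra.
  by move=> r; have := (H r.+1).2; rewrite F_lift -F_add /= addnC.
- apply: (@not_tail_A n t); first lra.
  by move=> r; have := (H r.+1).2; rewrite -F_add /= addnC.
- have := instrip_lift k (JA n).2 => h.
  have := instrip_uniq (H 0%N).2 h; rewrite /= addr0 => /eqP.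
  by rewrite -subr_eq0 opprD addrA subrr add0r oppr_eq0 (negbTE k0).
- have := instrip_uniq (H 0%N).2 (JA n).2 => /= /eqP.
  by rewrite addrC -subr_eq0 addrK (negbTE k0).
Qed.

(** Unlike in [exclA], a point with t > 0 does have the tail of [B], so only the first entry can
    give the contradiction, through [away_strip]. *)
Lemma exclB k n t : k != 0 -> 0 <= t <= 1 ->
  ~ inJ (m0 + 70) (shift_adr n 0 B) (lift k (F n (Q t))) /\
  ~ inJ (m0 + 70) (shift_adr n k B) (F n (Q t)).
Proof.
move=> k0 t01; case: (ltrgtP 0 t) => [t0|t0|<-]; [|lra|]; split => H.
- have ft : far (m0 + 70) n.+1 (Q t).
    move=> j nj; have := (H (j - n)%N).1.
    by rewrite -(subnSK nj) F_lift -F_add addSnnS addnC subnKC.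
  have := instrip_lift k (away_strip (ltac:(lra) : 0 < t <= 1) ft) => h.
  have := instrip_uniq (H 0%N).2 h; rewrite /= addr0 => /eqP.
  by rewrite -subr_eq0 opprD addrA subrr add0r oppr_eq0 (negbTE k0).
- have ft : far (m0 + 70) n.+1 (Q t).
    move=> j nj; have := (H (j - n)%N).1.
    by rewrite -F_add subnK // ltnW.
  have := instrip_uniq (H 0%N).2 (away_strip (ltac:(lra) : 0 < t <= 1) ft) => /= /eqP.
  by rewrite addrC -subr_eq0 addrK (negbTE k0).
- apply: (@not_tail_B n) => r; have := (H r.+1).2.
  by rewrite F_lift -F_add /= addnC.
- apply: (@not_tail_B n) => r; have := (H r.+1).2.
  by rewrite -F_add /= addnC.
Qed.

Lemma adjacent_strips n : `|A n - B n| <= 1.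
Proof.
have mm : m0 <= m0 + 70 by lra.
have L D z : inJ (m0 + 80) D z -> forall r, m0 + 70 + 4 <= re (F r (F n z)) /\ instrip (D (n + r)%N) (F r (F n z)).
  by move=> H r; rewrite -F_add addnC; have [h1 h2] := H (n + r)%N; split => //; lra.
have cC := cpath_F a n cQ.
have n1 : (1 : int) != 0 by [].
have h1 : ~ (A n + 1 < B n).
  apply: (@translate_unlinked (m0 + 70) (fun t => F n (Q t)) n A B) => //.
  - exact: L.
  - exact: L.
  - by move=> s t; exact: Q_disjoint.
  - by move=> t t01; have [] := exclA n n1 t01.
  - by move=> t t01; have [] := exclB n n1 t01.
  - by move=> t t01; have [] := exclA n n1 t01.
  - by move=> t t01; have [] := exclB n n1 t01.
have R01 t : 0 <= t <= 1 -> 0 <= 1 - t <= 1 by lra.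
have h2 : ~ (B n + 1 < A n).
  apply: (@translate_unlinked (m0 + 70) (prev (fun t => F n (Q t))) n B A) => //.
  - exact: prev_cpath.
  - by rewrite /prev subr0; exact: L.
  - by rewrite /prev subrr; exact: L.
  - by move=> s t s01 t01; apply: Q_disjoint; exact: R01.
  - by move=> t t01; have [] := exclB n n1 (R01 _ t01).
  - by move=> t t01; have [] := exclA n n1 (R01 _ t01).
  - by move=> t t01; have [] := exclB n n1 (R01 _ t01).
  - by move=> t t01; have [] := exclA n n1 (R01 _ t01).
by move: h1 h2; clear; move: (A n) (B n) => x y; lia.
Qed.

End AdjacentStrips.

Definition escapes z := forall b, exists N, far b N z.

Lemma far_inJ m z : m0 <= m -> far m 0 z -> exists A, inJ m A z.
Proof.
move=> mm fz; have [A HA] := far_trk (far_lev mm fz).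
by exists A => r; split; [exact: fz|exact: (HA r).2].
Qed.

Lemma uniform_away_F n Q : uniform_away Q -> uniform_away (fun t => F n (Q t)).
Proof.
move=> U e e0 e1; have [N HN] := U e e0 e1; exists N => t t01.
by apply: far_shift; apply: far_le (leq_addr _ _) _; exact: HN.
Qed.

(** Late itineraries of the ends differ by at most 1 at each time: either they eventually agree, or
    they differ infinitely often and [adjacent_strips] applies. *)
Lemma uniform_one_sided P : cpath P -> linj P -> escapes (P 0) -> escapes (P 1) ->
  uniform_away P -> exists N, forall t, 0 <= t <= 1 -> far (m0 + 50) N (P t).
Proof.
move=> cP lP e0 e1 U.
have m80 : m0 <= m0 + 80 by lra.
have [N0 H0] := e0 (m0 + 80); have [N1 H1] := e1 (m0 + 80).
pose n := maxn N0 N1.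
have f0 : far (m0 + 80) 0 (F n (P 0)).
  by apply: far_shift; rewrite add0n; apply: far_le (leq_maxl _ _) H0.
have f1 : far (m0 + 80) 0 (F n (P 1)).
  by apply: far_shift; rewrite add0n; apply: far_le (leq_maxr _ _) H1.
have [A JA] := far_inJ m80 f0; have [B JB] := far_inJ m80 f1.
have cQ := cpath_F a n cP; have lQ := linj_F a n cP lP; have UQ := uniform_away_F n U.
suff [k K] : exists k, forall r, (k <= r)%N -> `|A r - B r| <= 1.
  have sh D z : inJ (m0 + 80) D z -> inJ (m0 + 80) (fun r => D (r + k)%N) (F k z).
    by move=> J r; rewrite -F_add; exact: J.
  have [|N HN] := @uniform_adjacent _ a (fun t => F k (F n (P t))) (fun r => A (r + k)%N)
      (fun r => B (r + k)%N) (cpath_F a k cQ) (sh _ _ JA) (sh _ _ JB) (uniform_away_F k UQ).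
    by move=> r; apply: K; exact: leq_addl.
  exists (N + (k + n))%N => t t01 j Nj.
  have knj : (k + n <= j)%N by apply: leq_trans Nj; exact: leq_addl.
  have := HN t t01 (j - (k + n))%N; rewrite -!F_add -addnA subnK //; apply.
  by rewrite leq_subRL // addnC.
have [fr|] := pselect (forall N, exists2 r, (N <= r)%N & A r <> B r).
  have lS e : 0 < e < 1 -> linj (seg (fun t => F n (P t)) e 1).
    by move=> e01; apply: linj_seg => //; [rewrite lt_eqF|lra|lra]; lra.
  by exists 0%N => r _; exact: (adjacent_strips cQ lS JA JB UQ fr).
move=> /existsNP [N nN]; exists N => r Nr.
suff -> : A r = B r by rewrite subrr normr0.
by apply: contrapT => ne; apply: nN; exists r.
Qed.

End UniformEscape.

(** * Baire category and uniform escape on whole arcs *)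

Section Baire.
Variables (R : realType) (a : R[i]).
Implicit Types (P Q T C : R -> R[i]) (q u v w z : R[i]) (d e x s t m p : R) (A B : nat -> int).
Local Notation f := (expmap a).
Local Notation F n := (iter n (expmap a)).
Local Notation m0 := (m0 a).
Local Notation far := (far a).
Local Notation escapes := (escapes a).

Lemma last_bad (G : R -> Prop) p t : (forall x, G x -> exists2 d, 0 < d & forall s, `|s - x| < d -> G s) ->
  p <= t -> ~ G p -> exists al, [/\ p <= al <= t, ~ G al & forall x, al < x <= t -> G x].
Proof.
move=> oG pt nGp.
pose E : set R := [set x | p <= x <= t /\ ~ G x].
have Ep : E p by split => //; rewrite lexx.
have uE : has_ubound E by exists t => x [] /andP[].
have sE : has_sup E by split; [exists p|].
have pa : p <= sup E by apply: ub_le_sup.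
have at' : sup E <= t by apply: ge_sup; [exists p|move=> x [] /andP[]].
exists (sup E); split; first by rewrite pa at'.
  move=> /oG [d d0 D].
  have [x [xpt nGx] hx] := sup_adherent d0 sE.
  have xs : x <= sup E by apply: ub_le_sup => //; split.
  apply: nGx; by apply: D; rewrite ltr_norml; lra.
move=> x /andP[ax xt]; apply: contrapT => nGx.
have : x <= sup E by apply: ub_le_sup => //; split => //; lra.
lra.
Qed.

Lemma first_bad (G : R -> Prop) p t : (forall x, G x -> exists2 d, 0 < d & forall s, `|s - x| < d -> G s) ->
  t <= p -> ~ G p -> exists be, [/\ t <= be <= p, ~ G be & forall x, t <= x < be -> G x].
Proof.
move=> oG tp nGp.
have [||| al [al1 al2 al3]] := @last_bad (fun x => G (- x)) (- p) (- t).
- move=> x /oG [d d0 D]; exists d => // s hs; apply: D.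
  by rewrite -opprD normrN; move: hs; congr (`|_| < _); ring.
- lra.
- by rewrite opprK.
exists (- al); split => //; first lra.
by move=> x hx; rewrite -[x]opprK; apply: al3; lra.
Qed.

Definition good P t := exists d N, 0 < d /\
  forall s, 0 <= s <= 1 -> `|s - t| < d -> far (m0 + 50) N (P s).

Lemma good_open P t : good P t -> exists2 d, 0 < d & forall s, `|s - t| < d -> good P s.
Proof.
move=> [d [N [d0 D]]]; exists (d / 2); first lra.
move=> s hs; exists (d / 2), N; split; first lra.
by move=> r r01 hr; apply: D => //; move: hs hr; rewrite !ltr_norml; lra.
Qed.

Lemma compact_far P : (forall t, 0 <= t <= 1 -> good P t) ->
  exists N, forall t, 0 <= t <= 1 -> far (m0 + 50) N (P t).
Proof.
move=> H; pose S x := exists N, forall s, 0 <= s <= x -> far (m0 + 50) N (P s).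
suff [N HN] : S 1 by exists N.
apply: (@real_induction R S _ 0 1); try lra; last first.
  have [d [N [d0 D]]] := H 0 ltac:(lra).
  by exists N => s s0; apply: D; [lra|rewrite ltr_norml; lra].
move=> t t01; have [d [N [d0 D]]] := H t t01.
exists d => // r s r01 s01 hr hs [M HM]; exists (maxn M N) => x hx.
case: (lerP x r) => xr; first by apply: far_le (leq_maxl _ _) _; apply: HM; lra.
apply: far_le (leq_maxr _ _) _; apply: D; first lra.
by move: hr hs; rewrite !ltr_norml; lra.
Qed.

Lemma good_seg P p r : 0 <= p <= 1 -> 0 <= r <= 1 ->
  (forall t, 0 <= t <= 1 -> good P (p + t * (r - p))) ->
  exists N, forall t, 0 <= t <= 1 -> far (m0 + 50) N (seg P p r t).
Proof.
move=> p01 r01 H; apply: compact_far => t t01.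
have [d [N [d0 D]]] := H t t01.
exists d, N; split => // s s01 hs; apply: D; first nra.
have -> : p + s * (r - p) - (p + t * (r - p)) = (s - t) * (r - p) by ring.
rewrite normrM; apply: le_lt_trans hs; rewrite -[leRHS]mulr1.
by apply: ler_wpM2l; rewrite ?normr_ge0 // ler_norml; lra.
Qed.

Section Path.
Variable P : R -> R[i].
Hypotheses (cP : cpath P) (lP : linj P) (eP : forall t, 0 <= t <= 1 -> escapes (P t)).

Lemma one_sided_seg p r : p != r -> 0 <= p <= 1 -> 0 <= r <= 1 ->
  (forall t, 0 < t <= 1 -> good P (p + t * (r - p))) ->
  exists N, forall t, 0 <= t <= 1 -> far (m0 + 50) N (seg P p r t).
Proof.
move=> pr p01 r01 H; apply: uniform_one_sided.
- exact: seg_cpath.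
- exact: linj_seg.
- by rewrite seg0; exact: eP.
- by rewrite seg1; exact: eP.
move=> e e0 e1; pose p' := p + e * (r - p).
have [||t t01|N HN] := @good_seg P p' r; rewrite /p'; [nra|lra| |].
  have -> : p + e * (r - p) + t * (r - (p + e * (r - p))) = p + (e + t * (1 - e)) * (r - p) by ring.
  by apply: H; nra.
exists N => t te.
have [s s01 ->] := seg_surj te; have := HN s s01; rewrite /seg /p'.
by congr (far _ _ (P _)); ring.
Qed.

(** If all points just right of [t0] are good, this is the one-sided case. Otherwise fix a bad point
    [b] to the right. A good point in between lies in a gap with bad ends, which are far from time
    [N] on. Escape on the gap is uniform by the one-sided case at both ends, and [uniform_from_ends]
    makes the time [N], whatever the gap. *)
Lemma right_side t0 N d0 : 0 <= t0 <= 1 -> 0 < d0 ->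
  (forall t, 0 <= t <= 1 -> `|t - t0| < d0 -> ~ good P t -> far (m0 + 70) N (P t)) -> ~ good P t0 ->
  exists d M, 0 < d /\ forall t, 0 <= t <= 1 -> t0 <= t < t0 + d -> far (m0 + 50) M (P t).
Proof.
move=> t01 d00 H nG.
have F0 : far (m0 + 70) N (P t0) by apply: H; rewrite ?subrr ?normr0.
have [t1|t1] := leP 1 t0.
  exists 1, N; split => // t t01' ht; have -> : t = t0 by lra.
  by apply: far_lev F0; lra.
have [[e e0 E]|nE] := pselect (exists2 e, 0 < e & forall x, 0 <= x <= 1 -> t0 < x < t0 + e -> good P x).
  pose r := t0 + Num.min (e / 2) (1 - t0).
  have r0 : t0 < r by rewrite ltrDl lt_min; lra.
  have r1 : r <= 1 by rewrite -lerBrDl ge_min lexx orbT.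
  have r2 : r - t0 <= e / 2 by rewrite /r addrAC subrr add0r ge_min lexx.
  have [||||M HM] := @one_sided_seg t0 r; [by rewrite lt_eqF|lra|lra| |].
    by move=> t ht; apply: E; nra.
  exists (r - t0), M; split; first lra.
  move=> t t01' ht; have [s s01 ->] := seg_surj (ltac:(lra) : t0 <= t <= r).
  exact: HM.
have [b [b01 tb nb]] : exists b, [/\ 0 <= b <= 1, t0 < b < t0 + d0 & ~ good P b].
  apply: contrapT => nb; apply: nE; exists d0 => // x x01 hx.
  by apply: contrapT => ng; apply: nb; exists x.
exists (b - t0), N; split; first lra.
move=> t t01' ht.
have Hb x : 0 <= x <= 1 -> t0 <= x <= b -> ~ good P x -> far (m0 + 70) N (P x).
  by move=> x01 hx; apply: H => //; rewrite ltr_norml; lra.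
have [gt|ng] := pselect (good P t); last first.
  by apply: far_lev (Hb t t01' _ ng); lra.
have [||al [al1 al2 al3]] := @last_bad (good P) t0 t (@good_open P) => //; first lra.
have [||be [be1 be2 be3]] := @first_bad (good P) b t (@good_open P) => //; first lra.
have alt : al < t.
  by rewrite lt_neqAle; apply/andP; split; [apply/eqP => E; apply: al2; rewrite E|lra].
have bet : t < be.
  by rewrite lt_neqAle; apply/andP; split; [apply/eqP => E; apply: be2; rewrite -E|lra].
have al01 : 0 <= al <= 1 by lra.
have be01 : 0 <= be <= 1 by lra.
have [||||M1 HM1] := @one_sided_seg al t => //; [by rewrite lt_eqF| |].
  by move=> s hs; apply: al3; nra.
have [||||M2 HM2] := @one_sided_seg be t => //; [by rewrite gt_eqF| |].
  move=> s hs; case: (ltrgtP s 1) => [s1|s1|->]; [|by move: hs; rewrite leNgt s1 andbF|by rewrite mul1r addrC subrK].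
  by apply: be3; nra.
have HM x : al <= x <= be -> far m0 (maxn M1 M2) (P x).
  move=> hx; case: (lerP x t) => xt.
    have [s s01 ->] := seg_surj (ltac:(lra) : al <= x <= t).
    by apply: far_le (leq_maxl _ _) _; apply: far_lev (HM1 s s01); lra.
  have [s s01 ->] := seg_surj (ltac:(lra) : t <= x <= be).
  apply: far_le (leq_maxr _ _) _.
  have := HM2 (1 - s) ltac:(lra); rewrite /seg => h; apply: far_lev (_ : m0 <= m0 + 50) _; first lra.
  by move: h; congr (far _ _ (P _)); ring.
have [s s01 ->] := seg_surj (ltac:(lra) : al <= t <= be).
apply: far_lev (_ : m0 + 50 <= m0 + 70 - 4) _; first lra.
apply: (@uniform_from_ends _ a (seg P al be) (maxn M1 M2) N) => //.
- lra.
- exact: seg_cpath.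
- by apply: linj_seg => //; rewrite lt_eqF //; lra.
- by move=> r r01; apply: HM; apply: seg_itv => //; lra.
- by rewrite seg0; apply: Hb => //; lra.
- by rewrite seg1; apply: Hb => //; lra.
Qed.

End Path.

Lemma good_prev P t : good (prev P) (1 - t) -> good P t.
Proof.
move=> [d [N [d0 D]]]; exists d, N; split => // s s01 hs.
have := D (1 - s) ltac:(lra); rewrite /prev subKr; apply.
by rewrite -normrN; move: hs; congr (`|_| < _); ring.
Qed.

(* Baire category in the closed set of bad points. *)
Lemma baire_point P : cpath P -> (forall t, 0 <= t <= 1 -> escapes (P t)) ->
  (exists2 t, 0 <= t <= 1 & ~ good P t) ->
  exists t N d, [/\ 0 <= t <= 1, ~ good P t, 0 < d &
    forall s, 0 <= s <= 1 -> `|s - t| < d -> ~ good P s -> far (m0 + 70) N (P s)].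
Proof.
move=> cP eP [t0 t01 nG0]; apply: contrapT => nB.
pose ok (y : R * R) := [/\ 0 <= y.1 <= 1, ~ good P y.1 & 0 < y.2].
have step (k : nat) (y : R * R) : exists y' : R * R, ok y ->
    [/\ ok y', (forall s, `|s - y'.1| <= y'.2 -> `|s - y.1| <= y.2) &
        exists2 j, (k <= j)%N & forall s, `|s - y'.1| <= y'.2 -> re (F j (P s)) < m0 + 70].
  have [[y1 y2 y3]|no] := pselect (ok y); last by exists y.
  have [[s [s01 hs nGs nf]]|nS] := pselect (exists s, [/\ 0 <= s <= 1, `|s - y.1| < y.2 / 2, ~ good P s & ~ far (m0 + 70) k (P s)]); last first.
    exfalso; apply: nB; exists y.1, k, (y.2 / 2); split => //; first lra.
    by move=> s s01 hs nGs; apply: contrapT => nf; apply: nS; exists s.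
  have [j kj hj] : exists2 j, (k <= j)%N & re (F j (P s)) < m0 + 70.
    apply: contrapT => nj; apply: nf => j kj; rewrite leNgt; apply/negP => h.
    by apply: nj; exists j.
  have [||d d0 D] := @cts_pos R (fun x => m0 + 70 - re (F j (P x))) s.
  - by apply: cts_sub; [exact: cts_cst|exact: cpath_re].
  - lra.
  exists (s, Num.min (d / 2) (y.2 / 2)) => _; split => /=.
  - by split => //=; rewrite lt_min; lra.
  - move=> x; rewrite le_min => /andP[_ hx].
    by move: hs hx; rewrite ltr_norml !ler_norml; lra.
  - exists j => // x; rewrite le_min => /andP[hx _].
    by have := D x ltac:(lra); lra.
have [st Hst] : exists st : nat -> R * R -> R * R, forall k y, ok y ->
    [/\ ok (st k y), (forall s, `|s - (st k y).1| <= (st k y).2 -> `|s - y.1| <= y.2) &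
        exists2 j, (k <= j)%N & forall s, `|s - (st k y).1| <= (st k y).2 -> re (F j (P s)) < m0 + 70].
  have /choice [g Hg] : forall ky : nat * (R * R), exists y', ok ky.2 ->
    [/\ ok y', (forall s, `|s - y'.1| <= y'.2 -> `|s - ky.2.1| <= ky.2.2) &
        exists2 j, (ky.1 <= j)%N & forall s, `|s - y'.1| <= y'.2 -> re (F j (P s)) < m0 + 70].
    by move=> [k y]; exact: step.
  by exists (fun k y => g (k, y)) => k y; exact: (Hg (k, y)).
(* Nested intervals around bad points: on the interval of [X n.+1] some iterate of order at least n
   stays left of [m0 + 70], so a common point cannot escape. *)
pose X := fix X n := if n is n'.+1 then st n' (X n') else (t0, 1 : R).
have okX n : ok (X n).
  by elim: n => [|n IH]; [split => //=|have [] := Hst n _ IH].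
have nest n k : forall s, `|s - (X (k + n)%N).1| <= (X (k + n)%N).2 -> `|s - (X n).1| <= (X n).2.
  elim: k => [|k IH] s; first by rewrite add0n.
  rewrite addSn => hs; apply: IH.
  by have [_ + _] := Hst (k + n)%N _ (okX (k + n)%N); apply.
have X01 n : 0 <= (X n).1 <= 1 by have [] := okX n.
have [t t01' T] := cluster01 X01.
have tin n : `|t - (X n).1| <= (X n).2.
  rewrite leNgt; apply/negP => h.
  have [k nk hk] := T (`|t - (X n).1| - (X n).2) n ltac:(lra).
  have : `|(X k).1 - (X n).1| <= (X n).2.
    have := nest n (k - n)%N (X k).1; rewrite subnK //; apply.
    by rewrite subrr normr0; apply: ltW; have [] := okX k.
  have := ler_distD (X k).1 t (X n).1; rewrite [`|t - (X k).1|]distrC; lra.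
have [N HN] := eP t t01' (m0 + 70).
have [_ _ [j Nj hj]] := Hst N _ (okX N).
have := HN j Nj; have := hj t (tin N.+1); lra.
Qed.

(** Near the bad point of [baire_point] the bad points escape uniformly; [right_side], for the path
    and for its reversal, then shows that this point is good. *)
Lemma uniform_escape P : cpath P -> linj P -> (forall t, 0 <= t <= 1 -> escapes (P t)) ->
  exists N, forall t, 0 <= t <= 1 -> far (m0 + 50) N (P t).
Proof.
move=> cP lP eP.
have [H|] := pselect (forall t, 0 <= t <= 1 -> good P t); first exact: compact_far.
move=> /existsNP [t1 /not_implyP [t1h nG1]]; exfalso.
have [|t [N [d [t01 nG d0 D]]]] := @baire_point P cP eP; first by exists t1.
apply: (nG).
have [e1 [M1 [e10 H1]]] := right_side cP lP eP t01 d0 D nG.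
have eP' s : 0 <= s <= 1 -> escapes (prev P s) by move=> s01; apply: eP; lra.
have nG' : ~ good (prev P) (1 - t) by move=> /good_prev.
have D' s : 0 <= s <= 1 -> `|s - (1 - t)| < d -> ~ good (prev P) s -> far (m0 + 70) N (prev P s).
  move=> s01 hs ns; apply: D; [lra| |].
    by rewrite -normrN; move: hs; congr (`|_| < _); ring.
  move=> [d' [N' [d0' K]]]; apply: ns; exists d', N'; split => // r r01 hr.
  apply: K; first lra.
  by rewrite -normrN; move: hr; congr (`|_| < _); ring.
have [e2 [M2 [e20 H2]]] := right_side (prev_cpath cP) (linj_prev lP) eP' (ltac:(lra) : 0 <= 1 - t <= 1) d0 D' nG'.
exists (Num.min e1 e2), (maxn M1 M2); split; first by rewrite lt_min e10.
move=> s s01; rewrite lt_min !ltr_norml => hs.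
case: (lerP t s) => st.
  by apply: far_le (leq_maxl _ _) _; apply: H1 => //; lra.
apply: far_le (leq_maxr _ _) _; have := H2 (1 - s) ltac:(lra) ltac:(lra).
by rewrite /prev subKr.
Qed.

End Baire.

(** * Hairs with a common itinerary *)

Section Hairs.
Variables (R : realType) (a : R[i]).
Implicit Types (P Q T C u v : R -> R[i]) (q w x y z : R[i]) (d e s t m p : R) (A B : nat -> int).
Local Notation f := (expmap a).
Local Notation F n := (iter n (expmap a)).
Local Notation m0 := (m0 a).
Local Notation far := (far a).
Local Notation trk := (trk a).
Local Notation faster := (faster a).
Local Notation escapes := (escapes a).
Local Notation uniform_away := (uniform_away a).

Definition linj_at P t := exists2 d, 0 < d & forall s s', 0 <= s <= 1 -> 0 <= s' <= 1 ->
  `|s - t| < d -> `|s' - t| < d -> P s = P s' -> s = s'.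

(** Injectivity is only local and only away from the landing point [u 0], so that images of hairs
    under [f] are hairs again. *)
Definition hair u := [/\ cpath u, (forall t, 0 < t <= 1 -> linj_at u t), ~ escapes (u 0) &
  forall t, 0 < t <= 1 -> escapes (u t)].

Lemma escapes_f z : escapes (f z) <-> escapes z.
Proof.
split=> H b; have [N HN] := H b.
  by exists N.+1 => -[//|j] Nj; rewrite iterSr; exact: HN.
by exists N => j Nj; rewrite -iterSr; apply: HN; exact: leqW.
Qed.

Lemma hair_f u : hair u -> hair (fun t => f (u t)).
Proof.
move=> [cu lu n0 eu]; split.
- exact: cpath_f.
- move=> t t01; have [d d0 D] := lu t t01.
  have [_ /cts_ball cy] := cu.
  have [e e0 E] := cy t pi (pi_gt0 R).
  exists (Num.min d e); first by rewrite lt_min d0 e0.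
  move=> s s' s01 s01'; rewrite !lt_min => /andP[s1 /E s2] /andP[s1' /E s2'] Ef.
  apply: D => //; apply: (f_inj_near _ Ef); move: s2 s2'; rewrite !ltr_norml; lra.
- by rewrite escapes_f.
- by move=> t t01; rewrite escapes_f; exact: eu.
Qed.

Lemma hair_F n u : hair u -> hair (fun t => F n (u t)).
Proof. by move=> hu; elim: n => [|n IH] //; exact: hair_f IH. Qed.

Lemma hair_linj u e : hair u -> 0 < e < 1 -> linj (seg u e 1).
Proof.
move=> [_ lu _ _] e01 t t01; have [|d d0 D] := lu (e + t * (1 - e)); first nra.
exists d => // s s' s01 s01' hs hs' E.
have K r : 0 <= r <= 1 -> `|r - t| < d -> `|e + r * (1 - e) - (e + t * (1 - e))| < d.
  move=> r01 hr; have -> : e + r * (1 - e) - (e + t * (1 - e)) = (r - t) * (1 - e) by ring.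
  rewrite normrM [X in _ * X]ger0_norm; last lra.
  by apply: le_lt_trans hr; rewrite -[leRHS]mulr1; apply: ler_wpM2l; rewrite ?normr_ge0 //; lra.
have : e + s * (1 - e) = e + s' * (1 - e) by apply: D; [nra|nra|exact: K|exact: K|].
by move/addrI/mulIf; apply; rewrite subr_eq0 gt_eqF //; lra.
Qed.

Lemma hair_away u : hair u -> uniform_away u.
Proof.
move=> hu e e0 e1; have [cu _ _ eu] := hu.
case: (ltrgtP e 1) => [e1'|e1'|E]; [|lra|]; last first.
  have [N HN] := eu 1 ltac:(lra) (m0 + 50).
  by exists N => t ht; have -> : t = 1 by lra.
have [||N HN] := @uniform_escape _ a (seg u e 1) (seg_cpath e 1 cu); first by apply: hair_linj => //; rewrite e0.
  by move=> t t01; apply: eu; nra.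
by exists N => t ht; have [s s01 ->] := seg_surj ht; exact: HN.
Qed.

Lemma linj_seg_hair u p r : hair u -> 0 < p -> p < r -> r <= 1 -> linj (seg u p r).
Proof.
move=> hu p0 pr r1; have lS := hair_linj hu (ltac:(lra) : 0 < p < 1).
have [s s01 E] := seg_surj (ltac:(lra) : p <= r <= 1).
have s0 : 0 < s by rewrite ltNge; apply/negP => hs; nra.
have -> : seg u p r = seg (seg u p 1) 0 s.
  by apply: funext => t; rewrite /seg {1}E; congr u; ring.
by apply: linj_seg => //; [rewrite lt_eqF|lra].
Qed.

Section Tail.
Variable A : nat -> int.

Definition tracked N x := forall r, (N <= r)%N -> m0 + 50 <= re (F r x) /\ instrip (A r) (F r x).
Definition ev_tracked x := exists N, tracked N x.

Definition slower x y := exists N, faster (F N y) (F N x).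
Definition merge x y := exists N, F N x = F N y.

Lemma tracked_le N M x : (N <= M)%N -> tracked N x -> tracked M x.
Proof. by move=> NM H r Mr; apply: H; exact: leq_trans NM Mr. Qed.

Lemma tracked_trk N x : tracked N x -> trk (fun r => A (r + N)%N) (F N x).
Proof.
move=> H r; rewrite -F_add; have [h1 h2] := H (r + N)%N (leq_addl _ _).
by split => //; lra.
Qed.

Lemma faster_F N M x y : (N <= M)%N -> faster (F N y) (F N x) -> faster (F M y) (F M x).
Proof.
move=> NM H n; have := H (n + (M - N))%N; rewrite -!F_add.
by rewrite -addnA subnK.
Qed.

Lemma merge_F N M x y : (N <= M)%N -> F N x = F N y -> F M x = F M y.
Proof. by move=> NM E; rewrite -(subnK NM) !F_add E. Qed.

(** Distinct orbits in common strips move apart, so they can only meet if they coincide from the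
    start. *)
Lemma merge_at N x y : tracked N x -> tracked N y -> merge x y -> F N x = F N y.
Proof.
move=> hx hy [M E]; apply: dist2_eq0.
have E' : F (M + N) x = F (M + N) y by apply: merge_F E; exact: leq_addr.
have := grow M (tracked_trk hx) (tracked_trk hy); rewrite -!F_add E'.
by rewrite {2}/dist2 !subrr expr0n /= addr0 pmulr_rle0.
Qed.

Lemma slower_total x y : ev_tracked x -> ev_tracked y -> slower x y \/ slower y x.
Proof.
move=> [N hN] [M hM]; pose K := maxn N M.
have hx := tracked_trk (tracked_le (leq_maxl N M) hN).
have hy := tracked_trk (tracked_le (leq_maxr N M) hM).
by have [h|h] := faster_total hx hy; [right|left]; exists (maxn N M).
Qed.

Lemma slower_anti x y : ev_tracked x -> ev_tracked y -> slower x y -> slower y x -> merge x y.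
Proof.
move=> [N1 h1] [N2 h2] [N3 h3] [N4 h4]; pose K := (N1 + N2 + N3 + N4)%N; exists K.
have [k1 k2 k3 k4] : [/\ (N1 <= K)%N, (N2 <= K)%N, (N3 <= K)%N & (N4 <= K)%N].
  by rewrite /K; clear; split; lia.
exact: (faster_anti (tracked_trk (tracked_le k1 h1)) (tracked_trk (tracked_le k2 h2))
  (faster_F k4 h4) (faster_F k3 h3)).
Qed.

Lemma slower_trans x y z : ev_tracked x -> ev_tracked y -> ev_tracked z ->
  slower x y -> slower y z -> slower x z.
Proof.
move=> [N1 h1] [N2 h2] [N5 h5] [N3 h3] [N4 h4]; pose K := (N1 + N2 + N3 + N4 + N5)%N; exists K.
have [k1 k2 k3 [k4 k5]] : [/\ (N1 <= K)%N, (N2 <= K)%N, (N3 <= K)%N & (N4 <= K)%N /\ (N5 <= K)%N].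
  by rewrite /K; clear; split; lia.
exact: (faster_trans (tracked_trk (tracked_le k5 h5)) (tracked_trk (tracked_le k2 h2))
  (tracked_trk (tracked_le k1 h1)) (faster_F k4 h4) (faster_F k3 h3)).
Qed.

Lemma merge_slower x y : merge x y -> slower x y.
Proof. by move=> [N E]; exists N; rewrite E; exact: faster_refl. Qed.

Lemma merge_sym x y : merge x y -> merge y x.
Proof. by move=> [N E]; exists N. Qed.

Lemma merge_trans x y z : merge x y -> merge y z -> merge x z.
Proof.
move=> [N E] [M E']; exists (maxn N M).
by rewrite (merge_F (leq_maxl N M) E) (merge_F (leq_maxr N M) E').
Qed.

Lemma tracked_escapes_between x y : escapes y -> (exists N, forall j, (N <= j)%N -> re (F j y) - 5 <= re (F j x)) ->
  escapes x.
Proof.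
move=> ey [N HN] b; have [M HM] := ey (b + 5); exists (maxn N M) => j.
rewrite geq_max => /andP[Nj Mj]; have := HN j Nj; have := HM j Mj; lra.
Qed.

Section OneHair.
Variable u : R -> R[i].
Hypotheses (hu : hair u) (uA : exists N, forall n, (N <= n)%N -> instrip (A n) (F n (u 1))).

Lemma hair_tracked e : 0 < e <= 1 -> exists N, forall t, e <= t <= 1 -> tracked N (u t).
Proof.
move=> e01; have [N HN] := hair_away hu (ltac:(lra) : 0 < e) ltac:(lra); have [M HM] := uA.
have [cu _ _ _] := hu.
exists (maxn N M) => t ht r; rewrite geq_max => /andP[Nr Mr]; split; first exact: HN.
have [s s01 ->] := seg_surj ht; have := HM r Mr; rewrite -(seg1 u e 1).
apply: (@strip_path _ a _ (fun s => F r (seg u e 1 s)) 1 s) => //; try lra.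
  by apply: cpath_F; exact: seg_cpath.
move=> s' s01'; have h := HN _ (seg_itv (ltac:(lra) : e <= 1) s01') r.+1 (leqW Nr).
by apply: le_trans h; lra.
Qed.

Lemma hair_ev_tracked t : 0 < t <= 1 -> ev_tracked (u t).
Proof. by move=> t01; have [N HN] := hair_tracked t01; exists N; apply: HN; lra. Qed.

Lemma hair_seg_trk p r N : 0 < p -> p <= r -> r <= 1 -> (forall t, p <= t <= 1 -> tracked N (u t)) ->
  forall t, 0 <= t <= 1 -> trk (fun r => A (r + N)%N) (F N (seg u p r t)).
Proof.
move=> p0 pr r1 H t t01; apply: tracked_trk; apply: H.
by have := seg_itv pr t01; lra.
Qed.

(* If the hair were uniformly faster than an escaping orbit, its landing point would escape. *)
Lemma hair_slow y e : ev_tracked y -> escapes y -> 0 < e <= 1 ->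
  exists2 t, 0 < t <= e & slower (u t) y.
Proof.
move=> [Ny hy] ey e01; apply: contrapT => nS.
have [cu lu n0 eu] := hu.
have [Ne he] := hair_tracked e01.
pose N1 := maxn Ny Ne.
have hy1 := tracked_le (leq_maxl Ny Ne) hy; rewrite -/N1 in hy1.
have he1 t : e <= t <= 1 -> tracked N1 (u t) by move=> ht; apply: tracked_le (leq_maxr _ _) (he t ht).
have gap t : 0 < t <= e -> forall N, tracked N (u t) -> (N1 <= N)%N ->
    exists2 n, (N <= n)%N & forall k, (n <= k)%N -> re (F k y) + 4 <= re (F k (u t)).
  move=> ht N hN N1N.
  have ns : ~ slower (u t) y by move=> h; apply: nS; exists t.
  have /not_faster [n hn] : ~ faster (F N y) (F N (u t)) by move=> h; apply: ns; exists N.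
  exists (n + N)%N; first exact: leq_addl.
  move=> k nk.
  have := @gap_fwd _ a (fun r => A (r + N)%N) (F N (u t)) (F N y) n (k - (n + N)) (tracked_trk hN)
    (tracked_trk (tracked_le N1N hy1)) (ltW hn).
  by rewrite -!F_add -addnA subnK.
have claim t j : 0 < t < e -> (N1 <= j)%N -> re (F j y) - 4 <= re (F j (u t)).
  move=> ht N1j.
  have [Nt hNt] := hair_tracked (ltac:(lra) : 0 < t <= 1).
  pose N2 := maxn N1 Nt.
  have h2 s : t <= s <= 1 -> tracked N2 (u s).
    by move=> hs; apply: tracked_le (leq_maxr _ _) (hNt s hs).
  have N12 : (N1 <= N2)%N by exact: leq_maxl.
  have [nt Nnt gt] := gap t ltac:(lra) N2 (h2 t ltac:(lra)) N12.
  have [ne Nne ge'] := gap e ltac:(lra) N2 (h2 e ltac:(lra)) N12.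
  pose n := (maxn j (maxn nt ne)).
  have [jn [ntn nen]] : (j <= n)%N /\ (nt <= n)%N /\ (ne <= n)%N.
    by rewrite /n !leq_max !leqnn !orbT.
  have N2n : (N2 <= n)%N by apply: leq_trans Nnt ntn.
  have cS := seg_cpath t e cu.
  have tS := hair_seg_trk (ltac:(lra) : 0 < t) (ltac:(lra) : t <= e) (ltac:(lra) : e <= 1) h2.
  have lS : linj (fun s => F N2 (seg u t e s)).
    by apply: linj_F => //; apply: linj_seg_hair => //; lra.
  have lo s : 0 <= s <= 1 -> re (F n y) <= re (F n (seg u t e s)).
    move=> s01.
    have [S|S] := slow_end lS (cpath_F a N2 cS) tS; have := S s s01 (n - N2)%N;
      rewrite ?seg0 ?seg1 -!F_add subnK //.
      by have := gt n ntn; lra.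
    by have := ge' n nen; lra.
  have [|||h _] := @pullback _ a (seg u t e) y N1 n 1 cS ltac:(lra) _ _ _ j ltac:(by rewrite N1j jn) 0 ltac:(lra).
  - move=> s s01; have := lo s s01 => h; split; first lra.
    have hs := (h2 _ (_ : t <= t + s * (e - t) <= 1) n N2n).2.
    have hyn := (hy1 n (leq_trans N12 N2n)).2.
    have := instrip_diff (hs _) hyn; have := pi_lt4 R => hp.
    by move=> /(_ ltac:(by have := seg_itv (ltac:(lra) : t <= e) s01; lra)); rewrite /seg; lra.
  - by move=> i /andP[Ni _]; have := (hy1 i Ni).1; lra.
  - move=> i /andP[Ni _]; rewrite seg1.
    have := instrip_diff (he1 e ltac:(lra) i Ni).2 (hy1 i Ni).2; have := pi_lt4 R; lra.
  by move: h; rewrite seg0.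
apply: n0; apply: (tracked_escapes_between ey); exists N1 => j N1j.
have [d d0 D] := (cts_ball _).1 (@cpath_re _ a j _ cu) 0 1 ltr01.
pose t := Num.min (d / 2) (e / 2).
have t0 : 0 < t by rewrite lt_min; lra.
have td : t <= d / 2 by rewrite /t ge_min lexx.
have te : t <= e / 2 by rewrite /t ge_min lexx orbT.
have := claim t j ltac:(lra) N1j.
have := D t ltac:(rewrite ltr_norml; lra); rewrite ltr_norml; lra.
Qed.

Lemma hair_inj s t : 0 < s <= 1 -> 0 < t <= 1 -> merge (u s) (u t) -> s = t.
Proof.
wlog st : s t / s <= t.
  move=> W hs ht M; case: (lerP s t) => [|/ltW] h; first exact: W.
  by apply: esym; apply: W => //; exact: merge_sym.
move=> hs ht M; apply: contrapT => /eqP ne.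
have {ne}{}st : s < t by rewrite lt_neqAle ne.
have [cu _ _ _] := hu.
have [N HN] := hair_tracked hs.
have E := merge_at (HN s ltac:(lra)) (HN t ltac:(lra)) M.
have tS := hair_seg_trk (ltac:(lra) : 0 < s) (ltW st) (ltac:(lra) : t <= 1) HN.
have lS : linj (fun r => F N (seg u s t r)).
  by apply: linj_F; [exact: seg_cpath|apply: linj_seg_hair => //; lra].
have := @tracked_inj _ a _ _ lS (cpath_F a N (seg_cpath s t cu)) tS 0 1 ltac:(lra) ltac:(lra).
by rewrite seg0 seg1 => /(_ E) /eqP; rewrite eq_sym oner_eq0.
Qed.

(** By [hair_slow] some [u r] with r < s is slower than [u t]. If [u s] were strictly faster than
    [u t], the fastest point between [r] and [t] would be interior. *)
Lemma hair_mono s t : 0 < s -> s < t -> t <= 1 -> slower (u s) (u t).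
Proof.
move=> s0 st t1; have [cu _ _ eu] := hu.
have [] := slower_total (hair_ev_tracked (ltac:(lra) : 0 < s <= 1)) (hair_ev_tracked (ltac:(lra) : 0 < t <= 1)) => // ts.
have [r r01 rt] := hair_slow (hair_ev_tracked (ltac:(lra) : 0 < t <= 1)) (eu t ltac:(lra)) (ltac:(lra) : 0 < s / 2 <= 1).
have [N HN] := hair_tracked (ltac:(lra) : 0 < r <= 1).
have ge_at (x y : R) : r <= x <= 1 -> r <= y <= 1 -> slower (u x) (u y) -> faster (F N (u y)) (F N (u x)).
  move=> hx hy sl.
  have [//|h] := faster_total (tracked_trk (HN y hy)) (tracked_trk (HN x hx)).
  have M : merge (u x) (u y).
    apply: slower_anti => //; [by exists N; exact: HN|by exists N; exact: HN|by exists N].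
  by rewrite (merge_at (HN x hx) (HN y hy) M); exact: faster_refl.
have tS := hair_seg_trk (ltac:(lra) : 0 < r) (ltac:(lra) : r <= t) t1 HN.
have cS := cpath_F a N (seg_cpath r t cu).
have lS : linj (fun x : R => F N (seg u r t x)).
  by apply: linj_F; [exact: seg_cpath|apply: linj_seg_hair => //; lra].
have [x x01 X] := fastest cS tS.
have [s' s01' Es] := seg_surj (ltac:(lra) : r <= s <= t).
exfalso.
have eqT (y : R) : r <= y <= t -> faster (F N (u y)) (F N (u s)) -> slower (u y) (u t) -> False.
  move=> hy h1 h2.
  have st' : slower (u s) (u t).
    apply: (@slower_trans _ (u y)) => //; try (exists N; apply: HN; lra).
    by exists N.
  have : s = t by apply: hair_inj; [lra|lra|apply: slower_anti => //; exists N; apply: HN; lra].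
  lra.
have Xs : faster (F N (seg u r t x)) (F N (u s)) by rewrite Es; exact: X.
case: (ltrgtP 0 x) => [x0|x0|E]; [|lra|].
  case: (ltrgtP x 1) => [x1|x1|E]; [|lra|].
    by apply: (@no_interior_fastest _ a _ _ x 0 1 lS cS tS) => //; lra.
  apply: (@eqT t); [lra| |by exists N; exact: faster_refl].
  by rewrite E seg1 in Xs.
apply: (@eqT r); [lra| |by []].
by rewrite -E seg0 in Xs.
Qed.

Lemma hair_meet y p r : ev_tracked y -> 0 < p -> p <= r -> r <= 1 ->
  slower (u p) y -> slower y (u r) -> exists2 s, p <= s <= r & merge y (u s).
Proof.
move=> [Ny hy] p0 pr r1 [N1 h1] [N2 h2].
have [N3 h3] := hair_tracked (ltac:(lra) : 0 < p <= 1).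
pose N := (Ny + N1 + N2 + N3)%N.
have [k1 k2 k3 k4] : [/\ (Ny <= N)%N, (N1 <= N)%N, (N2 <= N)%N & (N3 <= N)%N].
  by rewrite /N; clear; split; lia.
have [cu _ _ _] := hu.
have HN t : p <= t <= 1 -> tracked N (u t) by move=> ht; exact: tracked_le k4 (h3 t ht).
have tS := hair_seg_trk p0 pr r1 HN.
have [||s s01 E] := @order_ivt01 _ a _ _ (F N y) (cpath_F a N (seg_cpath p r cu)) tS.
- exact: tracked_trk (tracked_le k1 hy).
- by left; rewrite seg0 seg1; split; [exact: faster_F k2 h1|exact: faster_F k3 h2].
exists (p + s * (r - p)); first exact: seg_itv.
by exists N; rewrite -E.
Qed.

End OneHair.
End Tail.
End Hairs.

Lemma within_ball (R : realType) (K : numFieldType) (V : pseudoMetricNormedZmodType K)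
    (g : R -> V) (p q : R) : {within `[p, q], continuous g} ->
  forall x, p <= x <= q -> forall e : K, 0 < e -> exists2 d : R, 0 < d &
    forall y, p <= y <= q -> `|y - x| < d -> `|g x - g y| < e.
Proof.
move=> /subspace_continuousP H x xpq e e0.
have {}H := H x; have /H {}H : `[p, q]%classic x by rewrite /= in_itv.
have /cvgrPdist_lt /(_ e e0) := H.
move=> /nbhs_ballP [d /= d0 D]; exists d => // y ypq yx.
by apply: (D y) => /=; [rewrite /ball /= distrC|rewrite in_itv].
Qed.

(** * Reparametrising one hair by another *)

Section Merging.
Variables (R : realType) (a : R[i]).
Implicit Types (P Q T C : R -> R[i]) (q w x y z : R[i]) (d e s t m p : R).
Local Notation f := (expmap a).
Local Notation F n := (iter n (expmap a)).
Local Notation m0 := (m0 a).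
Local Notation far := (far a).
Local Notation trk := (trk a).
Local Notation faster := (faster a).
Local Notation escapes := (escapes a).

Variables (A : nat -> int) (u v : R -> R[i]).
Hypotheses (hu : hair a u) (hv : hair a v)
  (uA : exists N, forall n, (N <= n)%N -> instrip (A n) (F n (u 1)))
  (vA : exists N, forall n, (N <= n)%N -> instrip (A n) (F n (v 1))).
Local Notation slower := (slower a).
Local Notation merge := (merge a).

Let tu t : 0 < t <= 1 -> ev_tracked a A (u t). Proof. exact: hair_ev_tracked. Qed.
Let tv t : 0 < t <= 1 -> ev_tracked a A (v t). Proof. exact: hair_ev_tracked. Qed.

Section Reparametrisation.
Variables (t1 : R) (ph : R -> R).
Hypotheses (t1h : 0 < t1 <= 1)
  (phP : forall t, 0 < t <= t1 -> 0 < ph t <= 1 /\ merge (u t) (v (ph t))).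

Lemma ph_lt s t : 0 < s -> s < t -> t <= t1 -> ph s < ph t.
Proof.
move=> s0 st tt; have t1b := t1h; have [ps ms] := phP (ltac:(lra) : 0 < s <= t1).
have [pt mt] := phP (ltac:(lra) : 0 < t <= t1).
rewrite ltNge; apply/negP => h.
have st' : slower (u s) (u t) by apply: (hair_mono hu uA) => //; lra.
have ts : slower (u t) (u s).
  apply: (slower_trans (tu _) (tv pt) (tu _)); [lra|lra|exact: merge_slower|].
  apply: (slower_trans (tv pt) (tv ps) (tu _)); [lra| |by apply: merge_slower; exact: merge_sym].
  move: h; rewrite le_eqVlt => /orP[/eqP ->|h]; last by apply: (hair_mono hv vA) => //; lra.
  by apply: merge_slower; exists 0%N.
have : s = t by apply: (hair_inj hu uA); [lra|lra|apply: (slower_anti (tu _) (tu _)) => //; lra].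
lra.
Qed.

Lemma ph_surj t0 s : 0 < t0 -> t0 < t1 -> ph t0 <= s <= ph t1 -> exists2 t, t0 <= t <= t1 & ph t = s.
Proof.
move=> t00 t01 hs; have t1b := t1h.
have [p0 mm0] := phP (ltac:(lra) : 0 < t0 <= t1).
have [p1 m1] := phP (ltac:(lra) : 0 < t1 <= t1).
have vmono (x y : R) : 0 < x -> x <= y -> y <= 1 -> slower (v x) (v y).
  move=> x0; rewrite le_eqVlt => /orP[/eqP -> _|xy y1]; last exact: (hair_mono hv vA).
  by apply: merge_slower; exists 0%N.
have [||t ht mt] := hair_meet hu uA (tv (ltac:(lra) : 0 < s <= 1)) t00 (ltW t01) (ltac:(lra)).
- apply: (slower_trans (tu _) (tv p0) (tv _)); [lra|lra|exact: merge_slower|].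
  by apply: vmono; lra.
- apply: (slower_trans (tv _) (tv p1) (tu _)); [lra|lra| |by apply: merge_slower; exact: merge_sym].
  by apply: vmono; lra.
exists t => //.
have [pt mpt] := phP (ltac:(lra) : 0 < t <= t1).
by apply: (hair_inj hv vA) => //; [lra|exact: merge_trans (merge_sym mpt) (merge_sym mt)].
Qed.

Lemma ph_cts t0 : 0 < t0 -> t0 < t1 -> continuous (fun s => ph (t0 + clamp s * (t1 - t0))).
Proof.
move=> t00 t01; have t1b := t1h.
have H : {within `[t0, t1], continuous ph}.
  apply: segment_inc_surj_continuous.
    move=> x y; rewrite !in_itv /= => hx hy; case: (ltrgtP x y) => [xy|xy|->].
    - by rewrite ltW // ph_lt //; lra.
    - by apply/negbTE; rewrite -ltNge ph_lt //; lra.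
    - by rewrite lexx.
  move=> s; rewrite /= in_itv /= => hs; have [t ht E] := ph_surj t00 t01 hs.
  by exists t => //=; rewrite in_itv.
have itv s : t0 <= t0 + clamp s * (t1 - t0) <= t1.
  by apply: seg_itv; [lra|exact: clamp01].
apply/cts_ball => s e e0.
have [d d0 D] := within_ball H (itv s) e0.
have [d' d0' D'] := (cts_ball _).1 (@clamp_cts R) s d d0.
exists d' => // r hr; rewrite distrC; apply: D => //.
have -> : t0 + clamp r * (t1 - t0) - (t0 + clamp s * (t1 - t0)) = (clamp r - clamp s) * (t1 - t0) by ring.
rewrite normrM; apply: le_lt_trans (D' _ hr); rewrite -[leRHS]mulr1.
by apply: ler_wpM2l; rewrite ?normr_ge0 // ger0_norm; lra.
Qed.

(* Going back in time, the two hairs differ by a multiple of 2 pi i that varies continuously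
   and vanishes at the outer end. *)
Lemma ph_merge N t0 : F N (u t1) = F N (v (ph t1)) -> 0 < t0 <= t1 -> F N (u t0) = F N (v (ph t0)).
Proof.
move=> E1 t0h; have t1b := t1h.
case: (ltrgtP t0 t1) => [t01|t01|->]; [|by move: t0h; rewrite leNgt t01 andbF|by []].
have [p0 mm0] := phP t0h; have [p1 m1] := phP (ltac:(lra) : 0 < t1 <= t1).
have [Nu HNu] := hair_tracked hu uA (ltac:(lra) : 0 < t0 <= 1).
have [Nv HNv] := hair_tracked hv vA p0.
pose M := (N + Nu + Nv)%N.
have [k1 k2 k3] : [/\ (N <= M)%N, (Nu <= M)%N & (Nv <= M)%N] by rewrite /M; clear; split; lia.
have phi t : t0 <= t <= t1 -> ph t0 <= ph t.
  by move=> /andP[]; rewrite le_eqVlt => /orP[/eqP -> //|h1 h2]; apply: ltW; apply: ph_lt; lra.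
have EM t : t0 <= t <= t1 -> F M (u t) = F M (v (ph t)).
  move=> ht; have [pt mt] := phP (ltac:(lra) : 0 < t <= t1).
  apply: merge_at mt; first by apply: tracked_le k2 _; apply: HNu; lra.
  by apply: tracked_le k3 _; apply: HNv; have := phi t ht; lra.
suff K k : (k <= M - N)%N -> forall t, t0 <= t <= t1 -> F (M - k) (u t) = F (M - k) (v (ph t)).
  by have := K (M - N)%N (leqnn _) t0 ltac:(lra); rewrite subKn.
elim: k => [|k IH] kM t ht; first by rewrite subn0; exact: EM.
have {}IH := IH (ltnW kM).
have [Nj jM] := sub_bounds kM.
move: IH; rewrite -(subnSK (leq_trans kM (leq_subr _ _))); set j := (M - k.+1)%N in Nj *.
move=> IH.
have Ej t' : t0 <= t' <= t1 -> re (F j (u t')) = re (F j (v (ph t'))) /\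
    exists k : int, im (F j (u t')) - im (F j (v (ph t'))) = k%:~R * (2 * pi).
  by move=> ht'; apply: (@f_eq _ a); exact: IH.
have E1j : F j (u t1) = F j (v (ph t1)) by exact: merge_F Nj E1.
have [cu _ _ _] := hu; have [cv _ _ _] := hv.
pose al s := t0 + clamp s * (t1 - t0).
have al_itv s : t0 <= al s <= t1 by apply: seg_itv; [lra|exact: clamp01].
have cal : continuous al.
  apply: cts_add; first exact: cts_cst.
  by apply: cts_mul; [exact: clamp_cts|exact: cts_cst].
have cg : continuous (fun s => im (F j (u (al s))) - im (F j (v (ph (al s))))).
  apply: cts_sub.
    exact: (cts_comp (@cpath_im _ a j _ cu) cal).
  exact: (cts_comp (@cpath_im _ a j _ cv) (ph_cts (ltac:(lra) : 0 < t0) t01)).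
have Z := @discrete_cst R _ (2 * pi) (ltac:(have := @pi_gt0 R; lra)) cg
   (fun s _ => (Ej (al s) (al_itv s)).2).
have [s s01 Es] := seg_surj ht.
have al_s : al s = t by rewrite /al clamp_id // -Es.
have al_1 : al 1 = t1 by rewrite /al clamp_ge1 // mul1r addrC subrK.
have z1 := Z 1 ltac:(lra); have zs := Z s s01.
rewrite al_1 E1j subrr in z1; rewrite al_s -z1 in zs.
apply: Cext; first exact: (Ej t ht).1.
by apply/eqP; rewrite -subr_eq0 zs.
Qed.

End Reparametrisation.

(** As [u t1] is slower than [v 1], each [u t] with t <= t1 lies between [v 1] and some slower point
    of [v], and so merges with some [v (ph t)]. By [ph_merge] one number of iterations serves all t;
    the last clause makes ph tend to 0. *)
Lemma hairs_merge : exists N t1 (ph : R -> R), [/\ 0 < t1 <= 1,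
  forall t, 0 < t <= t1 -> 0 < ph t <= 1 /\ F N (u t) = F N (v (ph t)) &
  forall e, 0 < e <= 1 -> exists2 t2, 0 < t2 <= t1 & forall t, 0 < t <= t2 -> ph t <= e].
Proof.
have [_ _ _ eu] := hu; have [_ _ _ ev] := hv.
have i1 : 0 < (1 : R) <= 1 by lra.
have [t1 t1h S1] := hair_slow hu uA (tv i1) (ev 1 i1) i1.
have Sle s t : 0 < s -> s <= t -> t <= 1 -> slower (u s) (u t).
  move=> s0; rewrite le_eqVlt => /orP[/eqP -> _|st tt]; last exact: (hair_mono hu uA).
  by apply: merge_slower; exists 0%N.
have /choice [ph phP] : forall t, exists s, 0 < t <= t1 -> 0 < s <= 1 /\ merge (u t) (v s).
  move=> t; have [ht|nt] := pselect (0 < t <= t1); last by exists 0.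
  have t01 : 0 < t <= 1 by lra.
  have [s0 s0h Ss] := hair_slow hv vA (tu t01) (eu t t01) i1.
  have [||s hs M] := hair_meet hv vA (tu t01) (ltac:(lra) : 0 < s0) (ltac:(lra) : s0 <= 1) (lexx 1) => //.
    apply: (slower_trans (tu t01) (tu t1h) (tv i1)) => //.
    by apply: Sle; lra.
  by exists s => _; split => //; lra.
have [N E1] := (phP t1 ltac:(lra)).2.
exists N, t1, ph; split => //.
  move=> t ht; split; first by have [] := phP t ht.
  exact: (ph_merge t1h phP E1 ht).
move=> e e01.
have [t2 t2h S2] := hair_slow hu uA (tv e01) (ev e e01) t1h.
exists t2 => // t ht; rewrite leNgt; apply/negP => h.
have [pt mt] := phP t ltac:(lra).
have tt : 0 < t <= 1 by lra.
have ve : slower (v (ph t)) (v e).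
  apply: (slower_trans (tv pt) (tu tt) (tv e01)); first by apply: merge_slower; exact: merge_sym.
  apply: (slower_trans (tu tt) (tu _) (tv e01) _ S2); first lra.
  by apply: Sle; lra.
have ev' : slower (v e) (v (ph t)) by apply: (hair_mono hv vA); lra.
have : ph t = e by apply: (hair_inj hv vA) => //; exact: (slower_anti (tv pt) (tv e01)).
lra.
Qed.

Lemma hairs_merge_landing : exists N, F N (u 0) = F N (v 0).
Proof.
have [N [t1 [ph [t1h phP ph0]]]] := hairs_merge; exists N.
have [cu _ _ _] := hu; have [cv _ _ _] := hv.
have key (g h : R -> R) : continuous g -> continuous h ->
    (forall t, 0 < t <= t1 -> g t = h (ph t)) -> g 0 = h 0.
  move=> cg ch E; apply/eqP; rewrite -subr_eq0 -normr_eq0; apply/eqP.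
  apply: contrapT => /eqP n0.
  have p0 : 0 < `|g 0 - h 0| / 2 by rewrite divr_gt0 // lt_neqAle eq_sym n0 normr_ge0.
  have [d d0 D] := (cts_ball _).1 cg 0 _ p0; have [d' d0' D'] := (cts_ball _).1 ch 0 _ p0.
  have m1 : 0 < Num.min (d' / 2) 1 <= 1.
    by rewrite ge_min lexx orbT andbT lt_min; lra.
  have [t2 t2h T2] := ph0 _ m1.
  pose t := Num.min t2 (d / 2).
  have t0 : 0 < t by rewrite lt_min; lra.
  have [tt2 td] : t <= t2 /\ t <= d / 2 by rewrite /t !ge_min !lexx orbT.
  have := T2 t ltac:(lra); rewrite le_min => /andP[ph1 _].
  have [pt _] := phP t ltac:(lra).
  have h1 := D t ltac:(rewrite ltr_norml; lra); have h2 := D' (ph t) ltac:(rewrite ltr_norml; lra).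
  rewrite E in h1; last lra.
  have := ler_distD (h (ph t)) (g 0) (h 0); rewrite [`|g 0 - h (ph t)|]distrC; lra.
apply: Cext.
  apply: (key (fun t => re (F N (u t))) (fun t => re (F N (v t)))); try exact: cpath_re.
  by move=> t ht; rewrite (phP t ht).2.
apply: (key (fun t => im (F N (u t))) (fun t => im (F N (v t)))); try exact: cpath_im.
by move=> t ht; rewrite (phP t ht).2.
Qed.

End Merging.

(** * No wandering triangles *)

Section Lexicographic.
Implicit Types (A B C : nat -> int).

Lemma lexlt_trans A B C : lexlt A B -> lexlt B C -> lexlt A C.
Proof.
move=> [r [hr ABr]] [r' [hr' BCr]]; case: (ltngtP r r') => [h|h|E].
- exists r; split; last by rewrite -hr'.
  by move=> i ir; rewrite hr // hr' //; exact: ltn_trans ir h.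
- exists r'; split; last by rewrite hr.
  by move=> i ir; rewrite hr ?hr' //; exact: ltn_trans ir h.
- exists r; rewrite -E in hr' BCr; split; last exact: lt_trans ABr BCr.
  by move=> i ir; rewrite hr ?hr'.
Qed.

Lemma lexlt_total A B : (exists r, A r <> B r) -> lexlt A B \/ lexlt B A.
Proof.
move=> [r0 nr0]; have ex : exists r, A r != B r by exists r0; apply/eqP.
have mn i : (i < ex_minn ex)%N -> A i = B i.
  case: ex_minnP => m _ hm im; apply/eqP; apply: contraT => /hm.
  by rewrite leqNgt im.
have : A (ex_minn ex) != B (ex_minn ex) by case: ex_minnP.
rewrite neq_lt => /orP[h|h]; [left|right]; exists (ex_minn ex); split => //.
by move=> i ir; apply: esym; exact: mn.
Qed.

(** Cylinders are convex in the lexicographic order. *)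
Lemma lexlt_between A B C b : lexlt A C -> lexlt C B -> (forall r, (r < b)%N -> A r = B r) ->
  forall r, (r < b)%N -> C r = A r.
Proof.
move=> [r1 [h1 l1]] [r2 [h2 l2]] H r rb.
have b1 : (b <= r1)%N.
  rewrite leqNgt; apply/negP => r1b.
  case: (ltngtP r1 r2) => [h|h|E].
  - by move: l1; rewrite (h2 r1 h) -(H r1 r1b) ltxx.
  - have r2b := ltn_trans h r1b.
    by move: l2; rewrite -(h1 r2 h) (H r2 r2b) ltxx.
  - by move: l2; rewrite -E -(H r1 r1b) => l2; have := lt_trans l1 l2; rewrite ltxx.
by apply: esym; apply: h1; exact: leq_trans rb b1.
Qed.

End Lexicographic.

(* Thurston-style argument: three pairwise different addresses whose shifts and translates
   are all unlinked cannot exist. At each event below, the two extreme addresses of a triple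
   that has just been torn apart bound an interval containing the address of the singular
   value; these intervals are nested, which forces the event lengths to decrease. *)
Section NoWanderingTriangles.
Variables (I : Type) (s : I -> nat -> int).
Local Notation S i n := (fun r => s i (n + r)%N).
Definition adr (i : I) (n : nat) (k : int) : nat -> int :=
  fun r => if r is r'.+1 then s i (n + r'.+1)%N else s i n + k.

Hypothesis differ : forall i j n m, i <> j \/ n <> m -> forall N, exists2 r, (N <= r)%N & s i (n + r)%N <> s j (m + r)%N.
Hypothesis unlinked_adr : forall n m k l i i' j j', n <> m \/ k <> l -> i <> i' -> j <> j' ->
  lexlt (adr i n k) (adr j m l) -> lexlt (adr j m l) (adr i' n k) -> lexlt (adr i' n k) (adr j' m l) ->
  lexlt (adr i n k) (adr j' m l) -> False.

Lemma unlinked' n m k l i i' j j' : n <> m \/ k <> l -> i <> i' -> j <> j' ->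
  lexlt (adr i n k) (adr j m l) -> lexlt (adr j m l) (adr i' n k) -> lexlt (adr i' n k) (adr j' m l) -> False.
Proof.
move=> h1 h2 h3 a b c; apply: (unlinked_adr h1 h2 h3 a b c).
exact: lexlt_trans a (lexlt_trans b c).
Qed.

Lemma adr_S i n : adr i n 0 = S i n.
Proof. by apply: funext => -[|r] /=; rewrite ?addn0 ?addr0. Qed.

Lemma adr_lt i j n m k l : s i n + k < s j m + l -> lexlt (adr i n k) (adr j m l).
Proof. by move=> h; exists 0%N. Qed.

Lemma adr_eq i j n m k l : s i n + k = s j m + l -> lexlt (S i n.+1) (S j m.+1) ->
  lexlt (adr i n k) (adr j m l).
Proof.
move=> E [r [hr lr]]; exists r.+1; split; last by rewrite /= -!addSnnS.
by move=> [|x] xr //=; rewrite -!addSnnS; exact: hr.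
Qed.

Lemma adr_inv i j n m k l : lexlt (adr i n k) (adr j m l) ->
  s i n + k < s j m + l \/ s i n + k = s j m + l /\ lexlt (S i n.+1) (S j m.+1).
Proof.
move=> [[|r] [hr lr]]; [by left|right]; split; first exact: (hr 0%N).
exists r; split; last by rewrite !addSnnS.
by move=> x xr; rewrite !addSnnS; exact: (hr x.+1).
Qed.

Lemma S_total i j n m : i <> j \/ n <> m -> lexlt (S i n) (S j m) \/ lexlt (S j m) (S i n).
Proof. by move=> h; apply: lexlt_total; have [r _ hr] := differ h 0; exists r. Qed.

(** A triple is unlinked with its own translate by 1, so its addresses span less than one period. *)
Lemma self_unlinked i j n : i <> j -> lexlt (S i n) (S j n) -> lexlt (adr j n 0) (adr i n 1).
Proof.
move=> ij ltij.
have [|h|h] := @lexlt_total (adr i n 1) (adr j n 0); [|exfalso|exact: h].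
  have [[|r] // _ hr] := differ (or_introl ij : i <> j \/ n <> n) 1.
  by exists r.+1.
apply: (@unlinked' n n 0 1 i j i j) => //.
- by right.
- by apply: adr_lt; rewrite addr0 ltrDl.
- by apply: adr_lt; rewrite addr0 ltrDl.
Qed.

Lemma gap_le1 i j n : s j n <= s i n + 1.
Proof.
have [-> |ij] := pselect (i = j); first by rewrite lerDl.
have [h|h] := S_total (or_introl ij : i <> j \/ n <> n).
  have [|[]] := adr_inv (self_unlinked ij h); rewrite addr0; first exact: ltW.
  by move=> ->.
have ha : lexlt (adr j n 0) (adr i n 0) by rewrite !adr_S.
have [|[]] := adr_inv ha.
  by rewrite !addr0 => h'; apply: ltW; apply: lt_trans h' _; rewrite ltrDl.
by rewrite !addr0 => ->; rewrite lerDl.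
Qed.

(** A full unit in the first entry leaves [self_unlinked] to be decided by the later entries, so the
    shift reverses the order. *)
Lemma gap_eq1 i j n : i <> j -> s j n = s i n + 1 -> lexlt (S j n.+1) (S i n.+1).
Proof.
move=> ij E.
have h : lexlt (S i n) (S j n).
  by rewrite -!adr_S; apply: adr_lt; rewrite !addr0 E ltrDl.
have [|[]] := adr_inv (self_unlinked ij h); last by [].
by rewrite addr0 E ltxx.
Qed.

Lemma two_values p q r n : s p n = s q n \/ s r n = s p n \/ s r n = s q n.
Proof.
have := gap_le1 p q n; have := gap_le1 q p n; have := gap_le1 p r n.
have := gap_le1 r p n; have := gap_le1 q r n; have := gap_le1 r q n.
by clear; move: (s p n) (s q n) (s r n) => x y z; lia.
Qed.

(** The pair [p], [r] is split at [n] and not again before [u]; in between, at [t], the third member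
    [q] leaves it. The length that decreases in the descent is u - n. *)
Definition event n t u p q r :=
  [/\ p <> q, q <> r & r <> p] /\
  [/\ (n < t < u)%N, s p n = s q n, s r n <> s p n,
      forall x, (n < x < t)%N -> s q x = s p x /\ s r x = s p x &
      [/\ s q t <> s p t, forall x, (t <= x < u)%N -> s r x = s p x & s r u <> s p u]].

Lemma first_difference p q t : p <> q -> exists u, [/\ (t <= u)%N, s p u <> s q u &
  forall x, (t <= x < u)%N -> s p x = s q x].
Proof.
move=> pq.
have ex : exists u, (t <= u)%N && (s p u != s q u).
  have [r Nr hr] := differ (or_introl pq : p <> q \/ 0%N <> 0%N) t.
  by exists r; rewrite Nr; apply/eqP.
case: (ex_minnP ex) => u /andP[tu /eqP hu] mn; exists u; split => // x /andP[tx xu].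
apply/eqP; apply: contraT => h; have := mn x; rewrite tx h => /(_ isT).
by rewrite leqNgt xu.
Qed.

Lemma find_event t0 t1 p q r : [/\ p <> q, q <> r & r <> p] -> (t0 < t1)%N ->
  (forall x, (t0 <= x < t1)%N -> s p x = s q x) -> s p t1 <> s q t1 -> s r t0 <> s p t0 ->
  exists n u p' q' r', (t0 <= n)%N /\ event n t1 u p' q' r'.
Proof.
move=> [pq qr rp] t01 agree dif d0.
have ex : exists n, (t0 <= n < t1)%N && (s r n != s p n).
  by exists t0; rewrite leqnn t01; apply/eqP.
have bd n : (t0 <= n < t1)%N && (s r n != s p n) -> (n <= t1)%N.
  by move=> /andP[/andP[_ h] _]; exact: ltnW.
(* The last time before [t1] at which [r] differs from the pair. By [two_values] one member of the
   pair agrees with [r] at [t1]; it becomes p'. *)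
case: (ex_maxnP ex bd) => n /andP[/andP[t0n nt1] /eqP dn] mx.
have all x : (n < x < t1)%N -> s q x = s p x /\ s r x = s p x.
  move=> /andP[nx xt]; have t0x : (t0 <= x)%N by apply: leq_trans t0n (ltnW nx).
  split; first by rewrite agree // t0x.
  apply/eqP; apply: contraT => h; have := mx x; rewrite t0x xt h => /(_ isT).
  by rewrite leqNgt nx.
have Epq : s p n = s q n by apply: agree; rewrite t0n.
have [h|[h|h]] := two_values p q r t1; first by [].
  have [u [tu du au]] := @first_difference r p t1 rp.
  exists n, u, p, q, r; split => //; split => //; split => //.
    rewrite nt1 ltn_neqAle tu andbT; apply/eqP => E; apply: du; rewrite -E.
    exact: h.
  by split => //; exact: nesym.
have [u [tu du au]] := @first_difference r q t1 (nesym qr).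
exists n, u, q, p, r; split => //; split; first by split => //; [exact: nesym|exact: nesym|exact: nesym].
split => //.
- by rewrite nt1 ltn_neqAle tu andbT; apply/eqP => E; apply: du; rewrite -E.
- by rewrite -Epq.
- by move=> x /all [-> ->].
Qed.

Lemma event_pair n t u p q r : event n t u p q r ->
  exists lo hi, [/\ lo <> hi, q <> lo, q <> hi, s hi n = s lo n + 1 & lexlt (S hi n.+1) (S lo n.+1)] /\
    [/\ forall x, (n < x < u)%N -> s lo x = s hi x, s q t <> s lo t & (n < t < u)%N].
Proof.
move=> [[pq qr rp] [ntu Epq dr all [dq ag du]]].
have E x : (n < x < u)%N -> s r x = s p x.
  move=> /andP[nx xu]; case: (ltnP x t) => xt; first by have [_ ->] := all x ltac:(by rewrite nx).
  by apply: ag; rewrite xt.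
have Et : s r t = s p t by apply: E.
have := gap_le1 p r n; have := gap_le1 r p n.
have [h|h] : s r n = s p n + 1 \/ s p n = s r n + 1.
  have := gap_le1 p r n; have := gap_le1 r p n; move: dr; clear.
  by move: (s r n) (s p n) => x y; lia.
  move=> _ _; exists p, r; split; split => //; try exact: nesym.
  - by apply: gap_eq1 => //; exact: nesym.
  - by move=> x /E.
move=> _ _; exists r, p; split; split => //; try exact: nesym.
- by apply: gap_eq1.
- by rewrite Et.
Qed.

(** Translate both triples so that their lower entries become 0. If the shifted [lo] preceded the
    shifted [hi'], the addresses would be linked in the order lo, lo', hi, hi'. *)
Lemma not_before n n' lo hi lo' hi' : n <> n' -> lo <> hi -> lo' <> hi' ->
  s hi n = s lo n + 1 -> s hi' n' = s lo' n' + 1 ->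
  lexlt (S hi n.+1) (S lo n.+1) -> lexlt (S hi' n'.+1) (S lo' n'.+1) ->
  lexlt (S hi' n'.+1) (S lo n.+1).
Proof.
move=> nn lh lh' E E' ab ab'.
have [|h|h] := @S_total hi' lo n'.+1 n.+1; [by right=> -[] /esym|exact: h|exfalso].
 apply: (@unlinked' n n' (- s lo n) (- s lo' n') lo hi lo' hi') => //; first by left.
- by apply: adr_eq; rewrite ?subrr //; exact: lexlt_trans h ab'.
- by apply: adr_lt; rewrite E subrr addrAC subrr add0r.
- apply: adr_eq; last exact: lexlt_trans ab h.
  by rewrite E E' addrAC subrr add0r addrAC subrr add0r.
Qed.

Lemma linked_S n m i i' j j' : n <> m -> i <> i' -> j <> j' ->
  lexlt (S i n) (S j m) -> lexlt (S j m) (S i' n) -> lexlt (S i' n) (S j' m) -> False.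
Proof.
rewrite -!adr_S => nm ii jj a b c.
by apply: (@unlinked' n m 0 0 i i' j j') => //; left.
Qed.

Lemma trapped n n' lo hi lo' hi' q' : n <> n' -> lo <> hi -> q' <> lo' -> q' <> hi' ->
  lexlt (S hi n) (S hi' n') -> lexlt (S hi' n') (S lo' n') -> lexlt (S lo' n') (S lo n) ->
  lexlt (S hi n) (S q' n') /\ lexlt (S q' n') (S lo n).
Proof.
move=> nn lh ql qh h1 h2 h3; split.
  have [|h|h] := @S_total hi q' n n'; [by right|exact: h|exfalso].
  apply: (@linked_S n' n q' hi' hi lo) => //; try exact: nesym.
  exact: lexlt_trans h2 h3.
have [|h|h] := @S_total lo q' n n'; [by right|exfalso|exact: h].
 apply: (@linked_S n n' hi lo hi' q') => //; try exact: nesym.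
exact: lexlt_trans h2 h3.
Qed.

Lemma trapped_agree n n' b lo hi lo' q' : lexlt (S hi n) (S q' n') -> lexlt (S q' n') (S lo n) ->
  lexlt (S hi n) (S lo' n') -> lexlt (S lo' n') (S lo n) ->
  (forall x, (n <= x < b + n)%N -> s lo x = s hi x) ->
  forall x, (n' <= x < b + n')%N -> s q' x = s lo' x.
Proof.
move=> h1 h2 h3 h4 H x /andP[nx xb].
have ag r : (r < b)%N -> s hi (n + r)%N = s lo (n + r)%N.
  by move=> rb; apply: esym; apply: H; rewrite leq_addr addnC ltn_add2r.
have xr : (x - n' < b)%N by rewrite ltn_subLR // addnC.
have := lexlt_between h1 h2 ag xr; have := lexlt_between h3 h4 ag xr.
by rewrite subnKC // => -> ->.
Qed.

(** The middle time of the second event is [u]. By [not_before] the intervals from hi to lo and from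
    hi' to lo' overlap; being unlinked, they are nested. If the later one were inside, [q'] would be
    trapped in the earlier one and agree with [lo'] at time [u], where it leaves. So the earlier one
    is inside, and since [q] leaves at [t], u' - n' is at most t - n. *)
Lemma event_shrinks n t u p q r n' u' p' q' r' : event n t u p q r -> event n' u u' p' q' r' ->
  (t <= n')%N -> (u' - n' < u - n)%N.
Proof.
move=> e e' tn.
have [lo [hi [[lh ql qh E ab] [ag dq ntu]]]] := event_pair e.
have [lo' [hi' [[lh' ql' qh' E' ab'] [ag' dq' ntu']]]] := event_pair e'.
have nn : n <> n' by move=> X; move: ntu tn; rewrite X; clear; lia.
have a'b := not_before nn lh lh' E E' ab ab'.
have ab0 := not_before (nesym nn) lh' lh E' E ab' ab.
have nnS : n.+1 <> n'.+1 by move=> [].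
have agS b : (b + n.+1 <= u)%N -> forall x, (n.+1 <= x < b + n.+1)%N -> s lo x = s hi x.
  move=> bu x /andP[nx xb]; apply: ag; rewrite nx; exact: leq_trans xb bu.
have agS' b : (b + n'.+1 <= u')%N -> forall x, (n'.+1 <= x < b + n'.+1)%N -> s lo' x = s hi' x.
  move=> bu x /andP[nx xb]; apply: ag'; rewrite nx; exact: leq_trans xb bu.
have [||aa] := @S_total hi hi' n.+1 n'.+1; first by right.
  move=> aa; have [|h|bb] := @S_total lo lo' n.+1 n'.+1; first by right.
    by exfalso; apply: (@linked_S n.+1 n'.+1 hi lo hi' lo') => //; exact: nesym.
  have [t1 t2] := trapped nnS lh ql' qh' aa ab' bb.
  exfalso; apply: dq'; apply: (@trapped_agree n.+1 n'.+1 (u - n.+1) lo hi lo' q' t1 t2).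
  - exact: lexlt_trans aa ab'.
  - exact: bb.
  - by apply: agS; rewrite subnK //; move: ntu; clear; lia.
  - by move: ntu ntu' tn; clear; lia.
have [|bb|h] := @S_total lo lo' n.+1 n'.+1; first by right.
  have [t1 t2] := trapped (nesym nnS) lh' ql qh aa ab bb.
  rewrite ltnNge; apply/negP => hle; apply: dq.
  apply: (@trapped_agree n'.+1 n.+1 (u' - n'.+1) lo' hi' lo q t1 t2).
  - exact: lexlt_trans aa ab.
  - exact: bb.
  - by apply: agS'; rewrite subnK //; move: ntu'; clear; lia.
  - by move: ntu ntu' tn hle; clear; lia.
by exfalso; apply: (@linked_S n'.+1 n.+1 hi' lo' hi lo) => //; exact: nesym.
Qed.

Lemma no_event k : forall n t u p q r, event n t u p q r -> (u - n <= k)%N -> False.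
Proof.
elim: k => [|k IH] n t u p q r e uk.
  by case: e => _ [ntu _ _ _ _]; move: ntu uk; clear; lia.
have [[pq qr rp] [ntu Epq dr all [dq ag du]]] := e.
have [|||||n' [u' [p' [q' [r' [tn e']]]]]] := @find_event t u r p q.
- by split => //; exact: nesym.
- by case/andP: ntu.
- exact: ag.
- exact: du.
- by rewrite ag // leqnn; case/andP: ntu.
have := event_shrinks e e' tn => h.
by apply: (IH _ _ _ _ _ _ e'); rewrite -ltnS; exact: leq_trans h uk.
Qed.

Lemma no_wandering_triangle (i0 i1 i2 : I) : i0 <> i1 -> i1 <> i2 -> i2 <> i0 -> False.
Proof.
move=> h01 h12 h20.
suff K p q r n : [/\ p <> q, q <> r & r <> p] -> s p n = s q n -> s r n <> s p n -> False.
  have [n _ hn] := differ (or_introl h01 : i0 <> i1 \/ 0%N <> 0%N) 0.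
  rewrite !add0n in hn.
  have [h|[h|h]] := two_values i0 i1 i2 n; first by [].
    by apply: (K i2 i0 i1 n) => //; rewrite h; exact: nesym.
  by apply: (K i1 i2 i0 n).
move=> [pq qr rp] E d.
have [t [nt dt at']] := first_difference n pq.
have nt' : (n < t)%N.
  by rewrite ltn_neqAle nt andbT; apply/eqP => X; apply: dt; rewrite -X.
have [n' [u [p' [q' [r' [_ e]]]]]] := find_event (And3 pq qr rp) nt' at' dt d.
exact: no_event e (leqnn _).
Qed.

End NoWanderingTriangles.

(** * The endpoint *)

Section ComplexTopology.
Variables (R : realType) (a : R[i]).
Implicit Types (z w : R[i]) (x y e r : R).
Local Notation F n := (iter n (expmap a)).

Lemma lt_normC x z : 0 <= x -> (x%:C < `|z|) = (x ^+ 2 < re z ^+ 2 + im z ^+ 2).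
Proof.
move=> x0; rewrite normc_def ltcR.
have h : 0 <= re z ^+ 2 + im z ^+ 2 by rewrite addr_ge0 ?sqr_ge0.
by rewrite -(@ltr_pXn2r _ 2%N) ?nnegrE ?sqrtr_ge0 // sqr_sqrtr.
Qed.

Lemma normC_lt x z : 0 < x -> (`|z| < x%:C) = (re z ^+ 2 + im z ^+ 2 < x ^+ 2).
Proof.
move=> x0; rewrite normc_def ltcR.
have h : 0 <= re z ^+ 2 + im z ^+ 2 by rewrite addr_ge0 ?sqr_ge0.
by rewrite -(@ltr_pXn2r _ 2%N) ?nnegrE ?sqrtr_ge0 // ?sqr_sqrtr // ltW.
Qed.

(** The modulus of [f z] is at most expR (re z) plus that of [a], so a large modulus at time j + 1
    forces a large real part at time j. *)
Lemma escapesP z : escaping_set a z <-> escapes a z.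
Proof.
split=> [H b|H].
  pose E := expR b; pose M := 2 * E + `|re a| + `|im a|.
  have E0 : 0 < E by exact: expR_gt0.
  have na := normr_ge0 (re a); have nb := normr_ge0 (im a).
  have M0 : 0 <= M by rewrite /M; lra.
  have [|N _ HN] := H [set x | M%:C < x]; first by exists M%:C; split => //; rewrite complex_real.
  exists N => j Nj; have := HN j.+1 (leqW Nj); rewrite /= lt_normC // => h.
  rewrite leNgt; apply/negP => hb.
  have e1 : expR (re (F j z)) <= E by rewrite ler_expR ltW.
  have e2 := expR_gt0 (re (F j z)).
  have B c : -1 <= c <= 1 -> `|expR (re (F j z)) * c| <= E.
    move=> c1; rewrite normrM gtr0_norm // -[leRHS]mulr1.
    by apply: ler_pM; rewrite ?normr_ge0 ?(ltW e2) // ler_norml.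
  have := B _ (introT andP (conj (cos_geN1 (im (F j z))) (cos_le1 (im (F j z))))).
  have := B _ (introT andP (conj (sin_geN1 (im (F j z))) (sin_le1 (im (F j z))))).
  move=> h2 h1.
  have g1 : `|re (expmap a (F j z))| <= E + `|re a|.
    by rewrite re_f; apply: le_trans (ler_normD _ _) _; lra.
  have g2 : `|im (expmap a (F j z))| <= E + `|im a|.
    by rewrite im_f; apply: le_trans (ler_normD _ _) _; lra.
  have := sq_le g1; have := sq_le g2; move: h; rewrite /M; nra.
move=> P [M [Mr HM]].
have [N HN] := H (`|re M| + 1); exists N => // n /= Nn; apply: HM.
rewrite -(RRe_real Mr); apply: le_lt_trans (_ : (`|re M|)%:C < _).
  by rewrite lecR ler_norm.
rewrite lt_normC ?normr_ge0 //; have := HN n Nn; have := normr_ge0 (re M).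
have := sqr_ge0 (im (F n z)); move: (re (F n z)) (`|re M|) => p q; nra.
Qed.

Lemma cpath_of_arc (g : R -> R[i]) (c d p q : R) : c <= d -> {within `[c, d], continuous g} ->
  c <= p <= d -> c <= q <= d -> cpath (fun t => g (p + clamp t * (q - p))).
Proof.
move=> cd H pcd qcd.
have itv t : c <= p + clamp t * (q - p) <= d by have := clamp01 t; nra.
have cal : continuous (fun t : R => p + clamp t * (q - p)).
  apply: cts_add; first exact: cts_cst.
  by apply: cts_mul; [exact: clamp_cts|exact: cts_cst].
have K t e : 0 < e -> exists2 d', 0 < d' & forall s, `|s - t| < d' ->
    re (g (p + clamp t * (q - p)) - g (p + clamp s * (q - p))) ^+ 2
    + im (g (p + clamp t * (q - p)) - g (p + clamp s * (q - p))) ^+ 2 < e ^+ 2.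
  move=> e0; have e0' : (0 : R[i]) < e%:C by rewrite ltcR.
  have [d1 d10 D1] := within_ball H (itv t) e0'.
  have [d2 d20 D2] := (cts_ball _).1 cal t d1 d10.
  by exists d2 => // s /D2 /(D1 _ (itv s)); rewrite normC_lt.
split; apply/cts_ball => t e e0; have [d' d0' D'] := K t e e0; exists d' => // s /D';
  move: (g _) (g _) => z w; rewrite !raddfB /= => h; rewrite distrC -[ltRHS]gtr0_norm //;
  rewrite -ltr_sqr ?nnegrE ?normr_ge0 // !real_normK ?num_real //.
  by have := sqr_ge0 (im z - im w); lra.
by have := sqr_ge0 (re z - re w); lra.
Qed.

Lemma cts_of_cpath (P : R -> R[i]) : cpath P -> continuous P.
Proof.
move=> [/cts_ball cx /cts_ball cy] t; apply/cvgrPdist_lt => e e0.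
have er : e \is Num.real by rewrite realE ltW.
move: e0; rewrite -(RRe_real er) ltcR => e0.
have [d1 d10 D1] := cx t (re e / 2) ltac:(lra); have [d2 d20 D2] := cy t (re e / 2) ltac:(lra).
exists (Num.min d1 d2); first by rewrite /= lt_min d10.
move=> s /=; rewrite lt_min distrC => /andP[/D1 h1 /D2 h2]; rewrite normC_lt // !raddfB /=.
have := sq_le (ltW h1); have := sq_le (ltW h2).
have -> : (re (P t) - re (P s)) ^+ 2 = (re (P s) - re (P t)) ^+ 2 by ring.
have -> : (im (P t) - im (P s)) ^+ 2 = (im (P s) - im (P t)) ^+ 2 by ring.
rewrite expr_div_n; nra.
Qed.

End ComplexTopology.

(** * From three accesses to a wandering triangle *)

Section Assembly.
Variables (R : realType) (a z0 : R[i]).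
Implicit Types (u v w z : R[i]) (s t e : R) (A B : nat -> int).
Local Notation f := (expmap a).
Local Notation F n := (iter n (expmap a)).
Local Notation m0 := (m0 a).
Local Notation far := (far a).
Local Notation escapes := (escapes a).
Local Notation inJ := (inJ a).

Definition access (g : R -> R[i]) := [/\ cpath g, g 0 = z0,
  (forall s t, 0 <= s <= 1 -> 0 <= t <= 1 -> g s = g t -> s = t) &
  forall t, 0 < t <= 1 -> escapes (g t)].

Lemma access_of_arc (B : set R[i]) : is_arc B -> B `<=` escaping_set a `|` [set z0] -> B z0 ->
  exists2 g, access g & forall t, 0 <= t <= 1 -> B (g t).
Proof.
move=> [c [d [g [cd [cg ig] ->]]]] sub [t0 /=]; rewrite in_itv /= => t0cd E0.
(* [z0] may be interior to the arc; the piece from [z0] to an end other than [z0] is kept. *)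
have [q [qcd qt]] : exists q, c <= q <= d /\ q != t0.
  have [h|h] := eqVneq d t0; [exists c|exists d; split => //; lra].
  by split; [lra|rewrite lt_eqF // -h].
have inj x y : c <= x <= d -> c <= y <= d -> g x = g y -> x = y.
  by move=> hx hy E; apply: ig; rewrite ?inE /= ?in_itv.
have itv t : 0 <= t <= 1 -> c <= t0 + t * (q - t0) <= d by move=> t01; nra.
have img t : 0 <= t <= 1 -> (g @` `[c, d]) (g (t0 + clamp t * (q - t0))).
  by move=> t01; exists (t0 + clamp t * (q - t0)) => //=; rewrite in_itv /= clamp_id //; exact: itv.
have injt s t : 0 <= s <= 1 -> 0 <= t <= 1 ->
    g (t0 + clamp s * (q - t0)) = g (t0 + clamp t * (q - t0)) -> s = t.
  move=> s01 t01; rewrite !clamp_id // => /(inj _ _ (itv s s01) (itv t t01)) /addrI /mulIf.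
  by apply; rewrite subr_eq0.
have g0 : g (t0 + clamp 0 * (q - t0)) = z0 by rewrite clamp_le0 // mul0r addr0.
exists (fun t => g (t0 + clamp t * (q - t0))) => //; split => //.
  exact: (cpath_of_arc (ltW cd) cg t0cd qcd).
move=> t t01; have t01' : 0 <= t <= 1 by lra.
have [/escapesP //|/= E] := sub _ (img t t01').
have : t = 0 by apply: injt => //; [lra|rewrite g0].
lra.
Qed.

Definition joined (g h : R -> R[i]) := pcat (prev g) h.

Lemma joined_inj g h : access g -> access h ->
  (forall s t, 0 <= s <= 1 -> 0 <= t <= 1 -> g s = h t -> g s = z0) ->
  forall s t, 0 <= s <= 1 -> 0 <= t <= 1 -> joined g h s = joined g h t -> s = t.
Proof.
move=> [cg g0 ig eg] [ch h0 ih eh] dis.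
have J : prev g 1 = h 0 by rewrite /prev subrr g0.
have mix s t : 0 <= s <= 1 / 2 -> 1 / 2 <= t <= 1 -> prev g (2 * s) = h (2 * t - 1) -> s = t.
  rewrite /prev => hs ht E; have Ez := dis (1 - 2 * s) (2 * t - 1) ltac:(lra) ltac:(lra) E.
  have e1 : 1 - 2 * s = 0 by apply: ig; [lra|lra|rewrite g0].
  have e2 : 2 * t - 1 = 0 by apply: ih; [lra|lra|rewrite h0 -E].
  lra.
move=> s t s01 t01; rewrite /joined.
case: (lerP s (1 / 2)) => hs; case: (lerP t (1 / 2)) => ht.
- rewrite !pcat_l; [|lra|lra]; rewrite /prev => /ig K; have := K ltac:(lra) ltac:(lra); lra.
- by rewrite pcat_l ?pcat_r //; [apply: mix|..]; lra.
- by rewrite pcat_r ?pcat_l //; [move=> /esym /mix K; apply: esym; apply: K|..]; lra.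
- rewrite !pcat_r //; [|lra|lra]; move=> /ih K; have := K ltac:(lra) ltac:(lra); lra.
Qed.

Lemma joined_cpath g h : access g -> access h -> cpath (joined g h).
Proof. by move=> [cg _ _ _] [ch _ _ _]; apply: pcat_cpath => //; exact: prev_cpath. Qed.

Lemma access_on_hair g h : access g -> access h ->
  (forall s t, 0 <= s <= 1 -> 0 <= t <= 1 -> g s = h t -> g s = z0) ->
  escapes z0 -> on_hair a z0.
Proof.
move=> ag ah dis e0; have cJ := joined_cpath ag ah; have iJ := joined_inj ag ah dis.
have [cg g0 ig eg] := ag; have [ch h0 ih eh] := ah.
have J : prev g 1 = h 0 by rewrite /prev subrr g0.
have E (g' : R -> R[i]) t : access g' -> 0 <= t <= 1 -> escapes (g' t).
  move=> [_ g0' _ eg'] t01; case: (ltrgtP 0 t) => [t0|t0|<-]; [|by move: t01; rewrite leNgt t0|by rewrite g0'].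
  by apply: eg'; lra.
pose X t := joined g h ((t + 1) / 2).
have cX : cpath X.
  apply: cpath_comp => //; apply: cts_mul; last exact: cts_cst.
  by apply: cts_add; [exact: cts_id|exact: cts_cst].
exists X; split.
- split; first by apply: continuous_subspaceT; exact: cts_of_cpath.
  move=> s t; rewrite !inE /= !in_itv /= => hs ht /iJ K.
  by have := K ltac:(lra) ltac:(lra); lra.
- move=> z [t /=]; rewrite in_itv /= => ht <-; apply/escapesP; rewrite /X /joined.
  have [s s01 [->|->]] := pcat_img J (ltac:(lra) : 0 <= (t + 1) / 2 <= 1); last exact: (E h).
  by apply: (E g) => //; lra.
- rewrite /X /joined add0r pcat_l; last lra.
  by rewrite /prev [2 * _]mulrC divfK // subrr.
Qed.

Lemma access_hair g : access g -> ~ escapes z0 -> hair a g.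
Proof.
move=> [cg g0 ig eg] n0; split => //; last by rewrite g0.
by move=> t t01; exists 1 => // s s' s01 s01' _ _; exact: ig.
Qed.

Lemma not_ep_inj : ~ eventually_periodic a z0 -> forall n m, F n z0 = F m z0 -> n = m.
Proof.
move=> nep n m.
wlog nm : n m / (n <= m)%N.
  by move=> W E; case: (leqP n m) => [|/ltnW] h; [exact: W|apply: esym; exact: W].
move=> E; apply: contrapT => ne; apply: nep; exists n; exists (m - n)%N.
  by rewrite subn_gt0 ltn_neqAle nm andbT; apply/eqP.
by rewrite -F_add subnK.
Qed.

Section Contradiction.
Variable g : 'I_3 -> R -> R[i].
Hypotheses (ag : forall i, access (g i)) (n0 : ~ escapes z0) (nep : ~ eventually_periodic a z0)
  (dis : forall i j, i != j -> forall s t, 0 <= s <= 1 -> 0 <= t <= 1 -> g i s = g j t -> g i s = z0).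

Let gh i : hair a (g i). Proof. exact: access_hair. Qed.

Lemma joined_linj i j : i != j -> linj (joined (g i) (g j)).
Proof.
move=> ij t t01; exists 1 => // s s' s01 s01' _ _.
exact: (joined_inj (ag i) (ag j) (dis ij)).
Qed.

(** If n <> m, the orbits of the landing points merge and [z0] is eventually periodic. If n = m, two
    different hairs have common images arbitrarily close to [z0], although iterates of [f] are
    locally injective along the arc that joins them. *)
Lemma tails_differ (i j : 'I_3) (n m : nat) A : i <> j \/ n <> m ->
  (exists N, forall r, (N <= r)%N -> instrip (A r) (F r (F n (g i 1)))) ->
  (exists N, forall r, (N <= r)%N -> instrip (A r) (F r (F m (g j 1)))) -> False.
Proof.
move=> ne tu tv; have hu := hair_F n (gh i); have hv := hair_F m (gh j).
have [nm|nm] := pselect (n = m); last first.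
  have [K] := hairs_merge_landing hu hv tu tv.
  have [_ -> _ _] := ag i; have [_ -> _ _] := ag j.
  by rewrite -!F_add => /(not_ep_inj nep) /addnI.
have ij : i != j by apply/eqP; case: ne.
have [K [t1 [ph [t1h phP ph0]]]] := hairs_merge hu hv tu tv.
have [ci _ _ _] := ag i; have [cj _ _ _] := ag j.
have [] := @linj_F _ a (K + n) _ (joined_cpath (ag i) (ag j)) (joined_linj ij) (1 / 2); first lra.
move=> d d0 D.
have dm : 0 < Num.min d 1 <= 1 by rewrite ge_min lexx orbT andbT lt_min d0 ltr01.
have [t2 t2h T2] := ph0 _ dm.
pose t := Num.min t2 d.
have t0 : 0 < t by rewrite lt_min; lra.
have [tt2 td] : t <= t2 /\ t <= d by rewrite /t !ge_min !lexx orbT.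
have := T2 t ltac:(lra); rewrite le_min => /andP[pd _].
have [pt E] := phP t ltac:(lra).
have J : prev (g i) 1 = g j 0.
  by rewrite /prev subrr; have [_ -> _ _] := ag i; have [_ -> _ _] := ag j.
have x1 : 1 - 2 * ((1 - t) / 2) = t by field.
have x2 : 2 * ((1 + ph t) / 2) - 1 = ph t by field.
have : (1 - t) / 2 = (1 + ph t) / 2.
  apply: D; [lra|lra| | |].
  - by rewrite ltr_norml; lra.
  - by rewrite ltr_norml; lra.
  - rewrite /joined pcat_l; last lra.
    rewrite pcat_r //; last lra.
    by rewrite /prev x1 x2 !F_add E nm.
lra.
Qed.

Lemma hair_strip (u : R -> R[i]) B n t : hair a u -> inJ (m0 + 80) B (u 1) -> 0 < t <= 1 ->
  far (m0 + 70) n.+1 (u t) -> instrip (B n) (F n (u t)).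
Proof.
move=> hu JB; have [cu _ _ _] := hu.
exact: (away_strip cu (fun e => @hair_linj _ a u e hu) JB (hair_away hu)).
Qed.

Section Addresses.
Variables (N : nat) (m : R) (s : 'I_3 -> nat -> int).
Let h i := fun t : R => F N (g i t).
Hypotheses (mm : m0 + 76 <= m) (J : forall i, inJ (m + 4) (s i) (h i 1))
  (slow : forall k, exists2 j, (k <= j)%N & re (F j (F N z0)) < m).

Let hh i : hair a (h i). Proof. exact: hair_F. Qed.
Let h0 i : h i 0 = F N z0. Proof. by rewrite /h; have [_ -> _ _] := ag i. Qed.

Lemma adr_differ i j n k : i <> j \/ n <> k -> forall M, exists2 r, (M <= r)%N & s i (n + r)%N <> s j (k + r)%N.
Proof.
move=> ne M; apply: contrapT => nr.
apply: (@tails_differ i j (n + N) (k + N) (fun r => s i (n + r)%N)).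
- by case: ne => ?; [left|right => /addIn].
- exists 0%N => r _; rewrite F_add -F_add (addnC r n); exact: (J i (n + r)%N).2.
exists M => r Mr; rewrite F_add -F_add (addnC r k).
have -> : s i (n + r)%N = s j (k + r)%N by apply: contrapT => ne'; apply: nr; exists r.
exact: (J j (k + r)%N).2.
Qed.

Lemma hair_tail i t : 0 < t <= 1 -> exists M, forall r, (M <= r)%N -> instrip (s i r) (F r (h i t)).
Proof.
move=> t01.
have uA : exists M, forall r, (M <= r)%N -> instrip (s i r) (F r (h i 1)).
  by exists 0%N => r _; exact: (J i r).2.
have [M HM] := hair_tracked (hh i) uA t01.
by exists M => r Mr; exact: (HM t ltac:(lra) r Mr).2.
Qed.

Lemma landing_not_tracked B n k : ~ inJ m B (lift k (F n (F N z0))).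
Proof.
move=> H; have [i ni hi] := slow n.+1.
have := (H (i - n)%N).1; rewrite -(subnSK ni) F_lift -F_add addSnnS.
by rewrite addnC subnKC //; lra.
Qed.

(** The landing point is excluded by [slow]. For t > 0 different hairs or times have tails that
    differ infinitely often; for the same hair and time, [hair_strip] makes the first entries
    differ. *)
Lemma not_tracked i j n n' k l t : n <> n' \/ k <> l -> 0 <= t <= 1 ->
  ~ inJ m (adr s j n' l) (lift k (F n (h i t))).
Proof.
move=> ne t01 H; case: (ltrgtP 0 t) => [t0|t0|E]; [|by move: t01; rewrite leNgt t0|]; last first.
  by move: H; rewrite -E h0; exact: landing_not_tracked.
have ht : 0 < t <= 1 by lra.
have [[ij nn]|d] := pselect (i = j /\ n = n'); last first.
  have {}d : i <> j \/ n <> n'.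
    by have [ij|] := pselect (i = j); [right => nn; apply: d|left].
  have [M HM] := hair_tail i ht.
  have [[//|r] Mr] := adr_differ d M.+1; apply.
  have := (H r.+1).2; rewrite F_lift -F_add => h1.
  apply: instrip_uniq h1; rewrite (addnC r.+1); apply: HM.
  by apply: leq_trans (ltnW Mr) (leq_addl _ _).
subst j n'; have kl : k <> l by case: ne.
have JB : inJ (m0 + 80) (s i) (h i 1) by apply: inJ_lev (J i); have := mm; lra.
have ft : far (m0 + 70) n.+1 (h i t).
  move=> j nj; have := (H (j - n)%N).1.
  by rewrite -(subnSK nj) F_lift -F_add addSnnS addnC subnKC //; have := mm; lra.
have h1 := instrip_lift k (hair_strip (hh i) JB ht ft).
apply: kl; have := instrip_uniq h1 (H 0%N).2.
by move=> /addrI.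
Qed.

Lemma translates_disjoint i j n n' k l t t' : n <> n' \/ k <> l -> 0 <= t <= 1 -> 0 <= t' <= 1 ->
  lift k (F n (h i t)) <> lift l (F n' (h j t')).
Proof.
move=> ne t01 t01' E.
have E1 : F n.+1 (h i t) = F n'.+1 (h j t') by rewrite /= -(f_lift a k) E f_lift.
have lift_inj z : lift k z = lift l z -> k = l.
  move=> /(congr1 (@complex.Im R)) /= /addrI; have p0 := @pi_gt0 R.
  have n2 : 2 * pi != 0 :> R by rewrite mulf_neq0 // gt_eqF.
  by move=> /(mulIf n2) /eqP; rewrite eqr_int => /eqP.
have esc i' n'' t'' : 0 < t'' <= 1 -> escapes (F n'' (h i' t'')).
  by move=> ht; have [_ _ _] := hair_F n'' (hh i'); apply.
have nesc n'' : ~ escapes (F n'' (F N z0)).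
  by rewrite -F_add; have [_ _ + _] := hair_F (n'' + N) (gh ord0); have [_ -> _ _] := ag ord0.
case: (ltrgtP 0 t) => [t0|t0|Et]; [|by move: t01; rewrite leNgt t0|].
  case: (ltrgtP 0 t') => [t0'|t0'|Et']; [|by move: t01'; rewrite leNgt t0'|].
    have ht : 0 < t <= 1 by lra.
    have ht' : 0 < t' <= 1 by lra.
    have [[ij nn]|d] := pselect (i = j /\ n = n'); last first.
      have {}d : i <> j \/ n <> n'.
        by have [ij|] := pselect (i = j); [right => nn; apply: d|left].
      have [M1 H1] := hair_tail i ht; have [M2 H2] := hair_tail j ht'.
      have [[//|r] Mr] := adr_differ d (M1 + M2).+1; apply.
      have E2 : F (n + r.+1) (h i t) = F (n' + r.+1) (h j t').
        by rewrite !addnS -!addSn ![(_.+1 + _)%N]addnC !F_add E1.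
      have h1 := H1 (n + r.+1)%N (leq_trans (leq_trans (leq_addr M2 M1) (ltnW Mr)) (leq_addl _ _)).
      have h2 := H2 (n' + r.+1)%N (leq_trans (leq_trans (leq_addl M1 M2) (ltnW Mr)) (leq_addl _ _)).
      by rewrite E2 in h1; exact: instrip_uniq h1 h2.
    subst j n'; have kl : k <> l by case: ne.
    have uA : exists M, forall r, (M <= r)%N -> instrip (s i r) (F r (h i 1)).
      by exists 0%N => r _; exact: (J i r).2.
    have tt : t = t' by apply: (hair_inj (hh i) uA) => //; exists n.+1.
    by apply: kl; apply: (lift_inj (F n (h i t))); rewrite {2}tt.
  by move: E1; rewrite -Et' h0 => E1; apply: (nesc n'.+1); rewrite -E1; apply: esc; lra.
case: (ltrgtP 0 t') => [t0'|t0'|Et']; [|by move: t01'; rewrite leNgt t0'|].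
  by move: E1; rewrite -Et h0 => E1; apply: (nesc n.+1); rewrite E1; apply: esc; lra.
move: E E1; rewrite -Et -Et' !h0 -!F_add => E /(not_ep_inj nep) /eqP.
rewrite eqn_add2r eqSS => /eqP nn; subst n'.
by case: ne => // kl; apply: kl; exact: lift_inj E.
Qed.

Lemma adr_unlinked n n' k l i i' j j' : n <> n' \/ k <> l -> i <> i' -> j <> j' ->
  lexlt (adr s i n k) (adr s j n' l) -> lexlt (adr s j n' l) (adr s i' n k) ->
  lexlt (adr s i' n k) (adr s j' n' l) -> lexlt (adr s i n k) (adr s j' n' l) -> False.
Proof.
move=> ne ii jj lab lbc lcd lad.
have ne' : n' <> n \/ l <> k by case: ne => ?; [left|right]; exact: nesym.
(* Two legs of a triod, traversed through the landing point. *)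
pose C p x y (t : R) := lift p.2 (F p.1 (pcat (prev (h x)) (h y) t)) : R[i].
have joint x y : prev (h x) 1 = h y 0 by rewrite /prev subrr !h0.
have cC p x y : cpath (C p x y).
  apply: lift_cpath; apply: cpath_F; apply: pcat_cpath; last by have [] := hh y.
  by apply: prev_cpath; have [] := hh x.
have iC p x y t : 0 <= t <= 1 -> exists x' t', 0 <= t' <= 1 /\ C p x y t = lift p.2 (F p.1 (h x' t')).
  move=> t01; have [r r01 [E|E]] := pcat_img (joint x y) t01; rewrite /C E.
    by exists x, (1 - r); split => //; lra.
  by exists y, r.
have C0 p x y : C p x y 0 = lift p.2 (F p.1 (h x 1)) by rewrite /C pcat0 /prev subr0.
have C1 p x y : C p x y 1 = lift p.2 (F p.1 (h y 1)) by rewrite /C pcat1.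
have end_J x p : inJ (m + 4) (adr s x p.1 p.2) (lift p.2 (F p.1 (h x 1))).
  by apply: inJ_lift; exact: inJ_shift (J x).
apply: (@unlinked _ a m (C (n, k) i i') (C (n', l) j j') _ _ _ _ _ (cC _ _ _) (cC _ _ _)
  _ _ _ _ _ _ _ _ _ lab lbc lcd lad); rewrite ?C0 ?C1.
- by have := mm; lra.
- exact: (end_J i (n, k)).
- exact: (end_J j (n', l)).
- exact: (end_J i' (n, k)).
- exact: (end_J j' (n', l)).
- move=> x y x01 y01; have [i1 [t1 [h1 ->]]] := iC (n, k) i i' x x01.
  have [i2 [t2 [h2 ->]]] := iC (n', l) j j' y y01; exact: translates_disjoint.
- by move=> t t01; have [x [t' [ht ->]]] := iC (n', l) j j' t t01; exact: not_tracked.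
- by move=> t t01; have [x [t' [ht ->]]] := iC (n', l) j j' t t01; exact: not_tracked.
- by move=> t t01; have [x [t' [ht ->]]] := iC (n, k) i i' t t01; exact: not_tracked.
- by move=> t t01; have [x [t' [ht ->]]] := iC (n, k) i i' t t01; exact: not_tracked.
Qed.

Lemma wandering_absurd : False.
Proof.
have d (x y : 'I_3) : val x != val y -> x <> y by move=> K E; move: K; rewrite E eqxx.
apply: (@no_wandering_triangle _ s adr_differ adr_unlinked (@inord 2 0) (@inord 2 1) (@inord 2 2)).
all: by apply: d; rewrite /= !inordK.
Qed.

End Addresses.

Lemma accessible_absurd : False.
Proof.
have [b Hb] : exists b, forall N, ~ far b N z0.
  by apply: contrapT => nb; apply: n0 => b; apply: contrapT => nN; apply: nb; exists b => N fN; apply: nN; exists N.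
(* The landing point falls below [b] infinitely often, and 76 + 4 gives the level [m0 + 80] that
   [hair_strip] requires. *)
pose m := Num.max (m0 + 76) b.
have mm : m0 + 76 <= m by rewrite le_max lexx.
have bm : b <= m by rewrite le_max lexx orbT.
have i1 : 0 < (1 : R) <= 1 by lra.
have /choice [M HM] : forall i, exists M, far (m + 4) M (g i 1).
  by move=> i; have [_ _ _ eg] := ag i; exact: eg.
pose N := \max_i M i.
have fN i : far (m + 4) 0 (F N (g i 1)).
  by apply: far_shift; rewrite add0n; apply: far_le (HM i); exact: leq_bigmax.
have /choice [s Js] : forall i, exists A, inJ (m + 4) A (F N (g i 1)).
  by move=> i; apply: far_inJ (fN i); lra.
apply: (@wandering_absurd N m s mm Js) => k.
apply: contrapT => nk; apply: (Hb (k + N)%N) => j kj.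
rewrite leNgt; apply/negP => hj; apply: nk; exists (j - N)%N.
  by rewrite leq_subRL ?(leq_trans (leq_addl k N)) // addnC.
by rewrite -F_add subnK ?(leq_trans (leq_addl k N)) //; lra.
Qed.

End Contradiction.
End Assembly.

Theorem theorem1p8 (R : realType) (a z0 : R[i]) :
  is_endpoint a z0 -> accessible_three_ways a z0 -> eventually_periodic a z0.
Proof.
move=> [nh _] [A [HA dA]]; apply: contrapT => nep.
have /choice [g Hg] : forall i, exists g, access a z0 g /\ forall t : R, 0 <= t <= 1 -> A i (g t).
  by move=> i; have [h1 h2 h3] := HA i; have [g ? ?] := access_of_arc h1 h2 h3; exists g.
have dis i j : i != j -> forall s t : R, 0 <= s <= 1 -> 0 <= t <= 1 -> g i s = g j t -> g i s = z0.
  move=> ij s t s01 t01 E; have := dA i j ij; move=> /seteqP [sub _].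
  by apply: sub; split; [exact: (Hg i).2|rewrite E; exact: (Hg j).2].
apply: (@accessible_absurd _ a z0 g (fun i => (Hg i).1)) => // e0; apply: nh.
by apply: (access_on_hair (Hg ord0).1 (Hg ord_max).1 _ e0); exact: dis.
Qed.
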